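(* Let $\lambda>0$ and let $Q$ be a contracting homogeneous cubic vector field on $\mathbb{R}^2$. Then the system $\dot X=\lambda X+Q(X)$ is equivalent to one of the following 7 normal forms: (I) $\dot x=\lambda x+3\mu x(x^2+y^2)-y^3$, $\ \dot y=\lambda y+3\mu y(x^2+y^2)+x(x^2+6\mu y^2)$, with $\mu<-\tfrac13$ [here $\mathcal{L}Q=x^4+6\mu x^2y^2+y^4$]; (II) $\dot x=\lambda x-Kx(x^2+y^2)-\alpha y^3$, $\ \dot y=\lambda y-Ky(x^2+y^2)+\alpha x(x^2+6\mu y^2)$, with $\alpha=\pm1$, $\mu>-\tfrac13$, $\mu\ne\tfrac13$, $K=\max\{(3\mu)^2,1/2\}$ [$\mathcal{L}Q=\alpha(x^4+6\mu x^2y^2+y^4)$]; (III) $\dot x=\lambda x-Kx(x^2+y^2)+y^3$, $\ \dot y=\lambda y-Ky(x^2+y^2)+x(x^2+6\mu y^2)$, with $\mu\in\mathbb{R}$, $K=\max\{(3\mu)^2,1/2\}$ [$\mathcal{L}Q=x^4+6\mu x^2y^2-y^4$]; (IV) $\dot x=\lambda x-4x(x^2+y^2)-\alpha y(6x^2+y^2)$, $\ \dot y=\lambda y-4y(x^2+y^2)$, with $\alpha=\pm1$ [$\mathcal{L}Q=\alpha(6x^2y^2+y^4)$]; (V) $\dot x=\lambda x-x(x^2+y^2)-\alpha y(6x^2-y^2)$, $\ \dot y=\lambda y-y(x^2+y^2)$, with $\alpha=\pm1$ [$\mathcal{L}Q=\alpha(6x^2y^2-y^4)$]; (VI) $\dot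 x=\lambda x-x(x^2+y^2)$, $\ \dot y=\lambda y-y(x^2+y^2)+6xy^2$ [$\mathcal{L}Q=6x^2y^2$]; (VII) $\dot x=\lambda x-x(x^2+y^2)$, $\ \dot y=\lambda y-y(x^2+y^2)$ [$\mathcal{L}Q=0$]. The qualitative phase portrait of $\dot X=\lambda X+Q(X)$ is of one of the seven corresponding types, with the following symbol sequences $\sigma(\mathcal{L}Q)$ and numbers of equilibria on the circle at infinity (the same as on the invariant circle): (I) $(1+),(1-),(1+),(1-)$; 8 equilibria, all hyperbolic within the circle; (II) $\varnothing$; no equilibria; (III) $(1+),(1-)$; 4 equilibria, all hyperbolic within the circle; (IV) $(2+)$ or $(2-)$, depending on the value of $\alpha$; 2 equilibria, both saddle-nodes; (V) $(2+),(1-),(1+)$ or $(2-),(1+),(1-)$, depending on the value of $\alpha$; 6 equilibria, of which 4 are hyperbolic within the circle and 2 are saddle-nodes; (VI) $(2+),(2+)$; 4 equilibria (at $\theta=0,\pi/2,\pi,3\pi/2$), all saddle-nodes; (VII) $\infty$; both the invariant circle and the circle at infinity are continua of equilibria.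
   Context: A homogeneous polynomial vector field $Q:\mathbb{R}^2\to\mathbb{R}^2$ is contracting if $\langle X,Q(X)\rangle<0$ for all $X$ with $\|X\|=1$. For $X=(x,y)$ put $\mathcal{L}Q(X)=\langle X^\perp,Q(X)\rangle$, $X^\perp=(-y,x)$; in each normal form $\mathcal{L}Q$ refers to its cubic part. Two systems are equivalent if they have the same dynamics up to a global planar homeomorphism that maps trajectories to trajectories, preserving the time orientation in each trajectory, plus a global rescaling of time. When $Q$ is contracting and $\lambda>0$, the system has a unique invariant topological circle in $\mathbb{R}^2\setminus\{0\}$ (the invariant circle), which surrounds the origin and attracts every trajectory with nonzero initial condition. The flow on it, and the flow on the circle at infinity of the Poincaré disc (the compactification of the plane to a closed disc whose boundary corresponds to infinity), are topologically equivalent to that of $\dot\theta=g(\theta)$, $g(\theta)=\mathcal{L}Q(\cos\theta,\sin\theta)$, $\theta\in[0,2\pi)$. Equilibria are hyperbolic within the circle if they are simple zeros of $g$; they are saddle-nodes if they are isolated zeros of $g$ of even multiplicity. Symbol sequence: for a real homogeneous polynomial $\mathcal{G}$ of degree 4 in two variables and $g(\theta)=\mathcal{G}(\cos\theta,\sin\theta)$, $\sigma(\mathcal{G})$ is the cyclic oriented list $(j_1s_1),\ldots,(j_\ell s_\ell)$ obtained from the ordered zeros $0\le\theta_1<\cdots<\theta_\ell<\pi$ of $g$: $j_i=1$ if the multiplicity of $\theta_i$ is odd, $j_i=2$ if it is even; if $j_i=1$, $s_i=+$ if $g$ is increasing around $\theta_i$ and $s_i=-$ if it is decreasing; if $j_i=2$,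 $s_i=+$ if $\theta_i$ is a local minimum of $g$ and $s_i=-$ if it is a local maximum. $\sigma(\mathcal{G})=\varnothing$ if $g$ has no zeros and $\sigma(\mathcal{G})=\infty$ if $\mathcal{G}\equiv0$.
   Formalization: For the given Q: type (VI) allows (2-),(2-) as well as (2+),(2+), since LQ=-x²y² occurs; type (III) equilibria are odd-multiplicity zeros, since LQ=cx³y has a triple zero; the (VI) angles are stated for the normal form only. The table is as printed for the normal forms. *)

(* Defs.v *)
From Stdlib Require Import Reals List Sorted Arith.
From Coquelicot Require Import Coquelicot.
Open Scope R_scope.
Import ListNotations.

Notation plane := (R * R)%type.

(** * Homogeneous polynomial maps of the plane *)

Definition homogeneous_poly (d : nat) (G : plane -> R) : Prop :=
  exists c : nat -> R, forall x y : R,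
    G (x, y) = sum_f_R0 (fun i => c i * x ^ (d - i) * y ^ i) d.

Definition homogeneous_cubic (Q : plane -> plane) : Prop :=
  homogeneous_poly 3 (fun X => fst (Q X)) /\
  homogeneous_poly 3 (fun X => snd (Q X)).

Definition dot (X Y : plane) : R := fst X * fst Y + snd X * snd Y.

Definition perp (X : plane) : plane := (- snd X, fst X).

Definition contracting (Q : plane -> plane) : Prop :=
  forall X : plane, dot X X = 1 -> dot X (Q X) < 0.

Definition LQ (Q : plane -> plane) (X : plane) : R := dot (perp X) (Q X).

Definition unit_vec (theta : R) : plane := (cos theta, sin theta).

Definition on_circle (G : plane -> R) (theta : R) : R := G (unit_vec theta).

Definition system (lambda : R) (Q : plane -> plane) (X : plane) : plane :=
  (lambda * fst X + fst (Q X), lambda * snd X + snd (Q X)).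

(** * Trajectories and topological equivalence *)

Definition in_itv (a b : Rbar) (t : R) : Prop := Rbar_lt a t /\ Rbar_lt t b.

Definition solution (F : plane -> plane) (a b : Rbar) (phi : R -> plane) : Prop :=
  forall t, in_itv a b t ->
    is_derive (fun u => fst (phi u)) t (fst (F (phi t))) /\
    is_derive (fun u => snd (phi u)) t (snd (F (phi t))).

(** Solutions may blow up in finite time, hence the intervals of definition. *)
Definition maximal_solution (F : plane -> plane) (a b : Rbar) (phi : R -> plane)
    : Prop :=
  Rbar_lt a b /\ solution F a b phi /\
  forall (a' b' : Rbar) (phi' : R -> plane),
    Rbar_le a' a -> Rbar_le b b' -> solution F a' b' phi' ->
    (forall t, in_itv a b t -> phi' t = phi t) ->
    a' = a /\ b' = b.

Definition homeomorphism (h : plane -> plane) : Prop :=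
  exists k : plane -> plane,
    (forall X, k (h X) = X) /\ (forall X, h (k X) = X) /\
    (forall X, continuous h X) /\ (forall X, continuous k X).

Definition increasing_bijection (a b a' b' : Rbar) (tau : R -> R) : Prop :=
  (forall t, in_itv a b t -> in_itv a' b' (tau t)) /\
  (forall t u, in_itv a b t -> in_itv a b u -> t < u -> tau t < tau u) /\
  (forall v, in_itv a' b' v -> exists t, in_itv a b t /\ tau t = v).

(** The homeomorphism may reverse the orientation of the plane.  A rescaling of
    time by a positive constant is a particular reparametrization [tau]. *)
Definition equivalent (F G : plane -> plane) : Prop :=
  exists h : plane -> plane, homeomorphism h /\
    forall (a b : Rbar) (phi : R -> plane), maximal_solution F a b phi ->
      exists (a' b' : Rbar) (psi : R -> plane) (tau : R -> R),
        maximal_solution G a' b' psi /\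
        increasing_bijection a b a' b' tau /\
        forall t, in_itv a b t -> psi (tau t) = h (phi t).

(** * The invariant circle and the circle at infinity *)

Definition topological_circle (C : plane -> Prop) : Prop :=
  exists gamma : R -> plane,
    (forall t, continuous gamma t) /\
    (forall t, gamma (t + 2 * PI) = gamma t) /\
    (forall t u, 0 <= t < 2 * PI -> 0 <= u < 2 * PI ->
       gamma t = gamma u -> t = u) /\
    (forall X, C X <-> exists t, 0 <= t < 2 * PI /\ gamma t = X).

Definition flow_invariant (F : plane -> plane) (C : plane -> Prop) : Prop :=
  forall (a b : Rbar) (phi : R -> plane), solution F a b phi ->
    forall t u, in_itv a b t -> in_itv a b u -> C (phi t) -> C (phi u).

Definition invariant_circle (F : plane -> plane) (C : plane -> Prop) : Prop :=
  topological_circle C /\ ~ C (0, 0) /\ flow_invariant F C.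

Definition the_invariant_circle (F : plane -> plane) (C : plane -> Prop) : Prop :=
  invariant_circle F C /\
  forall C', invariant_circle F C' -> forall X, C' X <-> C X.

(** Flow on the boundary of the Poincare disc, for a polynomial vector field [F]
    of degree at most 3: at the point [r (cos theta, sin theta)] the angular
    velocity is [dot (perp u) (F (r u)) / r] with [u = unit_vec theta]; after the
    rescaling of time by [r ^ 2] it extends continuously to [r = +oo]. *)
Definition infinity_field (F : plane -> plane) (theta : R) : R :=
  real (Lim (fun r => dot (perp (unit_vec theta))
                          (F (r * cos theta, r * sin theta)) / r ^ 3) p_infty).

Definition infinite_equilibrium (F : plane -> plane) (theta : R) : Prop :=
  0 <= theta < 2 * PI /\ infinity_field F theta = 0.

Definition equilibrium_on (F : plane -> plane) (C : plane -> Prop) (X : plane)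
    : Prop :=
  C X /\ F X = (0, 0).

Definition has_angle (X : plane) (theta : R) : Prop :=
  exists r, 0 < r /\ X = (r * cos theta, r * sin theta).

(** * Zeros of a function of the angle *)

Definition multiplicity (g : R -> R) (theta : R) (m : nat) : Prop :=
  (forall k, (k < m)%nat -> Derive_n g k theta = 0) /\ Derive_n g m theta <> 0.

Definition odd_zero (g : R -> R) (theta : R) : Prop :=
  g theta = 0 /\ exists m, Nat.Odd m /\ multiplicity g theta m.

Definition even_zero (g : R -> R) (theta : R) : Prop :=
  g theta = 0 /\ exists m, Nat.Even m /\ multiplicity g theta m.

Definition isolated_zero (g : R -> R) (theta : R) : Prop :=
  g theta = 0 /\
  exists eps, 0 < eps /\ forall t, 0 < Rabs (t - theta) < eps -> g t <> 0.

Definition simple_zero (g : R -> R) (theta : R) : Prop :=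
  g theta = 0 /\ multiplicity g theta 1.

Definition saddle_node_zero (g : R -> R) (theta : R) : Prop :=
  isolated_zero g theta /\ even_zero g theta.

(** * Symbol sequences *)

Inductive pm := Plus | Minus.

Definition opp_sign (s : pm) : pm :=
  match s with Plus => Minus | Minus => Plus end.

Definition sign_val (s : pm) : R :=
  match s with Plus => 1 | Minus => -1 end.

Inductive parity := One | Two.

Definition symbol := (parity * pm)%type.

Definition increasing_around (g : R -> R) (theta : R) : Prop :=
  exists eps, 0 < eps /\
    forall t u, theta - eps < t -> t < u -> u < theta + eps -> g t < g u.

Definition local_min (g : R -> R) (theta : R) : Prop :=
  exists eps, 0 < eps /\
    forall t, theta - eps < t < theta + eps -> g theta <= g t.

Definition symbol_at (g : R -> R) (theta : R) (js : symbol) : Prop :=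
  match js with
  | (One, Plus) => odd_zero g theta /\ increasing_around g theta
  | (One, Minus) => odd_zero g theta /\ increasing_around (fun t => - g t) theta
  | (Two, Plus) => even_zero g theta /\ local_min g theta
  | (Two, Minus) => even_zero g theta /\ local_min (fun t => - g t) theta
  end.

Inductive symbols :=
  | Finite_seq (l : list symbol)   (* the empty sequence is [Finite_seq []] *)
  | Infinite_seq.

Definition cyclic_eq {A : Type} (l l' : list A) : Prop :=
  exists l1 l2, l = l1 ++ l2 /\ l' = l2 ++ l1.

(** [symbol_sequence G s]: the sequence of [G] is [s], finite sequences being
    considered up to rotation. *)
Definition symbol_sequence (G : plane -> R) (s : symbols) : Prop :=
  match s with
  | Infinite_seq => forall X, G X = 0
  | Finite_seq l =>
      exists (zs : list R) (l' : list symbol),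
        StronglySorted Rlt zs /\
        (forall theta,
           In theta zs <-> 0 <= theta < PI /\ on_circle G theta = 0) /\
        Forall2 (symbol_at (on_circle G)) zs l' /\
        cyclic_eq l' l
  end.

(** * Normal forms *)

Inductive normal_form :=
  | NF_I (mu : R)
  | NF_II (alpha : pm) (mu : R)
  | NF_III (mu : R)
  | NF_IV (alpha : pm)
  | NF_V (alpha : pm)
  | NF_VI
  | NF_VII.

Definition admissible (N : normal_form) : Prop :=
  match N with
  | NF_I mu => mu < - (1 / 3)
  | NF_II _ mu => - (1 / 3) < mu /\ mu <> 1 / 3
  | _ => True
  end.

Definition K_of (mu : R) : R := Rmax ((3 * mu) ^ 2) (1 / 2).

(** Cubic part of the normal form. *)
Definition nf_field (N : normal_form) (X : plane) : plane :=
  let (x, y) := X in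
  match N with
  | NF_I mu =>
      (3 * mu * x * (x ^ 2 + y ^ 2) - y ^ 3,
       3 * mu * y * (x ^ 2 + y ^ 2) + x * (x ^ 2 + 6 * mu * y ^ 2))
  | NF_II alpha mu =>
      (- K_of mu * x * (x ^ 2 + y ^ 2) - sign_val alpha * y ^ 3,
       - K_of mu * y * (x ^ 2 + y ^ 2)
         + sign_val alpha * x * (x ^ 2 + 6 * mu * y ^ 2))
  | NF_III mu =>
      (- K_of mu * x * (x ^ 2 + y ^ 2) + y ^ 3,
       - K_of mu * y * (x ^ 2 + y ^ 2) + x * (x ^ 2 + 6 * mu * y ^ 2))
  | NF_IV alpha =>
      (- 4 * x * (x ^ 2 + y ^ 2) - sign_val alpha * y * (6 * x ^ 2 + y ^ 2),
       - 4 * y * (x ^ 2 + y ^ 2))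
  | NF_V alpha =>
      (- x * (x ^ 2 + y ^ 2) - sign_val alpha * y * (6 * x ^ 2 - y ^ 2),
       - y * (x ^ 2 + y ^ 2))
  | NF_VI =>
      (- x * (x ^ 2 + y ^ 2), - y * (x ^ 2 + y ^ 2) + 6 * x * y ^ 2)
  | NF_VII =>
      (- x * (x ^ 2 + y ^ 2), - y * (x ^ 2 + y ^ 2))
  end.

Definition nf_LQ (N : normal_form) (X : plane) : R :=
  let (x, y) := X in
  match N with
  | NF_I mu => x ^ 4 + 6 * mu * x ^ 2 * y ^ 2 + y ^ 4
  | NF_II alpha mu =>
      sign_val alpha * (x ^ 4 + 6 * mu * x ^ 2 * y ^ 2 + y ^ 4)
  | NF_III mu => x ^ 4 + 6 * mu * x ^ 2 * y ^ 2 - y ^ 4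
  | NF_IV alpha => sign_val alpha * (6 * x ^ 2 * y ^ 2 + y ^ 4)
  | NF_V alpha => sign_val alpha * (6 * x ^ 2 * y ^ 2 - y ^ 4)
  | NF_VI => 6 * x ^ 2 * y ^ 2
  | NF_VII => 0
  end.

Definition nf_symbols (N : normal_form) : symbols :=
  match N with
  | NF_I _ => Finite_seq [(One, Plus); (One, Minus); (One, Plus); (One, Minus)]
  | NF_II _ _ => Finite_seq []
  | NF_III _ => Finite_seq [(One, Plus); (One, Minus)]
  | NF_IV alpha => Finite_seq [(Two, alpha)]
  | NF_V alpha =>
      Finite_seq [(Two, alpha); (One, opp_sign alpha); (One, alpha)]
  | NF_VI => Finite_seq [(Two, Plus); (Two, Plus)]
  | NF_VII => Infinite_seq
  end.

(** Numbers of hyperbolic equilibria and of saddle-nodes on each circle; [None]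
    for a continuum of equilibria. *)
Definition nf_counts (N : normal_form) : option (nat * nat) :=
  match N with
  | NF_I _ => Some (8, 0)%nat
  | NF_II _ _ => Some (0, 0)%nat
  | NF_III _ => Some (4, 0)%nat
  | NF_IV _ => Some (0, 2)%nat
  | NF_V _ => Some (4, 2)%nat
  | NF_VI => Some (0, 4)%nat
  | NF_VII => None
  end.

(** * Phase portraits *)

Definition has_card {A : Type} (P : A -> Prop) (n : nat) : Prop :=
  exists l : list A, NoDup l /\ length l = n /\ forall x, In x l <-> P x.

(** The equilibria [E] are [h + s] in number, [h] satisfying [hyp] and [s]
    satisfying [sn]. *)
Definition equilibria_split {A : Type} (E hyp sn : A -> Prop) (h s : nat) : Prop :=
  has_card E (h + s) /\
  has_card (fun x => E x /\ hyp x) h /\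
  has_card (fun x => E x /\ sn x) s.

Definition portrait_at_infinity (hyp : (R -> R) -> R -> Prop) (N : normal_form)
    (lambda : R) (Q : plane -> plane) : Prop :=
  let F := system lambda Q in
  let g := on_circle (LQ Q) in
  match nf_counts N with
  | Some (h, s) =>
      equilibria_split (infinite_equilibrium F) (hyp g) (saddle_node_zero g) h s
  | None => forall theta, 0 <= theta < 2 * PI -> infinite_equilibrium F theta
  end.

Definition portrait_on (hyp : (R -> R) -> R -> Prop) (N : normal_form)
    (lambda : R) (Q : plane -> plane) (C : plane -> Prop) : Prop :=
  let F := system lambda Q in
  let g := on_circle (LQ Q) in
  match nf_counts N with
  | Some (h, s) =>
      equilibria_split (equilibrium_on F C)
        (fun X => exists theta, has_angle X theta /\ hyp g theta)
        (fun X => exists theta, has_angle X theta /\ saddle_node_zero g theta)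
        h s
  | None => forall X, C X -> equilibrium_on F C X
  end.

Definition axis_angles : list R := [0; PI / 2; PI; 3 * PI / 2].

(** For a field of the same type as [NF_III], an odd zero of [g] may be triple,
    as for [LQ = x ^ 3 * y]: linear hyperbolicity holds in the normal form, but
    it is not preserved by topological equivalence. *)
Definition hyperbolic_as (N : normal_form) : (R -> R) -> R -> Prop :=
  match N with NF_III _ => odd_zero | _ => simple_zero end.

(** The form [- x ^ 2 * y ^ 2] has symbol sequence (2-),(2-); the reflection
    (x,y) -> (y,x) brings the corresponding fields to type [NF_VI]. *)
Definition symbols_as (N : normal_form) (G : plane -> R) : Prop :=
  symbol_sequence G (nf_symbols N) \/
  (N = NF_VI /\ symbol_sequence G (Finite_seq [(Two, Minus); (Two, Minus)])).

(* Main.v *)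
(** Write [X = r (cos theta, sin theta)], and let [f] and [g] be the radial and angular
    components of [Q] on the unit circle.  In the time [ds = r ^ 2 dt] the angle satisfies
    [theta' = g theta] and [r ^ 2] a linear equation, so the invariant circle is a graph
    [r ^ 2 = rho2 theta], with [rho2] an integral along the backward orbit of [theta].  By
    homogeneity, every other solution is [sqrt (w t) * Y (y t)], where [Y] is a solution on
    the circle and [w], [y] are explicit functions of [t].  Therefore a homeomorphism which
    conjugates the flows on two invariant circles, up to a constant factor in time, extends
    to an equivalence of the two systems.  The circle flows are conjugate as soon as the
    signs of [g] between consecutive zeros agree; [g] comes from a quartic form, which is a
    product of factors [sin (theta - z)] and of a form without zeros, and this leaves few
    patterns of signs and multiplicities. *)

From Stdlib Require Import ZArith Reals Lra Lia Ranalysis5.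
From Stdlib Require Import ClassicalEpsilon FunctionalExtensionality PropExtensionality.
From Stdlib Require FinFun.
From Coquelicot Require Import Coquelicot.
From Stdlib Require Import List Sorted.
Require Import Defs.
Import ListNotations.
Open Scope R_scope.

(** With [r ^ 2 = rho2 theta * W], the ratio [W] satisfies the logistic equation
    [W' = 2 lambda W (1 - W)], whatever [f] and [g] are. This is why the planar flow is explicit
    once the flow on the circle is known: blow-up in the past outside the circle, decay to the
    origin inside it and the convergence to it are all read off from one formula. An equivalence
    sees only the directions of motion on the circle. Hence the value of [mu] inside a family is
    free, and one convenient value per family suffices. The obstacle is in [NF_V] and [NF_VI], whose
    coefficients are prescribed and whose radial component takes both signs; there [r ^ 2] is
    replaced by the quadratic form [y ^ 2 + r ^ 2 / 16], respectively [x ^ 2 + r ^ 2 / 16], which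
    tames the shear. All functions of the angle have period [PI], so that conjugacies are built on
    half a turn. Two patterns need more than a matching of arcs: without zeros the periods must be
    made equal, and two double zeros with [g <= 0] need an orientation-reversing homeomorphism,
    because [NF_VI] carries no sign. *)

(** * Rules of differentiation, monotonicity and Gronwall's inequality *)

Lemma is_derive_continuity_pt (f : R -> R) (x l : R) :
  is_derive f x l -> continuity_pt f x.
Proof.
  intros H. apply derivable_continuous_pt. exists l.
  now apply is_derive_Reals.
Qed.

Lemma is_derive_continuous (f : R -> R) (x l : R) :
  is_derive f x l -> continuous f x.
Proof. intros H. apply (ex_derive_continuous f x). now exists l. Qed.

Lemma is_derive_eq (f : R -> R) (x l l' : R) :
  is_derive f x l -> l = l' -> is_derive f x l'.
Proof. now intros H <-. Qed.

Lemma is_derive_ext_R (f g : R -> R) (x l : R) :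
  (forall y, f y = g y) -> is_derive f x l -> is_derive g x l.
Proof. apply (is_derive_ext f g). Qed.

Lemma is_derive_const_R (c x : R) : is_derive (fun _ : R => c) x 0.
Proof. apply (@is_derive_const R_AbsRing). Qed.

Lemma is_derive_id_R (x : R) : is_derive (fun y : R => y) x 1.
Proof. apply (@is_derive_id R_AbsRing). Qed.

Lemma is_derive_plus_R (f g : R -> R) (x l m : R) :
  is_derive f x l -> is_derive g x m -> is_derive (fun y => f y + g y) x (l + m).
Proof. apply (is_derive_plus f g). Qed.

Lemma is_derive_minus_R (f g : R -> R) (x l m : R) :
  is_derive f x l -> is_derive g x m -> is_derive (fun y => f y - g y) x (l - m).
Proof. apply (is_derive_minus f g). Qed.

Lemma is_derive_opp_R (f : R -> R) (x l : R) :
  is_derive f x l -> is_derive (fun y => - f y) x (- l).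
Proof. apply (is_derive_opp f). Qed.

Lemma is_derive_mult_R (f g : R -> R) (x l m : R) :
  is_derive f x l -> is_derive g x m ->
  is_derive (fun y => f y * g y) x (l * g x + f x * m).
Proof. intros Hf Hg. apply (is_derive_mult f g); auto. intros; apply Rmult_comm. Qed.

Lemma is_derive_comp_R (f g : R -> R) (x l m : R) :
  is_derive f (g x) l -> is_derive g x m -> is_derive (fun y => f (g y)) x (m * l).
Proof. apply (is_derive_comp f g). Qed.

Lemma nondecreasing_derive (f df : R -> R) (a b : R) :
  a <= b -> (forall x, a <= x <= b -> is_derive f x (df x)) ->
  (forall x, a <= x <= b -> 0 <= df x) -> f a <= f b.
Proof.
  intros Hab Hd Hp.
  destruct (MVT_gen f a b df) as [c [Hc E]].
  - intros x Hx. apply Hd. rewrite Rmin_left, Rmax_right in Hx; lra.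
  - intros x Hx. eapply is_derive_continuity_pt. apply Hd.
    rewrite Rmin_left, Rmax_right in Hx; lra.
  - rewrite Rmin_left, Rmax_right in Hc by lra.
    assert (0 <= df c * (b - a)) by (apply Rmult_le_pos; [apply Hp; lra | lra]).
    lra.
Qed.

Lemma increasing_derive (f df : R -> R) (a b : R) :
  a < b -> (forall x, a <= x <= b -> is_derive f x (df x)) ->
  (forall x, a <= x <= b -> 0 < df x) -> f a < f b.
Proof.
  intros Hab Hd Hp.
  destruct (MVT_gen f a b df) as [c [Hc E]].
  - intros x Hx. apply Hd. rewrite Rmin_left, Rmax_right in Hx; lra.
  - intros x Hx. eapply is_derive_continuity_pt. apply Hd.
    rewrite Rmin_left, Rmax_right in Hx; lra.
  - rewrite Rmin_left, Rmax_right in Hc by lra.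
    assert (0 < df c * (b - a)) by (apply Rmult_lt_0_compat; [apply Hp; lra | lra]).
    lra.
Qed.

Lemma exp_le_compat (x y : R) : x <= y -> exp x <= exp y.
Proof. intros [H | ->]; [left; now apply exp_increasing | apply Rle_refl]. Qed.

(** Forwards, [D s * exp (- L * (s - t0))] does not increase; backwards, [D s * exp (L * (s - t0))]
    does not decrease. The bound on the absolute value of the derivative serves both directions of
    time. *)
Lemma gronwall (D dD : R -> R) (L t0 t : R) :
  (forall s, Rmin t0 t <= s <= Rmax t0 t ->
     is_derive D s (dD s) /\ Rabs (dD s) <= L * D s) ->
  D t <= D t0 * exp (L * Rabs (t - t0)).
Proof.
  intros H. destruct (Rle_dec t0 t) as [Ht | Ht].
  - rewrite Rmin_left, Rmax_right in H by lra.
    rewrite Rabs_pos_eq by lra.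
    assert (M : D t0 * exp (- L * (t0 - t0)) >= D t * exp (- L * (t - t0))).
    { apply Rle_ge, Ropp_le_cancel.
      apply (nondecreasing_derive (fun s => - (D s * exp (- L * (s - t0))))
        (fun s => - ((dD s - L * D s) * exp (- L * (s - t0))))).
      - lra.
      - intros s Hs. destruct (H s Hs) as [H1 _].
        auto_derive; [now exists (dD s) |].
        rewrite (is_derive_unique (fun x : R => D x) _ _ H1). ring_simplify. unfold Rminus. ring.
      - intros s Hs. destruct (H s Hs) as [_ H2].
        apply Rabs_le_between in H2. pose proof (exp_pos (- L * (s - t0))). nra. }
    replace (- L * (t0 - t0)) with 0 in M by ring. rewrite exp_0 in M.
    replace (- L * (t - t0)) with (- (L * (t - t0))) in M by ring.
    rewrite exp_Ropp in M. pose proof (exp_pos (L * (t - t0))) as P.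
    apply Rmult_le_reg_r with (/ exp (L * (t - t0))).
    + now apply Rinv_0_lt_compat.
    + rewrite Rmult_assoc, Rinv_r by lra. lra.
  - rewrite Rmin_right, Rmax_left in H by lra.
    rewrite Rabs_left by lra.
    assert (M : D t * exp (L * (t - t0)) <= D t0 * exp (L * (t0 - t0))).
    { apply (nondecreasing_derive (fun s => D s * exp (L * (s - t0)))
        (fun s => (dD s + L * D s) * exp (L * (s - t0)))).
      - lra.
      - intros s Hs. destruct (H s Hs) as [H1 _].
        auto_derive; [now exists (dD s) |].
        rewrite (is_derive_unique (fun x : R => D x) _ _ H1). unfold Rminus. ring.
      - intros s Hs. destruct (H s Hs) as [_ H2].
        apply Rabs_le_between in H2. pose proof (exp_pos (L * (s - t0))). nra. }
    replace (L * (t0 - t0)) with 0 in M by ring. rewrite exp_0 in M.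
    replace (L * - (t - t0)) with (- (L * (t - t0))) by ring.
    rewrite exp_Ropp. pose proof (exp_pos (L * (t - t0))) as P.
    apply Rmult_le_reg_r with (exp (L * (t - t0))); [assumption |].
    rewrite Rmult_assoc, Rinv_l by lra. lra.
Qed.

Lemma gronwall_zero (D dD : R -> R) (L t0 t : R) :
  (forall s, Rmin t0 t <= s <= Rmax t0 t ->
     is_derive D s (dD s) /\ Rabs (dD s) <= L * D s) ->
  D t0 = 0 -> D t <= 0.
Proof.
  intros H H0. pose proof (gronwall D dD L t0 t H) as G. rewrite H0 in G. lra.
Qed.

(** * Bounded Lipschitz functions *)

(** Boundedness is what lets the Lipschitz property pass to products; it also bounds the speed of
    the flows. *)
Definition bounded_lipschitz (u : R -> R) : Prop :=
  exists L, 0 < L /\ (forall x, Rabs (u x) <= L) /\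
    forall x y, Rabs (u x - u y) <= L * Rabs (x - y).

Lemma bounded_lipschitz_const (c : R) : bounded_lipschitz (fun _ => c).
Proof.
  exists (Rabs c + 1). pose proof (Rabs_pos c). repeat split; intros; try lra.
  rewrite Rminus_diag, Rabs_R0. apply Rmult_le_pos; [lra | apply Rabs_pos].
Qed.

Lemma bounded_lipschitz_derive (u du : R -> R) (L : R) :
  (forall x, is_derive u x (du x)) -> (forall x, Rabs (u x) <= L) ->
  (forall x, Rabs (du x) <= L) -> bounded_lipschitz u.
Proof.
  intros Hd Hb Hl. exists (L + 1).
  assert (0 <= L) by (eapply Rle_trans; [apply Rabs_pos | apply (Hb 0)]).
  repeat split; [lra | intros x; specialize (Hb x); lra |].
  intros x y.
  destruct (MVT_gen u y x du) as [c [_ E]].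
  - intros; apply Hd.
  - intros; eapply is_derive_continuity_pt, Hd.
  - rewrite E, Rabs_mult. apply Rmult_le_compat_r; [apply Rabs_pos |].
    specialize (Hl c); lra.
Qed.

Lemma bounded_lipschitz_sin : bounded_lipschitz sin.
Proof.
  apply bounded_lipschitz_derive with cos 1.
  - intros x. apply is_derive_sin.
  - intros x. apply Rabs_le, SIN_bound.
  - intros x. apply Rabs_le, COS_bound.
Qed.

Lemma bounded_lipschitz_cos : bounded_lipschitz cos.
Proof.
  apply bounded_lipschitz_derive with (fun x => - sin x) 1.
  - intros x. apply is_derive_cos.
  - intros x. apply Rabs_le, COS_bound.
  - intros x. rewrite Rabs_Ropp. apply Rabs_le, SIN_bound.
Qed.

Lemma bounded_lipschitz_plus (u w : R -> R) :
  bounded_lipschitz u -> bounded_lipschitz w -> bounded_lipschitz (fun x => u x + w x).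
Proof.
  intros [L [HL [B1 L1]]] [M [HM [B2 L2]]]. exists (L + M). repeat split; [lra | |].
  - intros x. eapply Rle_trans; [apply Rabs_triang |]. specialize (B1 x). specialize (B2 x). lra.
  - intros x y. replace (u x + w x - (u y + w y)) with ((u x - u y) + (w x - w y)) by ring.
    eapply Rle_trans; [apply Rabs_triang |]. specialize (L1 x y). specialize (L2 x y). lra.
Qed.

Lemma bounded_lipschitz_mult (u w : R -> R) :
  bounded_lipschitz u -> bounded_lipschitz w -> bounded_lipschitz (fun x => u x * w x).
Proof.
  intros [L [HL [B1 L1]]] [M [HM [B2 L2]]]. exists (2 * (L * M)).
  assert (0 < L * M) by nra.
  repeat split; [lra | |].
  - intros x. rewrite Rabs_mult. specialize (B1 x). specialize (B2 x).
    assert (Rabs (u x) * Rabs (w x) <= L * M)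
      by (apply Rmult_le_compat; try apply Rabs_pos; assumption). lra.
  - intros x y. replace (u x * w x - u y * w y) with ((u x - u y) * w x + u y * (w x - w y)) by ring.
    eapply Rle_trans; [apply Rabs_triang |]. rewrite !Rabs_mult.
    assert (Rabs (u x - u y) * Rabs (w x) <= L * Rabs (x - y) * M)
      by (apply Rmult_le_compat; try apply Rabs_pos; auto).
    assert (Rabs (u y) * Rabs (w x - w y) <= L * (M * Rabs (x - y)))
      by (apply Rmult_le_compat; try apply Rabs_pos; auto).
    lra.
Qed.

Lemma bounded_lipschitz_inv (u : R -> R) (c : R) :
  0 < c -> (forall x, c <= Rabs (u x)) -> bounded_lipschitz u ->
  bounded_lipschitz (fun x => / u x).
Proof.
  intros Hc Hu [L [HL [B1 L1]]].
  assert (Hi : forall x, Rabs (/ u x) <= / c).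
  { intros x. rewrite Rabs_inv. apply Rinv_le_contravar; auto. }
  assert (Hn : forall x, u x <> 0).
  { intros x E. specialize (Hu x). rewrite E, Rabs_R0 in Hu. lra. }
  assert (0 < / c) by now apply Rinv_0_lt_compat.
  exists (/ c + L * (/ c * / c)).
  assert (0 < L * (/ c * / c)) by (apply Rmult_lt_0_compat; [| apply Rmult_lt_0_compat]; lra).
  repeat split; [lra | |].
  - intros x. specialize (Hi x). lra.
  - intros x y.
    replace (/ u x - / u y) with (- (u x - u y) * (/ u x * / u y)) by (field; auto).
    rewrite !Rabs_mult, Rabs_Ropp.
    assert (Rabs (/ u x) * Rabs (/ u y) <= / c * / c)
      by (apply Rmult_le_compat; try apply Rabs_pos; auto).
    assert (Rabs (u x - u y) * (Rabs (/ u x) * Rabs (/ u y)) <= L * Rabs (x - y) * (/ c * / c)).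
    { apply Rmult_le_compat; auto; [apply Rabs_pos |].
      apply Rmult_le_pos; apply Rabs_pos. }
    assert (0 <= / c * Rabs (x - y)) by (apply Rmult_le_pos; [lra | apply Rabs_pos]).
    lra.
Qed.

Lemma lipschitz_continuous (u : R -> R) (L x : R) :
  (forall y, Rabs (u y - u x) <= L * Rabs (y - x)) -> continuous u x.
Proof.
  intros H. apply continuity_pt_filterlim. intros eps Heps.
  (* Nothing is assumed on the sign of [L], hence [Rabs L + 1] in the denominator. *)
  exists (eps / (Rabs L + 1)). pose proof (Rabs_pos L) as PL. split.
  - apply Rdiv_lt_0_compat; lra.
  - intros y [_ Hy]. simpl in *. unfold R_dist in *.
    eapply Rle_lt_trans; [apply H |].
    apply Rle_lt_trans with ((Rabs L + 1) * Rabs (y - x)).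
    + apply Rmult_le_compat_r; [apply Rabs_pos |]. pose proof (Rle_abs L). lra.
    + apply Rmult_lt_reg_r with (/ (Rabs L + 1)); [apply Rinv_0_lt_compat; lra |].
      unfold Rdiv in Hy. rewrite (Rmult_comm (Rabs L + 1)), Rmult_assoc, Rinv_r by lra. lra.
Qed.

Lemma bounded_lipschitz_continuous (u : R -> R) (x : R) :
  bounded_lipschitz u -> continuous u x.
Proof.
  intros [L [_ [_ H]]]. apply lipschitz_continuous with L. intros y. apply H.
Qed.

(** * Flows of bounded Lipschitz functions on the line *)

(** In the norm weighted by [exp (- K * Rabs t)], integration from 0 has norm at most [1 / K]. With
    this weight Picard's iteration contracts on the whole line at once, and no local solutions have
    to be glued. *)
Lemma primitive_exp_bound_pos (F h : R -> R) (c K t : R) :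
  0 < K -> 0 <= c -> 0 <= t -> F 0 = 0 ->
  (forall s, is_derive F s (h s)) -> (forall s, Rabs (h s) <= c * exp (K * Rabs s)) ->
  Rabs (F t) <= c / K * exp (K * t).
Proof.
  intros HK Hc Ht F0 Hd Hb.
  assert (P : 0 <= c / K) by (apply Rdiv_le_0_compat; lra).
  assert (A : forall s, is_derive (fun s => c / K * exp (K * s)) s (c * exp (K * s))).
  { intros s. auto_derive; [trivial |]. field. lra. }
  apply Rabs_le. split.
  - assert (M : c / K * exp (K * 0) + F 0 <= c / K * exp (K * t) + F t).
    { apply (nondecreasing_derive (fun s => c / K * exp (K * s) + F s)
        (fun s => c * exp (K * s) + h s)); [lra | |].
      - intros s _. apply (is_derive_plus_R (fun s => c / K * exp (K * s)) F); auto.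
      - intros s Hs. specialize (Hb s). rewrite (Rabs_pos_eq s) in Hb by lra.
        apply Rabs_le_between in Hb. lra. }
    rewrite F0, Rmult_0_r, exp_0 in M. lra.
  - assert (M : c / K * exp (K * 0) - F 0 <= c / K * exp (K * t) - F t).
    { apply (nondecreasing_derive (fun s => c / K * exp (K * s) - F s)
        (fun s => c * exp (K * s) - h s)); [lra | |].
      - intros s _. apply (is_derive_minus_R (fun s => c / K * exp (K * s)) F); auto.
      - intros s Hs. specialize (Hb s). rewrite (Rabs_pos_eq s) in Hb by lra.
        apply Rabs_le_between in Hb. lra. }
    rewrite F0, Rmult_0_r, exp_0 in M. lra.
Qed.

Lemma is_derive_reflect (F : R -> R) (t l : R) :
  is_derive F (- t) l -> is_derive (fun s => F (- s)) t (- l).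
Proof.
  intros H. eapply is_derive_eq.
  - apply (is_derive_comp_R F Ropp); [exact H |].
    apply (is_derive_opp_R (fun x => x)), is_derive_id_R.
  - ring.
Qed.

Lemma primitive_exp_bound (F h : R -> R) (c K t : R) :
  0 < K -> 0 <= c -> F 0 = 0 ->
  (forall s, is_derive F s (h s)) -> (forall s, Rabs (h s) <= c * exp (K * Rabs s)) ->
  Rabs (F t) <= c / K * exp (K * Rabs t).
Proof.
  intros HK Hc F0 Hd Hb. destruct (Rle_dec 0 t) as [Ht | Ht].
  - rewrite (Rabs_pos_eq t) by lra. eapply primitive_exp_bound_pos; eauto.
  - rewrite (Rabs_left t) by lra. replace (F t) with (F (- - t)) by (f_equal; ring).
    apply (primitive_exp_bound_pos (fun s => F (- s)) (fun s => - h (- s))); auto; try lra.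
    + rewrite Ropp_0; assumption.
    + intros s. apply is_derive_reflect, Hd.
    + intros s. rewrite Rabs_Ropp, <- (Rabs_Ropp s). apply Hb.
Qed.

Lemma is_derive_RInt_0 (h : R -> R) (t : R) :
  (forall s, continuous h s) -> is_derive (fun s => RInt h 0 s) t (h t).
Proof.
  intros H. apply (is_derive_RInt h _ 0); [| apply H].
  apply filter_forall. intros s. apply (@RInt_correct R_CompleteNormedModule).
  apply (@ex_RInt_continuous R_CompleteNormedModule). intros z _. apply H.
Qed.

Lemma continuous_comp_R (u w : R -> R) (x : R) :
  continuous u x -> continuous w (u x) -> continuous (fun y => w (u y)) x.
Proof. apply (continuous_comp u w). Qed.

Lemma geometric_cauchy (u : nat -> R) (c : R) :
  (forall n, Rabs (u (S n) - u n) <= c * (1 / 2) ^ n) ->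
  exists l, forall n, Rabs (l - u n) <= 2 * c * (1 / 2) ^ n.
Proof.
  intros H.
  (* The difference of the two powers, and not [(1 / 2) ^ n] alone, is the bound that survives the
     induction on [k]. *)
  assert (Hk : forall n k, Rabs (u (n + k)%nat - u n) <= 2 * c * ((1 / 2) ^ n - (1 / 2) ^ (n + k))).
  { intros n k. induction k as [| k IH].
    - rewrite Nat.add_0_r, !Rminus_diag, Rabs_R0. lra.
    - rewrite Nat.add_succ_r.
      replace (u (S (n + k)) - u n) with ((u (S (n + k)) - u (n + k)%nat) + (u (n + k)%nat - u n)) by ring.
      eapply Rle_trans; [apply Rabs_triang |]. specialize (H (n + k)%nat).
      simpl pow at 2. lra. }
  assert (Hc : 0 <= c).
  { specialize (H 0%nat). simpl in H. pose proof (Rabs_pos (u 1%nat - u 0%nat)). lra. }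
  assert (Hp : forall n, 0 < (1 / 2) ^ n) by (intros n; apply pow_lt; lra).
  assert (Hk' : forall n k, Rabs (u (n + k)%nat - u n) <= 2 * c * (1 / 2) ^ n).
  { intros n k. eapply Rle_trans; [apply Hk |].
    apply Rmult_le_compat_l; [lra |]. specialize (Hp (n + k)%nat). lra. }
  assert (Hlim : is_lim_seq (fun n => 2 * c * (1 / 2) ^ n) 0).
  { replace (Finite 0) with (Rbar_mult (2 * c) 0) by (simpl; f_equal; ring).
    apply is_lim_seq_scal_l, is_lim_seq_geom. rewrite Rabs_pos_eq; lra. }
  assert (HC : ex_finite_lim_seq u).
  { apply ex_lim_seq_cauchy_corr. intros eps.
    apply is_lim_seq_spec in Hlim. destruct (Hlim (pos_div_2 eps)) as [N HN].
    exists N. intros n m Hn Hm.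
    specialize (HN N (Nat.le_refl N)). rewrite Rminus_0_r in HN.
    pose proof (Rle_abs (2 * c * (1 / 2) ^ N)). simpl in HN.
    pose proof (Hk' N (n - N)%nat) as A. replace (N + (n - N))%nat with n in A by lia.
    pose proof (Hk' N (m - N)%nat) as B. replace (N + (m - N))%nat with m in B by lia.
    apply Rabs_le_between in A. apply Rabs_le_between in B.
    apply Rabs_lt_between. lra. }
  destruct HC as [l Hl]. exists l. intros n.
  assert (Hl' : is_lim_seq (fun k => Rabs (u (n + k)%nat - u n)) (Rabs (l - u n))).
  { apply (is_lim_seq_abs _ (Finite (l - u n))).
    apply is_lim_seq_minus' ; [| apply is_lim_seq_const].
    apply (is_lim_seq_ext (fun k => u (k + n)%nat)); [intros k; f_equal; lia |].
    now apply -> is_lim_seq_incr_n. }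
  apply (is_lim_seq_le _ (fun _ => 2 * c * (1 / 2) ^ n) (Finite _) (Finite _) (Hk' n) Hl').
  apply is_lim_seq_const.
Qed.

Lemma geometric_small (c eps : R) : 0 < eps -> exists n, c * (1 / 2) ^ n < eps.
Proof.
  intros He.
  assert (Hlim : is_lim_seq (fun n => c * (1 / 2) ^ n) 0).
  { replace (Finite 0) with (Rbar_mult c 0) by (simpl; f_equal; ring).
    apply is_lim_seq_scal_l, is_lim_seq_geom. rewrite Rabs_pos_eq; lra. }
  apply is_lim_seq_spec in Hlim. destruct (Hlim (mkposreal eps He)) as [N HN].
  exists N. specialize (HN N (Nat.le_refl N)). simpl in HN. rewrite Rminus_0_r in HN.
  eapply Rle_lt_trans; [apply Rle_abs | exact HN].
Qed.

Fixpoint picard (v : R -> R) (x : R) (n : nat) (t : R) : R :=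
  match n with
  | O => x
  | S n => x + RInt (fun s => v (picard v x n s)) 0 t
  end.

Lemma picard_derive (v : R -> R) (x : R) (n : nat) (t : R) :
  (forall y, continuous v y) ->
  is_derive (picard v x (S n)) t (v (picard v x n t)).
Proof.
  intros Hv. revert t. induction n as [| n IH]; intros t.
  - simpl. eapply is_derive_eq.
    + apply is_derive_plus_R; [apply is_derive_const_R |].
      apply (is_derive_RInt_0 (fun _ => v x)). intros s. apply continuous_const.
    + ring.
  - change (picard v x (S (S n))) with (fun t => x + RInt (fun s => v (picard v x (S n) s)) 0 t).
    eapply is_derive_eq.
    + apply is_derive_plus_R; [apply is_derive_const_R |].
      apply (is_derive_RInt_0 (fun s => v (picard v x (S n) s))). intros s.
      apply (continuous_comp_R (picard v x (S n)) v); [| apply Hv].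
      eapply is_derive_continuous, IH.
    + ring.
Qed.

(** Picard's iteration in the weighted norm with [K = 2 * L]: the Lipschitz constant [L] divided by
    [2 * L] halves the distance of consecutive iterates at each step. *)
Lemma scalar_flow_exists (v : R -> R) :
  bounded_lipschitz v ->
  exists Phi : R -> R -> R,
    (forall x, Phi x 0 = x) /\ (forall x t, is_derive (Phi x) t (v (Phi x t))).
Proof.
  intros Hv. assert (Hc : forall y, continuous v y) by (intros; now apply bounded_lipschitz_continuous).
  destruct Hv as [L [HL [Hb Hl]]].
  assert (Hx : forall x, exists y : R -> R, y 0 = x /\ forall t, is_derive y t (v (y t))).
  { intros x.
    assert (P0 : forall n, picard v x n 0 = x).
    { intros [| n]; simpl; [reflexivity |]. rewrite RInt_point. unfold zero; simpl. ring. }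
    assert (D : forall n t, Rabs (picard v x (S n) t - picard v x n t) <= (1 / 2) ^ n * exp (2 * L * Rabs t)).
    { induction n as [| n IH]; intros t.
      - change ((1 / 2) ^ 0 * exp (2 * L * Rabs t)) with (1 * exp (2 * L * Rabs t)).
        eapply Rle_trans.
        + apply (primitive_exp_bound (fun t => picard v x 1 t - picard v x 0 t) (fun _ => v x) L (2 * L)); try lra.
          * rewrite !P0; ring.
          * intros s. eapply is_derive_eq.
            -- apply (is_derive_minus_R (picard v x 1) (picard v x 0)).
               ++ now apply (picard_derive v x 0).
               ++ apply is_derive_const_R.
            -- simpl. ring.
          * intros s. specialize (Hb x).
            assert (exp 0 <= exp (2 * L * Rabs s)).
            { apply exp_le_compat. pose proof (Rabs_pos s). nra. }
            rewrite exp_0 in *. nra.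
        + pose proof (exp_pos (2 * L * Rabs t)).
          replace (L / (2 * L)) with (1 / 2) by (field; lra). lra.
      - replace ((1 / 2) ^ S n) with (L * (1 / 2) ^ n / (2 * L)) by (simpl; field; lra).
        apply (primitive_exp_bound (fun t => picard v x (S (S n)) t - picard v x (S n) t)
          (fun t => v (picard v x (S n) t) - v (picard v x n t))); try lra.
        + apply Rmult_le_pos; [lra | apply pow_le; lra].
        + rewrite !P0; ring.
        + intros s. apply (is_derive_minus_R (picard v x (S (S n))) (picard v x (S n))); now apply picard_derive.
        + intros s. eapply Rle_trans; [apply Hl |]. rewrite Rmult_assoc.
          apply Rmult_le_compat_l; [lra | apply IH]. }
    assert (HY : forall t, exists l, forall n, Rabs (l - picard v x n t) <= 2 * exp (2 * L * Rabs t) * (1 / 2) ^ n).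
    { intros t. apply geometric_cauchy. intros n. rewrite Rmult_comm. apply D. }
    pose (y := fun t => proj1_sig (constructive_indefinite_description _ (HY t))).
    assert (Hy : forall t n, Rabs (y t - picard v x n t) <= 2 * exp (2 * L * Rabs t) * (1 / 2) ^ n).
    { intros t. unfold y. destruct (constructive_indefinite_description _ (HY t)) as [l Hl']. exact Hl'. }
    (* [L] also bounds [v], so it is a Lipschitz constant of the iterates, and the limit inherits
       it. Continuity of [y] is needed before its integral equation makes sense. *)
    assert (Ly : forall s t, Rabs (y s - y t) <= L * Rabs (s - t)).
    { intros s t. apply Rle_plus_epsilon. intros eps He.
      destruct (geometric_small (2 * exp (2 * L * Rabs s)) (eps / 2)) as [n1 N1]; [lra |].
      destruct (geometric_small (2 * exp (2 * L * Rabs t)) (eps / 2)) as [n2 N2]; [lra |].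
      assert (M : forall c n m, 0 <= c -> (n <= m)%nat -> c * (1 / 2) ^ m <= c * (1 / 2) ^ n).
      { intros c n m Hc' Hnm. apply Rmult_le_compat_l; [lra |].
        replace m with (n + (m - n))%nat by lia. rewrite pow_add.
        pose proof (pow_incr (1 / 2) 1 (m - n) ltac:(lra)) as Q1. rewrite pow1 in Q1.
        assert (0 < (1 / 2) ^ n) by (apply pow_lt; lra). nra. }
      (* A successor, so that [picard_derive] gives the derivative of the iterate. *)
      set (n := S (Nat.max n1 n2)).
      pose proof (M (2 * exp (2 * L * Rabs s)) n1 n ltac:(pose proof (exp_pos (2 * L * Rabs s)); lra) ltac:(unfold n; lia)) as M1.
      pose proof (M (2 * exp (2 * L * Rabs t)) n2 n ltac:(pose proof (exp_pos (2 * L * Rabs t)); lra) ltac:(unfold n; lia)) as M2.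
      pose proof (Hy s n) as A. pose proof (Hy t n) as B.
      assert (C : Rabs (picard v x n s - picard v x n t) <= L * Rabs (s - t)).
      { unfold n. destruct (MVT_gen (picard v x (S (Nat.max n1 n2))) t s (fun r => v (picard v x (Nat.max n1 n2) r))) as [c [_ E]].
        - intros; now apply picard_derive.
        - intros. eapply is_derive_continuity_pt. now apply picard_derive.
        - rewrite E, Rabs_mult. apply Rmult_le_compat_r; [apply Rabs_pos | apply Hb]. }
      replace (y s - y t) with ((y s - picard v x n s) + (picard v x n s - picard v x n t) + (picard v x n t - y t)) by ring.
      eapply Rle_trans; [apply Rabs_triang |].
      rewrite (Rabs_minus_sym (picard v x n t)).
      pose proof (Rabs_triang (y s - picard v x n s) (picard v x n s - picard v x n t)). lra. }
    assert (Cy : forall t, continuous y t).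
    { intros t. apply lipschitz_continuous with L. intros s. apply Ly. }
    assert (Cvy : forall t, continuous (fun s => v (y s)) t).
    { intros t. apply continuous_comp_R; auto. }
    (* Both sides differ from the iterate of index [S n] by a multiple of [(1 / 2) ^ n]. *)
    assert (E : forall t, y t = x + RInt (fun s => v (y s)) 0 t).
    { intros t. apply Rminus_diag_uniq. apply Rabs_eq_0.
      apply Rle_antisym; [| apply Rabs_pos]. apply Rle_plus_epsilon. intros eps He.
      destruct (geometric_small (4 * exp (2 * L * Rabs t)) eps He) as [n N].
      assert (A := Hy t (S n)).
      assert (B : Rabs (picard v x (S n) t - (x + RInt (fun s => v (y s)) 0 t)) <= (L * (2 * (1 / 2) ^ n)) / (2 * L) * exp (2 * L * Rabs t)).
      { apply (primitive_exp_bound (fun t => picard v x (S n) t - (x + RInt (fun s => v (y s)) 0 t))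
          (fun t => v (picard v x n t) - v (y t))); try lra.
        - apply Rmult_le_pos; [lra |]. apply Rmult_le_pos; [lra | apply pow_le; lra].
        - rewrite P0, RInt_point. unfold zero; simpl. ring.
        - intros s. apply (is_derive_minus_R (picard v x (S n))).
          + now apply picard_derive.
          + eapply is_derive_eq.
            * apply is_derive_plus_R; [apply is_derive_const_R |].
              now apply (is_derive_RInt_0 (fun s => v (y s))).
            * ring.
        - intros s. eapply Rle_trans; [apply Hl |]. rewrite Rmult_assoc.
          apply Rmult_le_compat_l; [lra |]. rewrite Rabs_minus_sym. specialize (Hy s n). lra. }
      replace ((L * (2 * (1 / 2) ^ n)) / (2 * L)) with ((1 / 2) ^ n) in B by (field; lra).
      simpl pow in A.
      replace (y t - (x + RInt (fun s => v (y s)) 0 t)) with ((y t - picard v x (S n) t) + (picard v x (S n) t - (x + RInt (fun s => v (y s)) 0 t))) by ring.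
      eapply Rle_trans; [apply Rabs_triang |].
      assert (0 < (1 / 2) ^ n) by (apply pow_lt; lra).
      pose proof (exp_pos (2 * L * Rabs t)). nra. }
    exists y. split.
    - rewrite E, RInt_point. unfold zero; simpl. ring.
    - intros t. apply (is_derive_ext_R (fun t => x + RInt (fun s => v (y s)) 0 t)); [intros; now rewrite E |].
      eapply is_derive_eq.
      + apply is_derive_plus_R; [apply is_derive_const_R |].
        now apply (is_derive_RInt_0 (fun s => v (y s))).
      + simpl. ring. }
  exists (fun x => proj1_sig (constructive_indefinite_description _ (Hx x))).
  split; intros x; destruct (constructive_indefinite_description _ (Hx x)) as [y [Y0 Yd]]; simpl; auto.
Qed.

(** A monotone function can be discontinuous only by a jump, and a jump would miss values. *)
Lemma increasing_surjective_continuous (u : R -> R) :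
  (forall x y, x < y -> u x < u y) -> (forall y, exists x, u x = y) ->
  forall x, continuous u x.
Proof.
  intros Hi Hs x. apply continuity_pt_filterlim. intros eps He.
  destruct (Hs (u x - eps)) as [a Ha]. destruct (Hs (u x + eps)) as [b Hb].
  assert (Hax : a < x).
  { destruct (Rlt_or_le a x) as [|[H | H]]; auto.
    - apply Hi in H. lra.
    - subst. lra. }
  assert (Hxb : x < b).
  { destruct (Rlt_or_le x b) as [|[H | H]]; auto.
    - apply Hi in H. lra.
    - subst. lra. }
  exists (Rmin (x - a) (b - x)). split.
  - apply Rmin_pos; lra.
  - intros y [_ Hy]. simpl in *. unfold R_dist in *.
    pose proof (Rmin_l (x - a) (b - x)). pose proof (Rmin_r (x - a) (b - x)).
    apply Rabs_lt_between in Hy. apply Rabs_lt_between.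
    pose proof (Hi a y ltac:(lra)). pose proof (Hi y b ltac:(lra)). lra.
Qed.

(** A right inverse obtained by choice is enough: [N] is strictly increasing, so [L] is a two-sided
    inverse, increasing and onto, hence continuous, and the rule for reciprocal functions
    applies. *)
Lemma inverse_derive (N dN L : R -> R) :
  (forall x, is_derive N x (dN x)) -> (forall x, 0 < dN x) ->
  (forall y, N (L y) = y) ->
  (forall x, L (N x) = x) /\ (forall y, is_derive L y (/ dN (L y))).
Proof.
  intros Hd Hp HL.
  assert (Hi : forall x y, x < y -> N x < N y).
  { intros x y H. apply (increasing_derive N dN); auto. }
  assert (Hinj : forall x y, N x = N y -> x = y).
  { intros x y E. destruct (Rtotal_order x y) as [H | [H | H]]; auto;
      apply Hi in H; lra. }
  assert (HL' : forall x, L (N x) = x) by (intros; apply Hinj; auto).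
  split; [exact HL' |]. intros y.
  assert (Li : forall a b, a < b -> L a < L b).
  { intros a b H. destruct (Rlt_or_le (L a) (L b)) as [|[H' | H']]; auto.
    - apply Hi in H'. rewrite !HL in H'. lra.
    - rewrite <- (HL a), <- (HL b), H' in H. lra. }
  assert (Lc : forall a, continuous L a).
  { apply increasing_surjective_continuous; auto. intros x. exists (N x). apply HL'. }
  assert (Prf : forall a, L (y - 1) <= a <= L (y + 1) -> derivable_pt N a).
  { intros a _. exists (dN a). now apply is_derive_Reals. }
  assert (G : L (y - 1) <= L y <= L (y + 1)) by (split; left; apply Li; lra).
  assert (Hder : derive_pt N (L y) (Prf (L y) G) = dN (L y)).
  { apply derive_pt_eq_0. now apply is_derive_Reals. }
  apply is_derive_Reals. rewrite <- Hder. rewrite <- (Rmult_1_l (/ _)).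
  apply derivable_pt_lim_recip_interv; try lra.
  - apply continuity_pt_filterlim. apply Lc.
  - intros x _. apply HL.
  - rewrite Hder. specialize (Hp (L y)). lra.
Qed.

(** Gronwall's inequality for the square of the difference, which is differentiable where the
    absolute value may not be. *)
Lemma flow_lipschitz (v : R -> R) (L : R) (y1 y2 : R -> R) (t : R) :
  (forall x y, Rabs (v x - v y) <= L * Rabs (x - y)) ->
  (forall t, is_derive y1 t (v (y1 t))) -> (forall t, is_derive y2 t (v (y2 t))) ->
  Rabs (y1 t - y2 t) <= Rabs (y1 0 - y2 0) * exp (L * Rabs t).
Proof.
  intros HL H1 H2.
  assert (G : (y1 t - y2 t) ^ 2 <= (y1 0 - y2 0) ^ 2 * exp (2 * L * Rabs (t - 0))).
  { apply (gronwall (fun t => (y1 t - y2 t) ^ 2)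
      (fun t => 2 * (y1 t - y2 t) * (v (y1 t) - v (y2 t)))).
    intros s _. split.
    - apply (is_derive_ext_R (fun t => (y1 t - y2 t) * (y1 t - y2 t))); [intros; ring |].
      eapply is_derive_eq.
      + apply is_derive_mult_R; apply is_derive_minus_R; auto.
      + simpl. ring.
    - rewrite !Rabs_mult, (Rabs_pos_eq 2) by lra.
      specialize (HL (y1 s) (y2 s)). rewrite <- (pow2_abs (y1 s - y2 s)).
      pose proof (Rabs_pos (y1 s - y2 s)). nra. }
  rewrite Rminus_0_r in G.
  replace (2 * L * Rabs t) with (L * Rabs t + L * Rabs t) in G by ring.
  rewrite exp_plus in G. pose proof (exp_pos (L * Rabs t)).
  rewrite <- (pow2_abs (y1 t - y2 t)), <- (pow2_abs (y1 0 - y2 0)) in G.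
  pose proof (Rabs_pos (y1 t - y2 t)). pose proof (Rabs_pos (y1 0 - y2 0)).
  apply Rsqr_incr_0_var; [unfold Rsqr; lra |].
  apply Rmult_le_pos; lra.
Qed.

Lemma flow_unique (v : R -> R) (y1 y2 : R -> R) :
  bounded_lipschitz v ->
  (forall t, is_derive y1 t (v (y1 t))) -> (forall t, is_derive y2 t (v (y2 t))) ->
  y1 0 = y2 0 -> forall t, y1 t = y2 t.
Proof.
  intros [L [_ [_ HL]]] H1 H2 H0 t.
  pose proof (flow_lipschitz v L y1 y2 t HL H1 H2) as G.
  rewrite H0, Rminus_diag, Rabs_R0, Rmult_0_l in G.
  apply Rminus_diag_uniq, Rabs_eq_0, Rle_antisym; [exact G | apply Rabs_pos].
Qed.

(** In the coordinates [theta] and [u = r ^ 2], the system [X' = lambda X + Q X]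
    reads [theta' = g u], [u' = 2 lambda u + 2 f u ^ 2], with [f] and [g] the radial
    and angular components of [Q] on the unit circle.  The invariant circle is
    [u = rho2 theta], and [B theta (2 lambda t)] is the angle at time [t] of the
    solution on it that starts at angle [theta]. *)
Record polar_flow (lambda : R) (f g rho2 : R -> R) (B : R -> R -> R) : Prop := {
  pf_bounds : exists c1 c2, 0 < c1 /\ forall x, c1 <= rho2 x <= c2;
  pf_cont : forall x, continuous rho2 x;
  pf_period : forall x, rho2 (x + PI) = rho2 x;
  pf_zero : forall x, B x 0 = x;
  pf_add : forall x y z, B x (y + z) = B (B x y) z;
  pf_shift : forall x y, B (x + PI) y = B x y + PI;
  pf_fixed : forall x y, g x = 0 -> B x y = x;
  pf_angle : forall x y, is_derive (B x) y (g (B x y) * rho2 (B x y) / (2 * lambda));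
  pf_radius : forall x y, is_derive (fun z => rho2 (B x z)) y
    (rho2 (B x y) + f (B x y) * rho2 (B x y) ^ 2 / lambda)
}.

(** * Construction of the flow on the invariant circle *)

Lemma bounded_lipschitz_opp (u : R -> R) :
  bounded_lipschitz u -> bounded_lipschitz (fun x => - u x).
Proof.
  intros [L [H0 [H1 H2]]]. exists L. repeat split; auto.
  - intros x. rewrite Rabs_Ropp; auto.
  - intros x y. replace (- u x - - u y) with (- (u x - u y)) by ring. rewrite Rabs_Ropp; auto.
Qed.

Lemma primitive_exp_between (F h : R -> R) (k1 k2 a b : R) :
  (forall s, is_derive F s (exp s * h s)) -> (forall s, k1 <= h s <= k2) -> a <= b ->
  k1 * (exp b - exp a) <= F b - F a <= k2 * (exp b - exp a).
Proof.
  intros Hd Hk Hab.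
  assert (De : forall c s, is_derive (fun s => c * exp s) s (c * exp s)).
  { intros c s. auto_derive; [trivial | ring]. }
  split.
  - assert (M : F a - k1 * exp a <= F b - k1 * exp b).
    { apply (nondecreasing_derive (fun s => F s - k1 * exp s) (fun s => exp s * h s - k1 * exp s)); auto.
      - intros s _. now apply is_derive_minus_R.
      - intros s _. specialize (Hk s). pose proof (exp_pos s). nra. }
    lra.
  - assert (M : k2 * exp a - F a <= k2 * exp b - F b).
    { apply (nondecreasing_derive (fun s => k2 * exp s - F s) (fun s => k2 * exp s - exp s * h s)); auto.
      - intros s _. now apply is_derive_minus_R.
      - intros s _. specialize (Hk s). pose proof (exp_pos s). nra. }
    lra.
Qed.

(** Integration of [F' = exp * h] from [-oo]. *)
Lemma primitive_exp_from_minus_infinity (F h : R -> R) (k1 k2 : R) :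
  (forall s, is_derive F s (exp s * h s)) -> (forall s, k1 <= h s <= k2) ->
  exists P, forall t, k1 * exp t <= P + F t <= k2 * exp t.
Proof.
  intros Hd Hk.
  (* The numbers [k1 * exp t - F t] increase as [t] decreases to [-oo]; their supremum plays the
     part of [- F (- oo)]. *)
  pose (E := fun x => exists t, x = k1 * exp t - F t).
  assert (Hub : forall x t, E x -> x <= k2 * exp t - F t).
  { intros x t [s ->]. assert (K : k1 <= k2) by (specialize (Hk 0); lra).
    pose proof (exp_pos s). pose proof (exp_pos t).
    destruct (Rle_dec s t) as [H1 | H1].
    - pose proof (primitive_exp_between F h k1 k2 s t Hd Hk H1). nra.
    - pose proof (primitive_exp_between F h k1 k2 t s Hd Hk ltac:(lra)). nra. }
  destruct (completeness E) as [P [HP1 HP2]].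
  - exists (k2 * exp 0 - F 0). intros x Hx. now apply Hub.
  - exists (k1 * exp 0 - F 0). now exists 0.
  - exists P. intros t. split.
    + assert (k1 * exp t - F t <= P) by (apply HP1; now exists t). lra.
    + assert (P <= k2 * exp t - F t) by (apply HP2; intros x Hx; now apply Hub). lra.
Qed.

Lemma exp_small (c eps : R) : 0 < eps -> exists t, t < 0 /\ c * exp t < eps.
Proof.
  intros He. pose proof (Rabs_pos c).
  exists (Rmin (-1) (ln (eps / (Rabs c + 1)))). split.
  - pose proof (Rmin_l (-1) (ln (eps / (Rabs c + 1)))). lra.
  - assert (P : 0 < eps / (Rabs c + 1)) by (apply Rdiv_lt_0_compat; lra).
    assert (M : exp (Rmin (-1) (ln (eps / (Rabs c + 1)))) <= eps / (Rabs c + 1)).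
    { rewrite <- (exp_ln _ P) at 2. apply exp_le_compat, Rmin_r. }
    pose proof (exp_pos (Rmin (-1) (ln (eps / (Rabs c + 1))))).
    pose proof (Rle_abs c).
    assert ((Rabs c + 1) * (eps / (Rabs c + 1)) = eps) by (field; lra).
    nra.
Qed.

(** Both constants lie in an interval of length [(k2 - k1) * exp t], for every [t]. Integrals from
    [-oo] are thereby identified by checking two bounds, without being computed. *)
Lemma primitive_exp_unique (F : R -> R) (k1 k2 P P' : R) :
  (forall t, k1 * exp t <= P + F t <= k2 * exp t) ->
  (forall t, k1 * exp t <= P' + F t <= k2 * exp t) -> P = P'.
Proof.
  intros H H'. apply Rminus_diag_uniq, Rabs_eq_0, Rle_antisym; [| apply Rabs_pos].
  apply Rle_plus_epsilon. intros eps He.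
  destruct (exp_small (k2 - k1) eps He) as [t [_ Ht]].
  specialize (H t). specialize (H' t). apply Rabs_le. lra.
Qed.

(** The flow [Phi] of [g / (- 2 f)] is the flow of the angle in the time
    [- 2 * integral of f ds], and [rho2 = lambda * P] with
    [P x = RInt (fun v => exp v * k (Phi x v)) (- oo) 0], [k = - 1 / f]. *)
Lemma polar_flow_exists (lambda : R) (f g : R -> R) (c : R) :
  0 < lambda -> 0 < c -> bounded_lipschitz f -> bounded_lipschitz g ->
  (forall x, f (x + PI) = f x) -> (forall x, g (x + PI) = g x) ->
  (forall x, f x <= - c) ->
  exists rho2 B, polar_flow lambda f g rho2 B.
Proof.
  intros Hlam Hc Hf Hg Pf Pg Hneg.
  (* In the time of [Phi] the equation of [u = r ^ 2] becomes [u' = lambda * k - u]: the rate of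
     decay is exactly 1, whence the weight [exp] in the integral. *)
  pose (k := fun x => - / f x).
  pose (v := fun x => g x * (1 / 2 * k x)).
  assert (Hk : bounded_lipschitz k).
  { apply bounded_lipschitz_opp, bounded_lipschitz_inv with c; auto.
    intros x. specialize (Hneg x). rewrite Rabs_left; lra. }
  assert (Hv : bounded_lipschitz v).
  { apply bounded_lipschitz_mult; auto.
    apply (bounded_lipschitz_mult (fun _ => 1 / 2)); auto using bounded_lipschitz_const. }
  assert (Hkb : exists k1 k2, 0 < k1 /\ forall x, k1 <= k x <= k2).
  { destruct Hf as [L [HL [Bf _]]]. exists (/ L), (/ c). split; [now apply Rinv_0_lt_compat |].
    intros x. unfold k. rewrite <- Rinv_opp. specialize (Hneg x). specialize (Bf x).
    apply Rabs_le_between in Bf. split; apply Rinv_le_contravar; lra. }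
  destruct Hkb as [k1 [k2 [Hk1 Hkb]]].
  destruct (scalar_flow_exists v Hv) as [Phi [Phi0 Phid]].
  assert (Phic : forall x t, continuous (Phi x) t) by (intros; eapply is_derive_continuous, Phid).
  assert (Padd : forall x s t, Phi x (s + t) = Phi (Phi x s) t).
  { intros x s t.
    apply (flow_unique v (fun t => Phi x (s + t)) (Phi (Phi x s))); auto.
    - intros r. eapply is_derive_eq.
      + apply (is_derive_comp_R (Phi x) (fun t => s + t)); [apply Phid |].
        apply is_derive_plus_R; [apply is_derive_const_R | apply is_derive_id_R].
      + ring.
    - now rewrite Phi0, Rplus_0_r. }
  assert (Pv : forall x, v (x + PI) = v x) by (intros; unfold v, k; now rewrite Pf, Pg).
  assert (Pshift : forall x t, Phi (x + PI) t = Phi x t + PI).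
  { intros x t. apply (flow_unique v (Phi (x + PI)) (fun t => Phi x t + PI)); auto.
    - intros r. rewrite Pv. eapply is_derive_eq.
      + apply is_derive_plus_R; [apply Phid | apply is_derive_const_R].
      + ring.
    - now rewrite !Phi0. }
  assert (Pfix : forall x t, g x = 0 -> Phi x t = x).
  { intros x t H. apply (flow_unique v (Phi x) (fun _ => x)); auto.
    intros r. unfold v. rewrite H. eapply is_derive_eq; [apply is_derive_const_R | ring]. }
  pose (H := fun x t => RInt (fun s => exp s * k (Phi x s)) 0 t).
  assert (H0 : forall x, H x 0 = 0) by (intros; unfold H; now rewrite RInt_point).
  assert (Hd : forall x t, is_derive (H x) t (exp t * k (Phi x t))).
  { intros x t. apply (is_derive_RInt_0 (fun s => exp s * k (Phi x s))).
    intros s. apply (continuous_mult exp).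
    - eapply is_derive_continuous, is_derive_exp.
    - apply continuous_comp_R; auto. now apply bounded_lipschitz_continuous. }
  assert (HP : forall x, exists P, forall t, k1 * exp t <= P + H x t <= k2 * exp t).
  { intros x. apply (primitive_exp_from_minus_infinity (H x) (fun t => k (Phi x t))); auto. }
  pose (P := fun x => proj1_sig (constructive_indefinite_description _ (HP x))).
  assert (PH : forall x t, k1 * exp t <= P x + H x t <= k2 * exp t).
  { intros x. unfold P. destruct (constructive_indefinite_description _ (HP x)) as [p Hp]. exact Hp. }
  clearbody P.
  assert (Pb : forall x, k1 <= P x <= k2).
  { intros x. specialize (PH x 0). rewrite H0, exp_0 in PH. lra. }
  (* Change of base point along the orbit: the right-hand side satisfies the two bounds that
     characterize [P (Phi x t)]. *)
  assert (Prel : forall x t, P (Phi x t) = exp (- t) * (P x + H x t)).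
  { intros x t. apply (primitive_exp_unique (H (Phi x t)) k1 k2); auto. intros s.
    assert (E : H (Phi x t) s = exp (- t) * (H x (t + s) - H x t)).
    { apply Rminus_diag_uniq.
      pose (D := fun s => H (Phi x t) s - exp (- t) * (H x (t + s) - H x t)).
      change (D s = 0). replace 0 with (D 0)
        by (unfold D; rewrite H0, Rplus_0_r; ring).
      assert (Dd : forall r, is_derive D r 0).
      { intros r. unfold D. eapply is_derive_eq.
        - apply is_derive_minus_R; [apply Hd |].
          apply is_derive_mult_R; [apply is_derive_const_R |].
          apply is_derive_minus_R; [| apply is_derive_const_R].
          apply (is_derive_comp_R (H x) (fun s => t + s)); [apply Hd |].
          apply is_derive_plus_R; [apply is_derive_const_R | apply is_derive_id_R].
        - rewrite <- Padd. replace (exp r) with (exp (- t) * exp (t + r)); [ring |].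
          rewrite <- exp_plus. f_equal. ring. }
      destruct (MVT_gen D 0 s (fun _ => 0)) as [z [_ E]]; [intros; apply Dd | |lra].
      intros. eapply is_derive_continuity_pt, Dd. }
    rewrite E. specialize (PH x (t + s)). rewrite exp_plus in PH.
    assert (X : exp (- t) * exp t = 1) by (rewrite <- exp_plus, Rplus_opp_l; apply exp_0).
    pose proof (exp_pos (- t)). pose proof (exp_pos s).
    replace (exp (- t) * (P x + H x t) + exp (- t) * (H x (t + s) - H x t))
      with (exp (- t) * (P x + H x (t + s))) by ring.
    split.
    - replace (k1 * exp s) with (exp (- t) * (k1 * (exp t * exp s))); [apply Rmult_le_compat_l; lra |].
      transitivity (k1 * exp s * (exp (- t) * exp t)); [ring | rewrite X; ring].
    - replace (k2 * exp s) with (exp (- t) * (k2 * (exp t * exp s))); [apply Rmult_le_compat_l; lra |].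
      transitivity (k2 * exp s * (exp (- t) * exp t)); [ring | rewrite X; ring]. }
  assert (Hshift : forall x t, H (x + PI) t = H x t).
  { intros x t. unfold H. apply RInt_ext. intros s _. rewrite Pshift. unfold k. now rewrite Pf. }
  assert (Pshift' : forall x, P (x + PI) = P x).
  { intros x. apply (primitive_exp_unique (H x) k1 k2); auto. intros t.
    rewrite <- Hshift. auto. }
  assert (Pc : forall x, continuous P x).
  { intros x. destruct Hk as [Lk [HLk [_ Lipk]]]. destruct Hv as [Lv [HLv [_ Lipv]]].
    apply continuity_pt_filterlim. intros eps He.
    (* The part of the integral before [t] contributes at most [(k2 - k1) * exp t] to the
       difference; on the remaining segment, orbits depend on the initial angle in a Lipschitz
       way. *)
    destruct (exp_small (k2 - k1) (eps / 2) ltac:(lra)) as [t [Ht0 Ht]].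
    pose (M := - t * (Lk * exp (Lv * - t)) + 1).
    assert (HM : 0 < - t * (Lk * exp (Lv * - t))).
    { pose proof (exp_pos (Lv * - t)). apply Rmult_lt_0_compat; [lra |]. apply Rmult_lt_0_compat; lra. }
    exists (eps / 2 / M). split; [apply Rdiv_lt_0_compat; unfold M; lra |].
    intros y [_ Hy]. simpl in *. unfold R_dist in *.
    assert (HH : Rabs (H y t - H x t) <= - t * (Lk * exp (Lv * - t)) * Rabs (y - x)).
    { destruct (MVT_gen (fun t => H y t - H x t) t 0
        (fun s => exp s * k (Phi y s) - exp s * k (Phi x s))) as [s [Hs E]].
      - intros s _. apply is_derive_minus_R; apply Hd.
      - intros s _. eapply is_derive_continuity_pt. apply is_derive_minus_R; apply Hd.
      - rewrite !H0 in E. rewrite Rmin_left, Rmax_right in Hs by lra.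
        replace (H y t - H x t) with (t * (exp s * (k (Phi y s) - k (Phi x s)))) by lra.
        rewrite !Rabs_mult, (Rabs_left t), !Rmult_assoc by lra.
        apply Rmult_le_compat_l; [lra |].
        assert (E1 : Rabs (exp s) <= 1).
        { rewrite Rabs_pos_eq by (left; apply exp_pos). rewrite <- exp_0. apply exp_le_compat; lra. }
        assert (E2 : Rabs (k (Phi y s) - k (Phi x s)) <= Lk * (Rabs (y - x) * exp (Lv * Rabs s))).
        { eapply Rle_trans; [apply Lipk |]. apply Rmult_le_compat_l; [lra |].
          pose proof (flow_lipschitz v Lv (Phi y) (Phi x) s Lipv (Phid y) (Phid x)) as G.
          now rewrite !Phi0 in G. }
        assert (E3 : exp (Lv * Rabs s) <= exp (Lv * - t)).
        { apply exp_le_compat. apply Rmult_le_compat_l; [lra |]. rewrite Rabs_left1; lra. }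
        pose proof (Rabs_pos (y - x)). pose proof (Rabs_pos (exp s)).
        pose proof (Rabs_pos (k (Phi y s) - k (Phi x s))).
        assert (Rabs (y - x) * exp (Lv * Rabs s) <= Rabs (y - x) * exp (Lv * - t))
          by (apply Rmult_le_compat_l; lra).
        assert (Lk * (Rabs (y - x) * exp (Lv * Rabs s)) <= Lk * (Rabs (y - x) * exp (Lv * - t)))
          by (apply Rmult_le_compat_l; lra).
        nra. }
    pose proof (PH x t) as A. pose proof (PH y t) as A'.
    assert (B1 : Rabs (P y - P x) <= (k2 - k1) * exp t + Rabs (H y t - H x t)).
    { pose proof (Rle_abs (H y t - H x t)). pose proof (Rle_abs (- (H y t - H x t))) as C.
      rewrite Rabs_Ropp in C. apply Rabs_le. lra. }
    assert (B2 : - t * (Lk * exp (Lv * - t)) * Rabs (y - x) <= M * Rabs (y - x))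
      by (apply Rmult_le_compat_r; [apply Rabs_pos | unfold M; lra]).
    assert (B3 : M * Rabs (y - x) < eps / 2).
    { replace (eps / 2) with (M * (eps / 2 / M)) by (field; unfold M; lra).
      apply Rmult_lt_compat_l; [unfold M; lra | exact Hy]. }
    lra. }
  assert (Spos : forall x t, 0 < P x + H x t).
  { intros x t. specialize (PH x t). pose proof (exp_pos t). nra. }
  (* [N x t] is the time [y] of [polar_flow] in terms of the time [t] of [Phi]. Along the orbit
     [dy = k / P dt], and by [Prel] this is the logarithmic derivative of [P x + H x t]. *)
  pose (N := fun x t => ln (P x + H x t) - ln (P x)).
  assert (Nd : forall x t, is_derive (N x) t (exp t * k (Phi x t) / (P x + H x t))).
  { intros x t. unfold N. eapply is_derive_eq.
    - apply is_derive_minus_R; [| apply is_derive_const_R].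
      apply (is_derive_comp_R ln (fun t => P x + H x t)).
      + apply is_derive_ln. apply Spos.
      + apply is_derive_plus_R; [apply is_derive_const_R | apply Hd].
    - field. specialize (Spos x t). lra. }
  assert (Ndp : forall x t, 0 < exp t * k (Phi x t) / (P x + H x t)).
  { intros x t. apply Rdiv_lt_0_compat; auto. apply Rmult_lt_0_compat; [apply exp_pos |].
    specialize (Hkb (Phi x t)). lra. }
  (* [N x] stays at bounded distance from the identity, and is therefore onto. *)
  assert (Nb : forall x t, ln k1 - ln (P x) <= N x t - t <= ln k2 - ln (P x)).
  { intros x t. unfold N. specialize (PH x t). pose proof (exp_pos t).
    assert (0 < k2) by (specialize (Hkb x); lra).
    assert (0 < k1 * exp t) as K1 by (apply Rmult_lt_0_compat; lra).
    pose proof (ln_le _ _ K1 (proj1 PH)) as A.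
    pose proof (ln_le _ _ (Spos x t) (proj2 PH)) as A'.
    rewrite ln_mult, ln_exp in A by lra. rewrite ln_mult, ln_exp in A' by lra. lra. }
  assert (NL : forall x y, exists t, N x t = y).
  { intros x y.
    pose (a := y - (ln k2 - ln (P x))). pose (b := y - (ln k1 - ln (P x))).
    pose proof (Nb x a) as A. pose proof (Nb x b) as B'.
    destruct (IVT_gen (N x) a b y) as [t [_ Ht]].
    - intros t. eapply is_derive_continuity_pt, Nd.
    - unfold a, b in *. split.
      + eapply Rle_trans; [apply Rmin_l | lra].
      + eapply Rle_trans; [| apply Rmax_r]. lra.
    - now exists t. }
  pose (L := fun x y => proj1_sig (constructive_indefinite_description _ (NL x y))).
  assert (NL' : forall x y, N x (L x y) = y).
  { intros x y. unfold L. destruct (constructive_indefinite_description _ (NL x y)) as [t Ht]. exact Ht. }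
  clearbody L.
  assert (Linv : forall x, (forall t, L x (N x t) = t) /\
    forall y, is_derive (L x) y (/ (exp (L x y) * k (Phi x (L x y)) / (P x + H x (L x y))))).
  { intros x. apply (inverse_derive (N x) (fun t => exp t * k (Phi x t) / (P x + H x t))); auto. }
  pose (B := fun x y => Phi x (L x y)).
  (* Times add up along an orbit; this cocycle identity gives [pf_add]. *)
  assert (Nadd : forall x s t, N x (s + t) = N x s + N (Phi x s) t).
  { intros x s t. pose proof (Prel x (s + t)) as A. pose proof (Prel (Phi x s) t) as A'.
    pose proof (Prel x s) as A''. rewrite Padd in A.
    assert (E : P x + H x (s + t) = exp s * (P (Phi x s) + H (Phi x s) t)).
    { apply Rmult_eq_reg_l with (exp (- (s + t))); [| pose proof (exp_pos (- (s + t))); lra].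
      rewrite <- A, A', <- Rmult_assoc, <- exp_plus. f_equal. f_equal. ring. }
    assert (E' : P x + H x s = exp s * P (Phi x s)).
    { rewrite A'', <- Rmult_assoc, <- exp_plus, Rplus_opp_r, exp_0. ring. }
    unfold N. rewrite E, E'. pose proof (exp_pos s). pose proof (Spos (Phi x s) t).
    pose proof (Pb (Phi x s)).
    rewrite !ln_mult, ln_exp by lra. ring. }
  assert (PB : forall x y, P (B x y) = exp (- L x y) * (P x * exp y)).
  { intros x y. unfold B. rewrite Prel. f_equal.
    pose proof (NL' x y) as A. unfold N in A.
    rewrite <- (exp_ln (P x + H x (L x y))) by auto.
    replace (ln (P x + H x (L x y))) with (ln (P x) + y) by lra.
    rewrite exp_plus, exp_ln; [ring |]. specialize (Pb x); lra. }
  assert (DL : forall x y, is_derive (L x) y (P (B x y) / k (B x y))).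
  { intros x y. eapply is_derive_eq; [apply Linv |]. unfold B at 1. rewrite Prel.
    unfold B. rewrite exp_Ropp. pose proof (exp_pos (L x y)). specialize (Spos x (L x y)).
    specialize (Hkb (Phi x (L x y))). field. lra. }
  exists (fun x => lambda * P x), B. split.
  - exists (lambda * k1), (lambda * k2). split; [now apply Rmult_lt_0_compat |].
    intros x. specialize (Pb x). nra.
  - intros x. apply (continuous_mult (fun _ => lambda) P); auto. apply continuous_const.
  - intros x. now rewrite Pshift'.
  - intros x. unfold B. replace (L x 0) with 0; auto.
    transitivity (L x (N x 0)); [symmetry; apply Linv |]. f_equal. unfold N. rewrite H0, Rplus_0_r. ring.
  - intros x y z. unfold B. rewrite <- Padd. f_equal.
    rewrite <- (proj1 (Linv x) (L x y + L (Phi x (L x y)) z)). f_equal.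
    now rewrite Nadd, !NL'.
  - intros x y. unfold B. rewrite Pshift. f_equal. f_equal.
    rewrite <- (proj1 (Linv x) (L (x + PI) y)). f_equal.
    transitivity (N (x + PI) (L (x + PI) y)); [| apply NL'].
    unfold N. now rewrite Pshift', Hshift.
  - intros x y H1. unfold B. now apply Pfix.
  - intros x y. eapply is_derive_eq.
    + apply (is_derive_comp_R (Phi x) (L x)); [apply Phid | apply DL].
    + change (Phi x (L x y)) with (B x y). unfold v. specialize (Hkb (B x y)). field. lra.
  - intros x y.
    apply (is_derive_ext_R (fun z => lambda * (exp (- L x z) * (P x * exp z)))); [intros; now rewrite PB |].
    eapply is_derive_eq.
    + apply is_derive_mult_R; [apply is_derive_const_R |].
      apply is_derive_mult_R.
      * apply (is_derive_comp_R exp (fun z => - L x z)); [apply is_derive_exp |].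
        apply is_derive_opp_R, DL.
      * apply is_derive_mult_R; [apply is_derive_const_R | apply is_derive_exp].
    + rewrite PB. unfold k. specialize (Hneg (B x y)). field. lra.
Qed.

(** The level sets of [r ^ 2 * m theta] replace the circles: if [m = 1] this is the
    contracting case, but the normal forms V and VI are only contracting for
    another inner product. *)
Lemma polar_flow_exists_modulated (lambda : R) (f g m dm : R -> R) (c m1 : R) :
  0 < lambda -> 0 < c -> 0 < m1 ->
  bounded_lipschitz f -> bounded_lipschitz g -> bounded_lipschitz m -> bounded_lipschitz dm ->
  (forall x, is_derive m x (dm x)) -> (forall x, m1 <= m x) ->
  (forall x, f (x + PI) = f x) -> (forall x, g (x + PI) = g x) ->
  (forall x, m (x + PI) = m x) -> (forall x, dm (x + PI) = dm x) ->
  (forall x, f x + g x * (dm x / (2 * m x)) <= - c) ->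
  exists rho2 B, polar_flow lambda f g rho2 B.
Proof.
  intros Hlam Hc Hm1 Lf Lg Lm Ldm Dm Hm Pf Pg Pm Pdm Hneg.
  assert (Li : bounded_lipschitz (fun x => / m x)).
  { apply bounded_lipschitz_inv with m1; auto. intros x. specialize (Hm x). rewrite Rabs_pos_eq; lra. }
  destruct Lm as [Lm [HLm [Bm _]]].
  assert (Hm2 : forall x, m x <= Lm) by (intros x; eapply Rle_trans; [apply Rle_abs | apply Bm]).
  (* In the variable [V = r ^ 2 * m theta] the system reads [theta' = g / m * V] and
     [V' = 2 lambda V + 2 F V ^ 2], with [F = (f + g * dm / (2 * m)) / m]: the same form, with a
     negative radial component. *)
  destruct (polar_flow_exists lambda
    (fun x => (f x + g x * (1 / 2 * (dm x * / m x))) * / m x) (fun x => g x * / m x) (c / Lm))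
    as [rho2 [B HB]]; auto.
  - now apply Rdiv_lt_0_compat.
  - apply bounded_lipschitz_mult; auto. apply bounded_lipschitz_plus; auto.
    apply bounded_lipschitz_mult; auto.
    apply (bounded_lipschitz_mult (fun _ => 1 / 2)); [apply bounded_lipschitz_const |].
    now apply bounded_lipschitz_mult.
  - now apply bounded_lipschitz_mult.
  - intros x. now rewrite Pf, Pg, Pm, Pdm.
  - intros x. now rewrite Pg, Pm.
  - intros x. specialize (Hneg x). specialize (Hm x). specialize (Hm2 x).
    replace (1 / 2 * (dm x * / m x)) with (dm x / (2 * m x)) by (field; lra).
    assert (c / Lm <= - (f x + g x * (dm x / (2 * m x))) * / m x); [| lra].
    apply Rmult_le_compat; try lra.
    + left. now apply Rinv_0_lt_compat.
    + apply Rinv_le_contravar; lra.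
  (* Back from [V] to [r ^ 2]; the circle flow itself is unchanged. *)
  - exists (fun x => rho2 x / m x), B.
    assert (Hn : forall x, m x <> 0) by (intros x; specialize (Hm x); lra).
    split; try apply HB.
    + destruct (pf_bounds _ _ _ _ _ HB) as [c1 [c2 [H1 H2]]].
      exists (c1 / Lm), (c2 / m1). split; [apply Rdiv_lt_0_compat; lra |].
      intros x. specialize (H2 x). specialize (Hm x). specialize (Hm2 x).
      split; apply Rmult_le_compat; try lra; try (left; apply Rinv_0_lt_compat; lra);
        apply Rinv_le_contravar; lra.
    + intros x. apply (continuous_mult rho2); [apply (pf_cont _ _ _ _ _ HB) |].
      now apply bounded_lipschitz_continuous.
    + intros x. now rewrite (pf_period _ _ _ _ _ HB), Pm.
    + intros x y H. apply (pf_fixed _ _ _ _ _ HB). rewrite H. ring.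
    + intros x y. eapply is_derive_eq; [apply (pf_angle _ _ _ _ _ HB) |]. simpl.
      field. split; auto; lra.
    + intros x y. eapply is_derive_eq.
      * unfold Rdiv. apply is_derive_mult_R; [apply (pf_radius _ _ _ _ _ HB) |].
        apply (is_derive_comp_R Rinv (fun z => m (B x z))).
        -- apply (is_derive_inv (fun x => x)); auto. apply is_derive_id_R.
        -- apply (is_derive_comp_R m (B x)); [apply Dm | apply (pf_angle _ _ _ _ _ HB)].
      * simpl. field. split; auto; lra.
Qed.

(** * Cubic systems in polar coordinates *)

Definition polar (r theta : R) : plane := (r * cos theta, r * sin theta).

Definition radial (Q : plane -> plane) : R -> R := on_circle (fun X => dot X (Q X)).

Definition angular (Q : plane -> plane) : R -> R := on_circle (LQ Q).

Definition cubic_form (a b c d x y : R) : R :=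
  a * x ^ 3 + b * x ^ 2 * y + c * x * y ^ 2 + d * y ^ 3.

Lemma homogeneous_cubic_form (G : plane -> R) :
  homogeneous_poly 3 G ->
  exists a b c d, forall x y, G (x, y) = cubic_form a b c d x y.
Proof.
  intros [k H]. exists (k 0%nat), (k 1%nat), (k 2%nat), (k 3%nat). intros x y.
  rewrite H. unfold cubic_form. simpl. ring.
Qed.

Lemma cos2_sin2 (x : R) : cos x * cos x + sin x * sin x = 1.
Proof. pose proof (sin2_cos2 x) as H. unfold Rsqr in H. lra. Qed.

Lemma homogeneous_cubic_scale (Q : plane -> plane) (s x y : R) :
  homogeneous_cubic Q ->
  fst (Q (s * x, s * y)) = s ^ 3 * fst (Q (x, y)) /\
  snd (Q (s * x, s * y)) = s ^ 3 * snd (Q (x, y)).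
Proof.
  intros [H1 H2].
  apply homogeneous_cubic_form in H1. destruct H1 as [a [b [c [d H1]]]].
  apply homogeneous_cubic_form in H2. destruct H2 as [a' [b' [c' [d' H2]]]].
  rewrite !H1, !H2. unfold cubic_form. split; ring.
Qed.

Lemma homogeneous_cubic_polar (Q : plane -> plane) (s x : R) :
  homogeneous_cubic Q ->
  fst (Q (polar s x)) = s ^ 3 * (radial Q x * cos x - angular Q x * sin x) /\
  snd (Q (polar s x)) = s ^ 3 * (radial Q x * sin x + angular Q x * cos x).
Proof.
  intros H. destruct (homogeneous_cubic_scale Q s (cos x) (sin x) H) as [H1 H2].
  unfold polar. rewrite H1, H2. unfold radial, angular, on_circle, LQ, dot, perp, unit_vec.
  simpl fst at 2 4 6; simpl snd at 2 4 5 7. simpl.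
  pose proof (cos2_sin2 x) as E.
  set (p := fst (Q (cos x, sin x))). set (q := snd (Q (cos x, sin x))).
  set (C := cos x) in *. set (S := sin x) in *. split.
  - transitivity (s * (s * (s * 1)) * (p * (C * C + S * S))); [rewrite E; ring | ring].
  - transitivity (s * (s * (s * 1)) * (q * (C * C + S * S))); [rewrite E; ring | ring].
Qed.

Lemma polar_coordinates (X : plane) : exists r theta, 0 <= r /\ 0 <= theta < 2 * PI /\ X = polar r theta.
Proof.
  destruct X as [x y]. pose proof PI_RGT_0 as HPI.
  pose (r := sqrt (x ^ 2 + y ^ 2)).
  assert (Hr : r * r = x ^ 2 + y ^ 2) by (apply sqrt_sqrt; nra).
  assert (Hr0 : 0 <= r) by apply sqrt_pos.
  destruct (Req_dec r 0) as [E | E].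
  - exists 0, 0. unfold polar. repeat split; try lra. rewrite E in Hr.
    assert (x = 0) by nra. assert (y = 0) by nra. subst. f_equal; ring.
  - assert (Hrp : 0 < r) by lra.
    assert (B : -1 <= x / r <= 1).
    { assert (- r <= x <= r) by (split; nra).
      split; [apply Rmult_le_reg_r with r | apply Rmult_le_reg_r with r]; try lra;
        unfold Rdiv; rewrite Rmult_assoc, Rinv_l; lra. }
    pose proof (acos_bound (x / r)) as AB.
    assert (S : sin (acos (x / r)) = Rabs y / r).
    { rewrite sin_acos by auto. apply sqrt_lem_1.
      - unfold Rsqr. nra.
      - apply Rdiv_le_0_compat; [apply Rabs_pos | lra].
      - unfold Rsqr. transitivity (Rabs y ^ 2 / r ^ 2); [field; lra |].
        rewrite pow2_abs. replace (y ^ 2) with (r * r - x ^ 2) by lra. field. lra. }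
    destruct (Rle_dec 0 y) as [Hy | Hy].
    + exists r, (acos (x / r)). unfold polar. repeat split; try lra.
      rewrite S, cos_acos, Rabs_pos_eq by auto. f_equal; field; lra.
    + exists r, (2 * PI - acos (x / r)). unfold polar.
      (* Keeps the angle [2 * PI - acos (x / r)] strictly below [2 * PI]. *)
      assert (acos (x / r) <> 0).
      { intros Z. rewrite Z, sin_0, Rabs_left in S by lra.
        assert (0 < - y / r) by (apply Rdiv_lt_0_compat; lra). lra. }
      repeat split; try lra.
      replace (2 * PI - acos (x / r)) with (- acos (x / r) + 2 * INR 1 * PI) by (simpl; ring).
      rewrite cos_period, sin_period, cos_neg, sin_neg, S, cos_acos, Rabs_left by (auto; lra).
      f_equal; field; lra.
Qed.

Lemma polar_norm (r x : R) : fst (polar r x) ^ 2 + snd (polar r x) ^ 2 = r ^ 2.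
Proof.
  unfold polar; simpl. pose proof (cos2_sin2 x).
  transitivity (r * r * (cos x * cos x + sin x * sin x)); [ring | rewrite H; ring].
Qed.

Lemma polar_radius_unique (r r' x x' : R) :
  0 <= r -> 0 <= r' -> polar r x = polar r' x' -> r = r'.
Proof.
  intros H H' E. pose proof (polar_norm r x) as N. rewrite E, polar_norm in N. nra.
Qed.

(** The hypotheses give [cos (x - y) = 1], hence a zero of the sine at half the difference, which
    lies strictly between [- PI] and [PI]. *)
Lemma unit_vec_injective (x y : R) :
  0 <= x < 2 * PI -> 0 <= y < 2 * PI -> cos x = cos y -> sin x = sin y -> x = y.
Proof.
  intros Hx Hy Hc Hs. pose proof PI_RGT_0.
  assert (E : cos (x - y) = 1) by (rewrite cos_minus, Hc, Hs; pose proof (cos2_sin2 y); lra).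
  destruct (Req_dec x y) as [|N]; auto. exfalso.
  destruct (Rle_dec x y) as [L | L].
  - rewrite <- cos_neg in E. replace (- (x - y)) with (2 * ((y - x) / 2)) in E by field.
    rewrite cos_2a_sin in E. assert (0 < sin ((y - x) / 2)) by (apply sin_gt_0; lra). nra.
  - replace (x - y) with (2 * ((x - y) / 2)) in E by field.
    rewrite cos_2a_sin in E. assert (0 < sin ((x - y) / 2)) by (apply sin_gt_0; lra). nra.
Qed.

(** * Uniqueness of solutions *)

Lemma in_itv_between (a b : Rbar) (t u s : R) :
  in_itv a b t -> in_itv a b u -> Rmin t u <= s <= Rmax t u -> in_itv a b s.
Proof.
  intros [H1 H2] [H3 H4] [H5 H6]. split.
  - apply Rbar_lt_le_trans with (Finite (Rmin t u)); [| exact H5]. unfold Rmin. destruct (Rle_dec t u); assumption.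
  - apply Rbar_le_lt_trans with (Finite (Rmax t u)); [exact H6 |]. unfold Rmax. destruct (Rle_dec t u); assumption.
Qed.

Lemma bounded_on_segment (f : R -> R) (a b : R) :
  (forall x, a <= x <= b -> continuity_pt f x) -> exists M, 0 <= M /\ forall x, a <= x <= b -> Rabs (f x) <= M.
Proof.
  intros H. destruct (Rle_dec a b) as [Hab | Hab].
  - destruct (continuity_ab_maj (fun x => Rabs (f x)) a b Hab) as [m [Hm _]].
    + intros x Hx. apply (continuity_pt_comp f Rabs); [auto | apply Rcontinuity_abs].
    + exists (Rabs (f m)). split; [apply Rabs_pos | auto].
  - exists 0. split; [lra | intros; lra].
Qed.

Lemma prod3_lipschitz (M d u v w u' v' w' : R) :
  Rabs u <= M -> Rabs v <= M -> Rabs w <= M -> Rabs u' <= M -> Rabs v' <= M -> Rabs w' <= M ->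
  Rabs (u - u') <= d -> Rabs (v - v') <= d -> Rabs (w - w') <= d ->
  Rabs (u * v * w - u' * v' * w') <= 3 * M ^ 2 * d.
Proof.
  intros. assert (0 <= M) by (pose proof (Rabs_pos u); lra).
  replace (u * v * w - u' * v' * w')
    with ((u - u') * (v * w) + (u' * (v - v')) * w + u' * v' * (w - w')) by ring.
  assert (K : forall a b c A1 B1 C1, Rabs a <= A1 -> Rabs b <= B1 -> Rabs c <= C1 -> Rabs (a * b * c) <= A1 * B1 * C1).
  { intros. rewrite !Rabs_mult.
    apply Rmult_le_compat; auto; [apply Rmult_le_pos; apply Rabs_pos | apply Rabs_pos |].
    apply Rmult_le_compat; auto; apply Rabs_pos. }
  eapply Rle_trans; [apply Rabs_triang |].
  eapply Rle_trans; [apply Rplus_le_compat_r, Rabs_triang |].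
  rewrite <- Rmult_assoc.
  pose proof (K (u - u') v w d M M). pose proof (K u' (v - v') w M d M).
  pose proof (K u' v' (w - w') M M d). nra.
Qed.

Lemma cubic_form_lipschitz (a b c d M : R) :
  0 <= M -> exists L, 0 <= L /\ forall x y x' y',
    Rabs x <= M -> Rabs y <= M -> Rabs x' <= M -> Rabs y' <= M ->
    Rabs (cubic_form a b c d x y - cubic_form a b c d x' y') <= L * (Rabs (x - x') + Rabs (y - y')).
Proof.
  intros HM. exists ((Rabs a + Rabs b + Rabs c + Rabs d) * (3 * M ^ 2)).
  pose proof (Rabs_pos a). pose proof (Rabs_pos b). pose proof (Rabs_pos c). pose proof (Rabs_pos d).
  split; [apply Rmult_le_pos; [lra | nra] |].
  intros x y x' y' Hx Hy Hx' Hy'. set (e := Rabs (x - x') + Rabs (y - y')).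
  assert (Ex : Rabs (x - x') <= e) by (unfold e; pose proof (Rabs_pos (y - y')); lra).
  assert (Ey : Rabs (y - y') <= e) by (unfold e; pose proof (Rabs_pos (x - x')); lra).
  unfold cubic_form.
  replace (a * x ^ 3 + b * x ^ 2 * y + c * x * y ^ 2 + d * y ^ 3 -
    (a * x' ^ 3 + b * x' ^ 2 * y' + c * x' * y' ^ 2 + d * y' ^ 3))
    with (a * (x * x * x - x' * x' * x') + b * (x * x * y - x' * x' * y')
      + c * (x * y * y - x' * y' * y') + d * (y * y * y - y' * y' * y')) by ring.
  pose proof (prod3_lipschitz M e x x x x' x' x').
  pose proof (prod3_lipschitz M e x x y x' x' y').
  pose proof (prod3_lipschitz M e x y y x' y' y').
  pose proof (prod3_lipschitz M e y y y y' y' y').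
  eapply Rle_trans; [apply Rabs_triang |].
  eapply Rle_trans; [apply Rplus_le_compat_r, Rabs_triang |].
  eapply Rle_trans; [apply Rplus_le_compat_r, Rplus_le_compat_r, Rabs_triang |].
  rewrite !Rabs_mult.
  assert (K : forall p q, 0 <= p -> q <= 3 * M ^ 2 * e -> p * q <= p * (3 * M ^ 2 * e))
    by (intros; now apply Rmult_le_compat_l).
  pose proof (K (Rabs a) (Rabs (x * x * x - x' * x' * x'))).
  pose proof (K (Rabs b) (Rabs (x * x * y - x' * x' * y'))).
  pose proof (K (Rabs c) (Rabs (x * y * y - x' * y' * y'))).
  pose proof (K (Rabs d) (Rabs (y * y * y - y' * y' * y'))).
  replace ((Rabs a + Rabs b + Rabs c + Rabs d) * (3 * M ^ 2) * e)
    with (Rabs a * (3 * M ^ 2 * e) + Rabs b * (3 * M ^ 2 * e) + Rabs c * (3 * M ^ 2 * e) + Rabs d * (3 * M ^ 2 * e)) by ring.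
  repeat apply Rplus_le_compat; auto.
Qed.

(** A cubic field is only locally Lipschitz, but on the segment between [t0] and [t] both solutions
    stay in a common square. Gronwall's inequality is applied there to the squared distance. *)
Lemma solution_unique (lambda : R) (Q : plane -> plane) (a b : Rbar) (phi psi : R -> plane) (t0 t : R) :
  homogeneous_cubic Q ->
  solution (system lambda Q) a b phi -> solution (system lambda Q) a b psi ->
  in_itv a b t0 -> in_itv a b t -> phi t0 = psi t0 -> phi t = psi t.
Proof.
  intros [HQ1 HQ2] Hphi Hpsi Ht0 Ht E0.
  apply homogeneous_cubic_form in HQ1. destruct HQ1 as [a0 [a1 [a2 [a3 HQ1]]]].
  apply homogeneous_cubic_form in HQ2. destruct HQ2 as [b0 [b1 [b2 [b3 HQ2]]]].
  set (p := Rmin t0 t) in *. set (q := Rmax t0 t) in *.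
  assert (Hin : forall s, p <= s <= q -> in_itv a b s) by (intros; now apply (in_itv_between a b t0 t)).
  destruct (bounded_on_segment (fun s => fst (phi s)) p q) as [M1 [P1 B1]].
  { intros s Hs. eapply is_derive_continuity_pt, Hphi; auto. }
  destruct (bounded_on_segment (fun s => snd (phi s)) p q) as [M2 [P2 B2]].
  { intros s Hs. eapply is_derive_continuity_pt, Hphi; auto. }
  destruct (bounded_on_segment (fun s => fst (psi s)) p q) as [M3 [P3 B3]].
  { intros s Hs. eapply is_derive_continuity_pt, Hpsi; auto. }
  destruct (bounded_on_segment (fun s => snd (psi s)) p q) as [M4 [P4 B4]].
  { intros s Hs. eapply is_derive_continuity_pt, Hpsi; auto. }
  set (M := M1 + M2 + M3 + M4).
  destruct (cubic_form_lipschitz a0 a1 a2 a3 M) as [L1 [HL1 Lip1]]; [unfold M; lra |].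
  destruct (cubic_form_lipschitz b0 b1 b2 b3 M) as [L2 [HL2 Lip2]]; [unfold M; lra |].
  set (D := fun s => (fst (phi s) - fst (psi s)) ^ 2 + (snd (phi s) - snd (psi s)) ^ 2).
  assert (HD : D t <= 0).
  { apply (gronwall_zero D (fun s =>
      2 * (fst (phi s) - fst (psi s)) * (fst (system lambda Q (phi s)) - fst (system lambda Q (psi s))) +
      2 * (snd (phi s) - snd (psi s)) * (snd (system lambda Q (phi s)) - snd (system lambda Q (psi s))))
      (2 * Rabs lambda + 4 * (L1 + L2)) t0 t).
    - intros s Hs. pose proof (Hin s Hs) as Hi.
      destruct (Hphi s Hi) as [D1 D2]. destruct (Hpsi s Hi) as [D3 D4]. split.
      + unfold D. apply (is_derive_ext_R (fun s =>
          (fst (phi s) - fst (psi s)) * (fst (phi s) - fst (psi s)) +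
          (snd (phi s) - snd (psi s)) * (snd (phi s) - snd (psi s)))); [intros; ring |].
        eapply is_derive_eq.
        * apply is_derive_plus_R; apply is_derive_mult_R; apply is_derive_minus_R; eassumption.
        * simpl. ring.
      + specialize (B1 s Hs). specialize (B2 s Hs). specialize (B3 s Hs). specialize (B4 s Hs).
        cbv beta in B1, B2, B3, B4.
        unfold D, system. simpl fst. simpl snd.
        destruct (phi s) as [x y]. destruct (psi s) as [x' y']. simpl fst in *; simpl snd in *.
        rewrite !HQ1, !HQ2.
        specialize (Lip1 x y x' y' ltac:(unfold M; lra) ltac:(unfold M; lra) ltac:(unfold M; lra) ltac:(unfold M; lra)).
        specialize (Lip2 x y x' y' ltac:(unfold M; lra) ltac:(unfold M; lra) ltac:(unfold M; lra) ltac:(unfold M; lra)).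
        set (c1 := cubic_form a0 a1 a2 a3 x y - cubic_form a0 a1 a2 a3 x' y') in *.
        set (c2 := cubic_form b0 b1 b2 b3 x y - cubic_form b0 b1 b2 b3 x' y') in *.
        replace (2 * (x - x') * (lambda * x + cubic_form a0 a1 a2 a3 x y - (lambda * x' + cubic_form a0 a1 a2 a3 x' y')) +
          2 * (y - y') * (lambda * y + cubic_form b0 b1 b2 b3 x y - (lambda * y' + cubic_form b0 b1 b2 b3 x' y')))
          with (2 * lambda * ((x - x') ^ 2 + (y - y') ^ 2) + (2 * (x - x') * c1 + 2 * (y - y') * c2))
          by (unfold c1, c2; ring).
        rewrite <- (pow2_abs (x - x')), <- (pow2_abs (y - y')).
        eapply Rle_trans; [apply Rabs_triang |].
        eapply Rle_trans; [apply Rplus_le_compat_l, Rabs_triang |].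
        rewrite !Rabs_mult, (Rabs_pos_eq 2) by lra.
        rewrite (Rabs_pos_eq (_ ^ 2 + _ ^ 2)) by nra.
        pose proof (Rabs_pos (x - x')) as Px. pose proof (Rabs_pos (y - y')) as Py.
        set (u := Rabs (x - x')) in *. set (v := Rabs (y - y')) in *.
        assert (u * Rabs c1 <= u * (L1 * (u + v))) by now apply Rmult_le_compat_l.
        assert (v * Rabs c2 <= v * (L2 * (u + v))) by now apply Rmult_le_compat_l.
        assert (u * (u + v) <= 2 * (u ^ 2 + v ^ 2)) by nra.
        assert (v * (u + v) <= 2 * (u ^ 2 + v ^ 2)) by nra.
        assert (L1 * (u * (u + v)) <= L1 * (2 * (u ^ 2 + v ^ 2))) by now apply Rmult_le_compat_l.
        assert (L2 * (v * (u + v)) <= L2 * (2 * (u ^ 2 + v ^ 2))) by now apply Rmult_le_compat_l.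
        lra.
    - unfold D. rewrite E0. ring. }
  unfold D in HD.
  assert (Z : forall x y, x ^ 2 + y ^ 2 <= 0 -> x = 0).
  { intros x y H. destruct (Req_dec x 0) as [|N]; auto.
    pose proof (pow2_gt_0 x N). pose proof (pow2_ge_0 y). lra. }
  assert (E1 := Z _ _ HD). rewrite Rplus_comm in HD. assert (E2 := Z _ _ HD).
  apply Rminus_diag_uniq in E1. apply Rminus_diag_uniq in E2.
  destruct (phi t), (psi t); simpl in *; subst; reflexivity.
Qed.

(** * The solutions of a cubic system *)

(** The solution at angle [theta] at time [t0], where [w] is the ratio of its squared
    radius to [rho2 theta]; [clock] is its time on the invariant circle, in exponential
    form. *)
Definition clock (lambda w t0 t : R) : R := 1 + w * (exp (2 * lambda * (t - t0)) - 1).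

Definition angle_at (lambda : R) (B : R -> R -> R) (theta w t0 t : R) : R :=
  B theta (ln (clock lambda w t0 t)).

Definition canonical (lambda : R) (rho2 : R -> R) (B : R -> R -> R) (theta w t0 t : R) : plane :=
  let x := angle_at lambda B theta w t0 t in
  polar (sqrt (rho2 x * (w * exp (2 * lambda * (t - t0)) / clock lambda w t0 t))) x.

(** For [w > 1], outside the invariant circle, this is the time at which [clock] vanishes: the
    solution comes from infinity in finite time. For [w <= 1] the clock is positive at all times. *)
Definition start (lambda w t0 : R) : Rbar :=
  if Rle_dec w 1 then m_infty else Finite (t0 + ln ((w - 1) / w) / (2 * lambda)).

Lemma in_start (lambda w t0 t : R) :
  0 < lambda -> 0 < w -> (in_itv (start lambda w t0) p_infty t <-> 0 < clock lambda w t0 t).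
Proof.
  intros Hl Hw. unfold in_itv, start, clock. destruct (Rle_dec w 1) as [H | H]; simpl.
  - split; auto. intros _. pose proof (exp_pos (2 * lambda * (t - t0))). nra.
  - assert (P : 0 < (w - 1) / w) by (apply Rdiv_lt_0_compat; lra).
    assert (E : w * ((w - 1) / w) = w - 1) by (field; lra).
    split.
    + intros [H1 _].
      assert (K : (w - 1) / w < exp (2 * lambda * (t - t0))).
      { rewrite <- (exp_ln _ P) at 1. apply exp_increasing.
        replace (ln ((w - 1) / w)) with (2 * lambda * (ln ((w - 1) / w) / (2 * lambda))) by (field; lra).
        apply Rmult_lt_compat_l; lra. }
      nra.
    + intros H1. split; auto.
      assert (K : (w - 1) / w < exp (2 * lambda * (t - t0))) by nra.
      apply (ln_increasing _ _ P) in K. rewrite ln_exp in K.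
      assert (ln ((w - 1) / w) / (2 * lambda) < t - t0); [| lra].
      apply Rmult_lt_reg_r with (2 * lambda); [lra |].
      unfold Rdiv. rewrite Rmult_assoc, Rinv_l by lra. lra.
Qed.

Lemma is_derive_exp_affine (lambda t0 t : R) :
  is_derive (fun t => exp (2 * lambda * (t - t0))) t (2 * lambda * exp (2 * lambda * (t - t0))).
Proof. auto_derive; [trivial | unfold Rminus; ring]. Qed.

Lemma is_derive_clock (lambda w t0 t : R) :
  is_derive (clock lambda w t0) t (2 * lambda * (w * exp (2 * lambda * (t - t0)))).
Proof.
  eapply is_derive_eq.
  - apply is_derive_plus_R; [apply is_derive_const_R |].
    apply is_derive_mult_R; [apply is_derive_const_R |].
    apply is_derive_minus_R; [apply is_derive_exp_affine | apply is_derive_const_R].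
  - simpl. ring.
Qed.

Lemma rho2_pos (lambda : R) (f g rho2 : R -> R) (B : R -> R -> R) (x : R) :
  polar_flow lambda f g rho2 B -> 0 < rho2 x.
Proof.
  intros H. destruct (pf_bounds _ _ _ _ _ H) as [c1 [c2 [H1 H2]]]. specialize (H2 x). lra.
Qed.

(** The ratio [W = w * e / E], with [e] the exponential and [E] the clock, solves the logistic
    equation [W' = 2 lambda W (1 - W)], and [ln E] has derivative [2 lambda W]. Inserted in
    [pf_angle] and [pf_radius], these two facts give the polar equations. *)
Lemma canonical_solution (lambda : R) (Q : plane -> plane) (rho2 : R -> R) (B : R -> R -> R) (theta w t0 : R) :
  0 < lambda -> homogeneous_cubic Q -> polar_flow lambda (radial Q) (angular Q) rho2 B -> 0 < w ->
  solution (system lambda Q) (start lambda w t0) p_infty (canonical lambda rho2 B theta w t0).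
Proof.
  intros Hl HQ HB Hw t Ht. apply in_start in Ht; auto.
  pose (e := fun t => exp (2 * lambda * (t - t0))).
  pose (E := clock lambda w t0). pose (x := angle_at lambda B theta w t0).
  pose (u := fun t => rho2 (x t) * (w * e t / E t)).
  assert (EP : 0 < E t) by exact Ht.
  assert (De : is_derive e t (2 * lambda * e t)) by apply is_derive_exp_affine.
  assert (DE : is_derive E t (2 * lambda * (w * e t))) by apply is_derive_clock.
  assert (DlE : is_derive (fun t => ln (E t)) t (2 * lambda * (w * e t / E t))).
  { eapply is_derive_eq.
    - apply (is_derive_comp_R ln E); [now apply is_derive_ln | exact DE].
    - field. lra. }
  assert (Dx : is_derive x t (angular Q (x t) * u t)).
  { eapply is_derive_eq.
    - apply (is_derive_comp_R (B theta) (fun t => ln (E t))); [apply (pf_angle _ _ _ _ _ HB) | exact DlE].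
    - unfold u. change (B theta (ln (E t))) with (x t). field. lra. }
  assert (Du : is_derive u t (2 * lambda * u t + 2 * radial Q (x t) * (u t * u t))).
  { unfold u at 1. eapply is_derive_eq.
    - apply is_derive_mult_R.
      + apply (is_derive_comp_R (fun y => rho2 (B theta y)) (fun t => ln (E t)));
          [apply (pf_radius _ _ _ _ _ HB) | exact DlE].
      + unfold Rdiv. apply is_derive_mult_R.
        * apply is_derive_mult_R; [apply is_derive_const_R | exact De].
        * apply (is_derive_inv E); [exact DE | lra].
    - unfold u. simpl. change (B theta (ln (E t))) with (x t). field. lra. }
  assert (Up : 0 < u t).
  { unfold u. apply Rmult_lt_0_compat; [eapply rho2_pos, HB |].
    apply Rdiv_lt_0_compat; [| exact EP]. apply Rmult_lt_0_compat; [lra | apply exp_pos]. }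
  pose (s := fun t => sqrt (u t)).
  assert (Sp : 0 < s t) by now apply sqrt_lt_R0.
  assert (Su : u t = s t * s t) by (unfold s; rewrite sqrt_sqrt; lra).
  assert (Ds : is_derive s t (lambda * s t + radial Q (x t) * s t ^ 3)).
  { eapply is_derive_eq.
    - apply (is_derive_comp_R sqrt u); [| exact Du].
      apply is_derive_sqrt; [apply is_derive_id_R | exact Up].
    - cbv beta. change (sqrt (u t)) with (s t). rewrite Su. simpl. field. lra. }
  destruct (homogeneous_cubic_polar Q (s t) (x t) HQ) as [Q1 Q2].
  change (is_derive (fun t => s t * cos (x t)) t (lambda * (s t * cos (x t)) + fst (Q (polar (s t) (x t)))) /\
    is_derive (fun t => s t * sin (x t)) t (lambda * (s t * sin (x t)) + snd (Q (polar (s t) (x t))))).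
  rewrite Q1, Q2. split.
  - eapply is_derive_eq.
    + apply is_derive_mult_R; [exact Ds |]. apply (is_derive_comp_R cos x); [apply is_derive_cos | exact Dx].
    + rewrite Su. simpl. ring.
  - eapply is_derive_eq.
    + apply is_derive_mult_R; [exact Ds |]. apply (is_derive_comp_R sin x); [apply is_derive_sin | exact Dx].
    + rewrite Su. simpl. ring.
Qed.

Lemma clock_start (lambda w t0 : R) : clock lambda w t0 t0 = 1.
Proof.
  unfold clock. rewrite Rminus_diag, Rmult_0_r, exp_0. ring.
Qed.

Lemma canonical_start (lambda : R) (f g rho2 : R -> R) (B : R -> R -> R) (theta w t0 : R) :
  polar_flow lambda f g rho2 B ->
  canonical lambda rho2 B theta w t0 t0 = polar (sqrt (rho2 theta * w)) theta.
Proof.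
  intros HB. unfold canonical, angle_at. rewrite clock_start, ln_1, (pf_zero _ _ _ _ _ HB).
  rewrite Rminus_diag, Rmult_0_r, exp_0.
  now replace (rho2 theta * (w * 1 / 1)) with (rho2 theta * w) by field.
Qed.

Lemma canonical_through (lambda : R) (f g rho2 : R -> R) (B : R -> R -> R) (X : plane) (t0 : R) :
  polar_flow lambda f g rho2 B -> X <> (0, 0) ->
  exists theta w, 0 < w /\ canonical lambda rho2 B theta w t0 t0 = X.
Proof.
  intros HB HX. destruct (polar_coordinates X) as [r [x [Hr [_ E]]]].
  assert (Hp : 0 < r).
  { destruct Hr as [|Hr]; auto. exfalso. apply HX. rewrite E, <- Hr. unfold polar. f_equal; ring. }
  pose proof (rho2_pos _ _ _ _ _ x HB) as P.
  exists x, (r * r / rho2 x). split.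
  - apply Rdiv_lt_0_compat; auto. now apply Rmult_lt_0_compat.
  - rewrite (canonical_start _ _ _ _ _ _ _ _ HB), E. f_equal.
    replace (rho2 x * (r * r / rho2 x)) with (r * r) by (field; lra).
    now apply sqrt_square.
Qed.

(** With the clock as the only variable, the size of the orbit can be read off when the clock tends
    to 0 ([w > 1]) or to [1 - w] ([w < 1]). *)
Lemma canonical_norm (lambda : R) (f g rho2 : R -> R) (B : R -> R -> R) (theta w t0 t : R) :
  0 < lambda -> polar_flow lambda f g rho2 B -> 0 < w -> 0 < clock lambda w t0 t ->
  let X := canonical lambda rho2 B theta w t0 t in
  fst X ^ 2 + snd X ^ 2 =
    rho2 (angle_at lambda B theta w t0 t) * ((clock lambda w t0 t + (w - 1)) / clock lambda w t0 t).
Proof.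
  intros Hl HB Hw HE X. unfold X, canonical. rewrite polar_norm. simpl. rewrite Rmult_1_r, sqrt_sqrt.
  - f_equal. f_equal. unfold clock. ring.
  - apply Rmult_le_pos; [left; eapply rho2_pos, HB |]. apply Rdiv_le_0_compat; auto.
    apply Rmult_le_pos; [lra | left; apply exp_pos].
Qed.

(** Multiply the squared norm by the clock. Just after the time [start] the product is at least
    [c1 * (w - 1) > 0], whereas at that time the clock is not positive; for a solution defined
    there, the product would be continuous. *)
Lemma canonical_blow_up (lambda : R) (Q : plane -> plane) (rho2 : R -> R) (B : R -> R -> R)
    (theta w t0 : R) (a b : Rbar) (phi : R -> plane) :
  0 < lambda -> polar_flow lambda (radial Q) (angular Q) rho2 B -> 0 < w ->
  solution (system lambda Q) a b phi ->
  Rbar_lt a (start lambda w t0) -> Rbar_lt (start lambda w t0) b ->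
  (forall t, in_itv (start lambda w t0) b t -> phi t = canonical lambda rho2 B theta w t0 t) -> False.
Proof.
  intros Hl HB Hw Hphi Ha Hb Heq.
  assert (Hd : exists d, start lambda w t0 = Finite d /\ 1 < w).
  { unfold start in *. destruct (Rle_dec w 1); [destruct a; contradiction |]. eexists; split; [reflexivity | lra]. }
  destruct Hd as [d [Ed Hw1]]. rewrite Ed in *.
  destruct (pf_bounds _ _ _ _ _ HB) as [c1 [c2 [Hc1 Hc2]]].
  pose (q := fun t => (fst (phi t) ^ 2 + snd (phi t) ^ 2) * clock lambda w t0 t).
  assert (Cq : continuity_pt q d).
  { destruct (Hphi d (conj Ha Hb)) as [D1 D2].
    apply (continuity_pt_mult (fun t => fst (phi t) ^ 2 + snd (phi t) ^ 2)).
    - apply (continuity_pt_plus (fun t => fst (phi t) ^ 2) (fun t => snd (phi t) ^ 2)).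
      + eapply is_derive_continuity_pt.
        apply (is_derive_ext_R (fun t => fst (phi t) * fst (phi t))); [intros; simpl; ring |].
        apply is_derive_mult_R; exact D1.
      + eapply is_derive_continuity_pt.
        apply (is_derive_ext_R (fun t => snd (phi t) * snd (phi t))); [intros; simpl; ring |].
        apply is_derive_mult_R; exact D2.
    - eapply is_derive_continuity_pt, is_derive_clock. }
  assert (Hq0 : q d <= 0).
  { unfold q. assert (clock lambda w t0 d <= 0); [| pose proof (pow2_ge_0 (fst (phi d))); pose proof (pow2_ge_0 (snd (phi d))); nra].
    apply Rnot_lt_le. intros C. apply in_start in C; auto. rewrite Ed in C. destruct C as [C _]. simpl in C. lra. }
  destruct (Cq (c1 * (w - 1))) as [del [Hdel Hc]]; [apply Rmult_lt_0_compat; lra |].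
  assert (Ht : exists t, d < t < d + del /\ Rbar_lt t b).
  { destruct b as [b | |]; simpl in Hb; try contradiction.
    - exists (Rmin ((d + b) / 2) (d + del / 2)).
      pose proof (Rmin_l ((d + b) / 2) (d + del / 2)). pose proof (Rmin_r ((d + b) / 2) (d + del / 2)).
      assert (d < Rmin ((d + b) / 2) (d + del / 2)) by (apply Rmin_glb_lt; lra).
      simpl. lra.
    - exists (d + del / 2). simpl. split; [lra | trivial]. }
  destruct Ht as [t [Htd Htb]].
  assert (Hit : in_itv d b t) by (split; [simpl; lra | exact Htb]).
  assert (HE : 0 < clock lambda w t0 t).
  { apply in_start; auto. rewrite Ed. split; simpl; auto. lra. }
  specialize (Hc t). simpl in Hc. unfold R_dist in Hc.
  assert (Hc' : Rabs (q t - q d) < c1 * (w - 1)).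
  { apply Hc. split; [split; [exact I | lra] |]. rewrite Rabs_pos_eq; lra. }
  apply Rabs_lt_between in Hc'.
  assert (Q1 : q t = rho2 (angle_at lambda B theta w t0 t) * (clock lambda w t0 t + (w - 1))).
  { unfold q. rewrite (Heq t Hit), (canonical_norm _ _ _ _ _ _ _ _ _ Hl HB Hw HE). field. lra. }
  specialize (Hc2 (angle_at lambda B theta w t0 t)). nra.
Qed.

Lemma canonical_maximal (lambda : R) (Q : plane -> plane) (rho2 : R -> R) (B : R -> R -> R) (theta w t0 : R) :
  0 < lambda -> homogeneous_cubic Q -> polar_flow lambda (radial Q) (angular Q) rho2 B -> 0 < w ->
  maximal_solution (system lambda Q) (start lambda w t0) p_infty (canonical lambda rho2 B theta w t0).
Proof.
  intros Hl HQ HB Hw. split; [| split].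
  - unfold start. destruct (Rle_dec w 1); simpl; auto.
  - now apply canonical_solution.
  - intros a b phi Ha Hb Hphi Heq.
    assert (b = p_infty) by (destruct b; simpl in Hb; tauto). subst. split; auto.
    apply Rbar_le_lt_or_eq_dec in Ha. destruct Ha as [Ha | Ha]; auto. exfalso.
    apply (canonical_blow_up lambda Q rho2 B theta w t0 a p_infty phi); auto.
    unfold start. destruct (Rle_dec w 1); simpl; auto.
Qed.

Lemma system_zero (lambda : R) (Q : plane -> plane) :
  homogeneous_cubic Q -> system lambda Q (0, 0) = (0, 0).
Proof.
  intros H. destruct (homogeneous_cubic_scale Q 0 0 0 H) as [H1 H2].
  rewrite !Rmult_0_l in H1, H2. unfold system; simpl. rewrite H1, H2. f_equal; ring.
Qed.

Lemma zero_solution (lambda : R) (Q : plane -> plane) (a b : Rbar) :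
  homogeneous_cubic Q -> solution (system lambda Q) a b (fun _ => (0, 0)).
Proof.
  intros H t _. rewrite system_zero by assumption. split; apply is_derive_const_R.
Qed.

Lemma zero_maximal (lambda : R) (Q : plane -> plane) :
  homogeneous_cubic Q -> maximal_solution (system lambda Q) m_infty p_infty (fun _ => (0, 0)).
Proof.
  intros H. split; [exact I | split; [now apply zero_solution |]].
  intros a b phi Ha Hb _ _. destruct a, b; simpl in *; tauto.
Qed.

Lemma interval_point (a b : Rbar) : Rbar_lt a b -> exists t, in_itv a b t.
Proof.
  intros H. destruct a as [a | |], b as [b | |]; simpl in H; try contradiction; unfold in_itv; simpl.
  - exists ((a + b) / 2). lra.
  - exists (a + 1). lra.
  - exists (b - 1). lra.
  - exists 0. tauto.
Qed.

Lemma solution_restrict (F : plane -> plane) (a b a' b' : Rbar) (phi : R -> plane) :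
  solution F a b phi -> Rbar_le a a' -> Rbar_le b' b -> solution F a' b' phi.
Proof.
  intros H Ha Hb t [H1 H2]. apply H. split.
  - eapply Rbar_le_lt_trans; eassumption.
  - eapply Rbar_lt_le_trans; eassumption.
Qed.

Lemma start_lt (lambda w t0 : R) : 0 < lambda -> 0 < w -> in_itv (start lambda w t0) p_infty t0.
Proof. intros Hl Hw. apply in_start; auto. rewrite clock_start. lra. Qed.

Lemma solution_canonical (lambda : R) (Q : plane -> plane) (rho2 : R -> R) (B : R -> R -> R)
    (theta w t0 : R) (a b : Rbar) (phi : R -> plane) :
  0 < lambda -> homogeneous_cubic Q -> polar_flow lambda (radial Q) (angular Q) rho2 B -> 0 < w ->
  solution (system lambda Q) a b phi -> in_itv a b t0 ->
  phi t0 = canonical lambda rho2 B theta w t0 t0 ->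
  Rbar_le (start lambda w t0) a /\
  forall t, in_itv a b t -> phi t = canonical lambda rho2 B theta w t0 t.
Proof.
  intros Hl HQ HB Hw Hphi Ht0 E.
  (* Used twice: with [a' = start], to exclude by blow-up that the solution begins earlier, and then
     with [a' = a]. *)
  assert (U : forall a', Rbar_le a a' -> Rbar_le (start lambda w t0) a' -> Rbar_lt a' t0 ->
    forall t, in_itv a' b t -> phi t = canonical lambda rho2 B theta w t0 t).
  { intros a' H1 H2 H3 t Ht. apply (solution_unique lambda Q a' b _ _ t0); auto.
    - eapply solution_restrict; [exact Hphi | auto |]. apply Rbar_le_refl.
    - eapply solution_restrict; [apply canonical_solution; auto | auto |]. destruct b; simpl; auto.
    - split; [auto | apply Ht0]. }
  assert (Hs : Rbar_le (start lambda w t0) a).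
  { apply Rbar_not_lt_le. intros C.
    apply (canonical_blow_up lambda Q rho2 B theta w t0 a b phi); auto.
    - eapply Rbar_lt_trans; [apply start_lt; auto | apply Ht0].
    - apply U; [now apply Rbar_lt_le | apply Rbar_le_refl | now apply start_lt]. }
  split; auto. apply U; auto; [apply Rbar_le_refl | apply Ht0].
Qed.

(** A solution that meets the origin stays there by uniqueness; any other one agrees with a
    canonical solution, and maximality forces the two intervals to coincide. *)
Lemma maximal_solution_canonical (lambda : R) (Q : plane -> plane) (rho2 : R -> R) (B : R -> R -> R)
    (a b : Rbar) (phi : R -> plane) :
  0 < lambda -> homogeneous_cubic Q -> polar_flow lambda (radial Q) (angular Q) rho2 B ->
  maximal_solution (system lambda Q) a b phi ->
  (a = m_infty /\ b = p_infty /\ forall t, phi t = (0, 0)) \/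
  exists theta w t0, 0 < w /\ a = start lambda w t0 /\ b = p_infty /\
    forall t, in_itv a b t -> phi t = canonical lambda rho2 B theta w t0 t.
Proof.
  intros Hl HQ HB [Hab [Hphi Hmax]]. destruct (interval_point a b Hab) as [t0 Ht0].
  destruct (classic (phi t0 = (0, 0))) as [E | E].
  - left.
    assert (Z : forall t, in_itv a b t -> (0, 0) = phi t).
    { intros t Ht. apply (solution_unique lambda Q a b (fun _ => (0, 0)) phi t0); auto.
      now apply zero_solution. }
    destruct (Hmax m_infty p_infty (fun _ => (0, 0))) as [A1 A2]; auto.
    + exact I.
    + destruct b; exact I.
    + now apply zero_solution.
    + subst. repeat split; auto. intros t. symmetry. apply Z. split; exact I.
  - right. destruct (canonical_through _ _ _ _ _ (phi t0) t0 HB E) as [theta [w [Hw Hc]]].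
    exists theta, w, t0.
    destruct (solution_canonical lambda Q rho2 B theta w t0 a b phi) as [Hs Hp]; auto.
    destruct (Hmax (start lambda w t0) p_infty (canonical lambda rho2 B theta w t0)) as [A1 A2]; auto.
    + destruct b; exact I.
    + now apply canonical_solution.
    + intros t Ht. symmetry. auto.
Qed.

(** * The invariant circle *)

Section Continuity.
Context {U : UniformSpace}.

Lemma continuous_pair (f g : U -> R) (x : U) :
  continuous f x -> continuous g x -> continuous (fun y => (f y, g y)) x.
Proof.
  intros Hf Hg. apply (continuous_comp_2 f g (fun a b => (a, b))); auto.
  apply (continuous_ext (fun p : R * R => p)); [now intros [] |]. apply continuous_id.
Qed.

Lemma continuous_plus_R (f g : U -> R) (x : U) :
  continuous f x -> continuous g x -> continuous (fun y => f y + g y) x.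
Proof. apply (continuous_plus f g). Qed.

Lemma continuous_minus_R (f g : U -> R) (x : U) :
  continuous f x -> continuous g x -> continuous (fun y => f y - g y) x.
Proof. apply (continuous_minus f g). Qed.

Lemma continuous_mult_R (f g : U -> R) (x : U) :
  continuous f x -> continuous g x -> continuous (fun y => f y * g y) x.
Proof. apply (continuous_mult f g). Qed.

Lemma continuous_const_R (c : R) (x : U) : continuous (fun _ => c) x.
Proof. apply continuous_const. Qed.

Lemma continuous_comp_real (f : U -> R) (w : R -> R) (x : U) :
  continuous f x -> continuous w (f x) -> continuous (fun y => w (f y)) x.
Proof. apply (continuous_comp f w). Qed.

Lemma continuous_div_R (f g : U -> R) (x : U) :
  continuous f x -> continuous g x -> g x <> 0 -> continuous (fun y => f y / g y) x.
Proof.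
  intros Hf Hg H. apply continuous_mult_R; auto.
  apply (continuous_comp_real g Rinv); auto. apply continuous_Rinv; auto.
Qed.

(** Made for the origin, where the angle has no limit and only a bound on the radius is
    available. *)
Lemma continuous_squeeze_zero (u m : U -> R) (x : U) :
  (forall y, Rabs (u y) <= m y) -> continuous m x -> m x = 0 -> continuous u x.
Proof.
  intros H Hm Hx.
  assert (Hu : u x = 0).
  { specialize (H x). rewrite Hx in H. apply Rabs_eq_0, Rle_antisym; [auto | apply Rabs_pos]. }
  apply filterlim_locally. intros eps.
  apply (proj1 (filterlim_locally _ _)) with (eps := eps) in Hm.
  revert Hm. apply filter_imp. intros y Hy.
  rewrite Hu. rewrite Hx in Hy.
  unfold ball, AbsRing_ball in *; simpl in *. unfold AbsRing_ball, abs, minus, plus, opp in *; simpl in *.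
  specialize (H y). pose proof (Rle_abs (m y + - 0)). rewrite Ropp_0, Rplus_0_r in *. lra.
Qed.

End Continuity.

Lemma continuous_cos_R (x : R) : continuous cos x.
Proof. apply continuity_pt_filterlim, continuity_cos. Qed.

Lemma continuous_sin_R (x : R) : continuous sin x.
Proof. apply continuity_pt_filterlim, continuity_sin. Qed.

Lemma continuous_polar {U : UniformSpace} (r x : U -> R) (p : U) :
  continuous r p -> continuous x p -> continuous (fun q => polar (r q) (x q)) p.
Proof.
  intros Hr Hx. apply (continuous_pair (fun q => r q * cos (x q)) (fun q => r q * sin (x q)));
    apply continuous_mult_R; auto; apply (continuous_comp_real x); auto.
  - apply continuous_cos_R.
  - apply continuous_sin_R.
Qed.

(** The codomain is arbitrary: the lemma serves for real functions, for curves in the plane and for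
    predicates. *)
Lemma periodic_multiple {A : Type} (u : R -> A) (P : R) :
  (forall x, u (x + P) = u x) -> forall n x, u (x + IZR n * P) = u x.
Proof.
  intros H.
  assert (N : forall n x, u (x + INR n * P) = u x).
  { induction n as [| n IH]; intros x.
    - simpl. f_equal. ring.
    - rewrite S_INR. replace (x + (INR n + 1) * P) with (x + INR n * P + P) by ring. now rewrite H. }
  intros n x. destruct (Z_le_gt_dec 0 n) as [Hn | Hn].
  - rewrite <- (Z2Nat.id n Hn), <- INR_IZR_INZ. apply N.
  - rewrite <- (N (Z.to_nat (- n)) (x + IZR n * P)). f_equal.
    rewrite INR_IZR_INZ, Z2Nat.id, opp_IZR by lia. ring.
Qed.

Lemma equivariant_multiple (u : R -> R) (P P' : R) :
  (forall x, u (x + P) = u x + P') -> forall n x, u (x + IZR n * P) = u x + IZR n * P'.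
Proof.
  intros H.
  assert (N : forall n x, u (x + INR n * P) = u x + INR n * P').
  { induction n as [| n IH]; intros x.
    - simpl. rewrite !Rmult_0_l, !Rplus_0_r. reflexivity.
    - rewrite S_INR. replace (x + (INR n + 1) * P) with (x + INR n * P + P) by ring.
      rewrite H, IH. ring. }
  intros n x. destruct (Z_le_gt_dec 0 n) as [Hn | Hn].
  - rewrite <- (Z2Nat.id n Hn), <- INR_IZR_INZ. apply N.
  - pose proof (N (Z.to_nat (- n)) (x + IZR n * P)) as E.
    rewrite INR_IZR_INZ, Z2Nat.id, opp_IZR in E by lia.
    replace (x + IZR n * P + - IZR n * P) with x in E by ring. lra.
Qed.

Lemma reduce_modulo (a P x : R) : 0 < P -> exists n, a <= x + IZR n * P < a + P.
Proof.
  intros HP. exists (- Int_part ((x - a) / P))%Z. rewrite opp_IZR.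
  destruct (base_Int_part ((x - a) / P)) as [H1 H2].
  assert (E : (x - a) / P * P = x - a) by (field; lra).
  set (k := IZR (Int_part ((x - a) / P))) in *. set (q := (x - a) / P) in *. nra.
Qed.

Lemma cos_shift (x : R) : cos (x + 2 * PI) = cos x.
Proof. replace (x + 2 * PI) with (x + 2 * INR 1 * PI) by (simpl; ring). apply cos_period. Qed.

Lemma sin_shift (x : R) : sin (x + 2 * PI) = sin x.
Proof. replace (x + 2 * PI) with (x + 2 * INR 1 * PI) by (simpl; ring). apply sin_period. Qed.

Lemma polar_shift (r x : R) : polar r (x + 2 * PI) = polar r x.
Proof. unfold polar. now rewrite cos_shift, sin_shift. Qed.

Lemma polar_angle (r x y : R) :
  0 < r -> polar r x = polar r y -> exists n, y = x + IZR n * (2 * PI).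
Proof.
  intros Hr E. unfold polar in E. injection E as E1 E2. pose proof PI_RGT_0.
  apply Rmult_eq_reg_l in E1; [| lra]. apply Rmult_eq_reg_l in E2; [| lra].
  destruct (reduce_modulo 0 (2 * PI) x ltac:(lra)) as [n Hn].
  destruct (reduce_modulo 0 (2 * PI) y ltac:(lra)) as [m Hm].
  exists (n - m)%Z.
  assert (K : x + IZR n * (2 * PI) = y + IZR m * (2 * PI)).
  { apply unit_vec_injective; try lra.
    - rewrite !(periodic_multiple cos _ cos_shift). exact E1.
    - rewrite !(periodic_multiple sin _ sin_shift). exact E2. }
  rewrite minus_IZR. lra.
Qed.

Definition circle (rho2 : R -> R) (X : plane) : Prop :=
  exists theta, X = polar (sqrt (rho2 theta)) theta.

Lemma pf_period2 (lambda : R) (f g rho2 : R -> R) (B : R -> R -> R) (x : R) :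
  polar_flow lambda f g rho2 B -> rho2 (x + 2 * PI) = rho2 x.
Proof.
  intros H. replace (x + 2 * PI) with (x + PI + PI) by ring.
  now rewrite !(pf_period _ _ _ _ _ H).
Qed.

Lemma circle_angle (lambda : R) (f g rho2 : R -> R) (B : R -> R -> R) (X : plane) :
  polar_flow lambda f g rho2 B -> circle rho2 X ->
  exists theta, 0 <= theta < 2 * PI /\ X = polar (sqrt (rho2 theta)) theta.
Proof.
  intros HB [x Hx]. pose proof PI_RGT_0.
  destruct (reduce_modulo 0 (2 * PI) x ltac:(lra)) as [n Hn].
  exists (x + IZR n * (2 * PI)). split; [lra |]. rewrite Hx.
  rewrite (periodic_multiple rho2 (2 * PI)) by (intros; eapply pf_period2, HB).
  symmetry. apply (periodic_multiple (polar (sqrt (rho2 x)))). apply polar_shift.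
Qed.

Lemma circle_topological (lambda : R) (f g rho2 : R -> R) (B : R -> R -> R) :
  polar_flow lambda f g rho2 B -> topological_circle (circle rho2).
Proof.
  intros HB. exists (fun t => polar (sqrt (rho2 t)) t).
  assert (P : forall x, 0 < sqrt (rho2 x)) by (intros; apply sqrt_lt_R0; eapply rho2_pos, HB).
  repeat split.
  - intros t. apply continuous_polar; [| apply continuous_id].
    apply (continuous_comp_real rho2 sqrt); [apply (pf_cont _ _ _ _ _ HB) | apply continuous_sqrt].
  - intros t. rewrite (pf_period2 _ _ _ _ _ _ HB). apply polar_shift.
  - intros t u Ht Hu E.
    assert (R : sqrt (rho2 t) = sqrt (rho2 u)).
    { apply (polar_radius_unique _ _ t u); auto; left; apply P. }
    rewrite R in E. unfold polar in E. injection E as E1 E2. specialize (P u).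
    apply unit_vec_injective; auto; eapply Rmult_eq_reg_l; try eassumption; lra.
  - intros HX. destruct (circle_angle _ _ _ _ _ _ HB HX) as [x [Hx E]]. exists x. auto.
  - intros [t [_ E]]. exists t. auto.
Qed.

Lemma circle_canonical (lambda : R) (f g rho2 : R -> R) (B : R -> R -> R) (theta t0 t : R) :
  polar_flow lambda f g rho2 B -> circle rho2 (canonical lambda rho2 B theta 1 t0 t).
Proof.
  intros HB. exists (angle_at lambda B theta 1 t0 t). unfold canonical. f_equal. f_equal.
  unfold clock. pose proof (exp_pos (2 * lambda * (t - t0))). field. lra.
Qed.

Lemma circle_invariant (lambda : R) (Q : plane -> plane) (rho2 : R -> R) (B : R -> R -> R) :
  0 < lambda -> homogeneous_cubic Q -> polar_flow lambda (radial Q) (angular Q) rho2 B ->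
  flow_invariant (system lambda Q) (circle rho2).
Proof.
  intros Hl HQ HB a b phi Hphi t u Ht Hu [x Hx].
  destruct (solution_canonical lambda Q rho2 B x 1 t a b phi) as [_ H]; auto; try lra.
  - rewrite (canonical_start _ _ _ _ _ _ _ _ HB), Rmult_1_r. exact Hx.
  - rewrite (H u Hu). eapply circle_canonical, HB.
Qed.

Lemma intermediate_value (f : R -> R) (a b y : R) :
  (forall x, continuous f x) -> a <= b -> (f a <= y <= f b \/ f b <= y <= f a) ->
  exists x, a <= x <= b /\ f x = y.
Proof.
  intros Hf Hab Hy. destruct (IVT_gen f a b y) as [x [Hx E]].
  - intros x. apply continuity_pt_filterlim, Hf.
  - unfold Rmin, Rmax. destruct (Rle_dec (f a) (f b)); lra.
  - exists x. rewrite Rmin_left, Rmax_right in Hx by lra. auto.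
Qed.

(** The value half-way between [k 0] and [k (P / 2)] is attained on each half of the period. *)
Lemma no_injective_loop (k : R -> R) (P : R) :
  0 < P -> (forall x, continuous k x) -> k P = k 0 ->
  (forall t u, 0 <= t < P -> 0 <= u < P -> k t = k u -> t = u) -> False.
Proof.
  intros HP Hk HE Hi.
  assert (N : k (P / 2) <> k 0) by (intros E; apply Hi in E; lra).
  destruct (intermediate_value k 0 (P / 2) ((k 0 + k (P / 2)) / 2)) as [t [Ht Et]]; auto; try lra.
  destruct (intermediate_value k (P / 2) P ((k 0 + k (P / 2)) / 2)) as [u [Hu Eu]]; auto; try lra.
  assert (t <> P / 2) by (intros ->; lra). assert (u <> P) by (intros ->; lra).
  assert (t = u) by (apply Hi; lra). subst. lra.
Qed.

Lemma circle_norm_bounds (C : plane -> Prop) :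
  topological_circle C -> ~ C (0, 0) ->
  exists c M, 0 < c /\ forall X, C X -> c <= fst X ^ 2 + snd X ^ 2 <= M.
Proof.
  intros [gam [Hc [Hp [_ HC]]]] H0. pose proof PI_RGT_0.
  pose (N := fun t => fst (gam t) ^ 2 + snd (gam t) ^ 2).
  assert (CN : forall t, continuity_pt N t).
  { intros t. apply continuity_pt_filterlim.
    apply (continuous_ext (fun t => fst (gam t) * fst (gam t) + snd (gam t) * snd (gam t)));
      [intros; unfold N; simpl; ring |].
    assert (C1 : continuous (fun t => fst (gam t)) t)
      by (apply (continuous_comp gam fst); [apply Hc | destruct (gam t); apply continuous_fst]).
    assert (C2 : continuous (fun t => snd (gam t)) t)
      by (apply (continuous_comp gam snd); [apply Hc | destruct (gam t); apply continuous_snd]).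
    apply continuous_plus_R; apply continuous_mult_R; auto. }
  destruct (continuity_ab_min N 0 (2 * PI)) as [m [Hm Im]]; [lra | auto |].
  destruct (continuity_ab_maj N 0 (2 * PI)) as [p [Hpm Ip]]; [lra | auto |].
  exists (N m), (N p). split.
  - assert (Cm : C (gam m)).
    (* A minimum at [2 * PI], outside the half-open range of parameters, is moved to 0. *)
    { apply HC. destruct (Req_dec m (2 * PI)) as [E | E].
      - exists 0. split; [lra |]. rewrite <- (Hp 0), E. f_equal. ring.
      - exists m. split; [lra | auto]. }
    unfold N. destruct (gam m) as [x y]. simpl fst; simpl snd.
    destruct (Req_dec x 0) as [Ex | Ex]; destruct (Req_dec y 0) as [Ey | Ey].
    + subst. contradiction.
    + pose proof (pow2_gt_0 y Ey). pose proof (pow2_ge_0 x). lra.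
    + pose proof (pow2_gt_0 x Ex). pose proof (pow2_ge_0 y). lra.
    + pose proof (pow2_gt_0 x Ex). pose proof (pow2_ge_0 y). lra.
  - intros X HX. apply HC in HX. destruct HX as [t [Ht <-]].
    split; [apply Hm; lra | apply Hpm; lra].
Qed.

(** On any other orbit the distance to the origin has infimum [0] or supremum [+oo]. *)
Lemma invariant_circle_included (lambda : R) (Q : plane -> plane) (rho2 : R -> R) (B : R -> R -> R)
    (C : plane -> Prop) (X : plane) :
  0 < lambda -> homogeneous_cubic Q -> polar_flow lambda (radial Q) (angular Q) rho2 B ->
  invariant_circle (system lambda Q) C -> C X -> circle rho2 X.
Proof.
  intros Hl HQ HB [HT [H0 HI]] HX.
  destruct (circle_norm_bounds C HT H0) as [c [M [Hc HM]]].
  assert (X0 : X <> (0, 0)) by (intros ->; contradiction).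
  destruct (canonical_through _ _ _ _ _ X 0 HB X0) as [x [w [Hw E]]].
  destruct (pf_bounds _ _ _ _ _ HB) as [c1 [c2 [Hc1 Hc2]]].
  (* Every [e > 0] that keeps the clock positive is the exponential at some time of the orbit, so
     the bounds on [C] become bounds for all such [e]. *)
  assert (K : forall e, 0 < e -> 0 < 1 + w * (e - 1) ->
    exists r, c1 <= r <= c2 /\ c <= r * (w * e / (1 + w * (e - 1))) <= M).
  { intros e He HE. pose (t := ln e / (2 * lambda)).
    assert (Et : exp (2 * lambda * (t - 0)) = e).
    { unfold t. rewrite <- (exp_ln e He) at 2. f_equal. field. lra. }
    assert (Ec : clock lambda w 0 t = 1 + w * (e - 1)) by (unfold clock; now rewrite Et).
    assert (CX : C (canonical lambda rho2 B x w 0 t)).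
    { apply (HI (start lambda w 0) p_infty (canonical lambda rho2 B x w 0)) with 0.
      - now apply canonical_solution.
      - now apply start_lt.
      - apply in_start; auto. rewrite Ec. exact HE.
      - now rewrite E. }
    apply HM in CX. exists (rho2 (angle_at lambda B x w 0 t)). split; auto.
    rewrite (canonical_norm _ _ _ _ _ _ _ _ _ Hl HB Hw) in CX by (rewrite Ec; exact HE).
    rewrite Ec in CX. replace (w * e) with (1 + w * (e - 1) + (w - 1)) by ring. exact CX. }
  destruct (Rtotal_order w 1) as [Hw1 | [Hw1 | Hw1]].
  (* Inside the circle the clock is at least [1 - w]; this [e] makes the squared norm at most
     [c2 * (c / (2 * c2)) = c / 2], below the lower bound [c]. *)
  - exfalso. pose (e := Rmin 1 (c * (1 - w) / (2 * c2))).
    assert (0 < c2) by (specialize (Hc2 0); lra).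
    assert (P : 0 < c * (1 - w) / (2 * c2)).
    { apply Rdiv_lt_0_compat; [apply Rmult_lt_0_compat |]; lra. }
    assert (0 < e) by (apply Rmin_glb_lt; lra).
    assert (He : e <= c * (1 - w) / (2 * c2)) by apply Rmin_r.
    assert (HE : 1 - w <= 1 + w * (e - 1)) by nra.
    destruct (K e) as [r [Hr [Hcr _]]]; [lra | lra |].
    assert (w * e / (1 + w * (e - 1)) <= w * e / (1 - w)).
    { apply Rmult_le_compat_l; [apply Rmult_le_pos; lra |]. apply Rinv_le_contravar; lra. }
    assert (w * e / (1 - w) <= c / (2 * c2)).
    { apply Rmult_le_reg_r with (1 - w); [lra |]. unfold Rdiv at 1. rewrite Rmult_assoc, Rinv_l by lra.
      replace (c / (2 * c2) * (1 - w)) with (c * (1 - w) / (2 * c2)) by (field; lra). nra. }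
    assert (r * (w * e / (1 + w * (e - 1))) <= c2 * (c / (2 * c2))).
    { apply Rmult_le_compat; try lra. apply Rdiv_le_0_compat; [apply Rmult_le_pos; lra | lra]. }
    replace (c2 * (c / (2 * c2))) with (c / 2) in * by (field; lra). lra.
  - rewrite Hw1 in E. rewrite <- E. eapply circle_canonical, HB.
  (* [d] is the value given to the clock. It is so small that [c1 * (w - 1) / d = Rabs M + 1], and
     the squared norm exceeds [M]. *)
  - exfalso. pose (d := c1 * (w - 1) / (Rabs M + 1)). pose proof (Rabs_pos M). pose proof (Rle_abs M).
    assert (Pd : 0 < d) by (apply Rdiv_lt_0_compat; [apply Rmult_lt_0_compat |]; lra).
    destruct (K ((d + (w - 1)) / w)) as [r [Hr [_ Hcr]]].
    + apply Rdiv_lt_0_compat; lra.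
    + replace (1 + w * ((d + (w - 1)) / w - 1)) with d by (field; lra). exact Pd.
    + replace (1 + w * ((d + (w - 1)) / w - 1)) with d in Hcr by (field; lra).
      replace (w * ((d + (w - 1)) / w) / d) with (1 + (w - 1) / d) in Hcr by (field; lra).
      assert (c1 * ((w - 1) / d) = Rabs M + 1) by (unfold d; field; lra).
      assert (0 < (w - 1) / d) by (apply Rdiv_lt_0_compat; lra). nra.
Qed.

(** Stereographic projection of the unit circle from [(1, 0)]. *)
Lemma stereographic_injective (c s c' s' : R) :
  c * c + s * s = 1 -> c' * c' + s' * s' = 1 -> c <> 1 -> c' <> 1 ->
  s / (1 - c) = s' / (1 - c') -> c = c' /\ s = s'.
Proof.
  intros H H' N N' E. set (k := s / (1 - c)) in *.
  assert (Es : s = k * (1 - c)) by (unfold k; field; lra).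
  assert (Es' : s' = k * (1 - c')) by (rewrite E; field; lra).
  assert (A : (1 + c) = k * k * (1 - c)).
  { apply Rmult_eq_reg_r with (1 - c); [| lra]. transitivity (s * s); [lra | rewrite Es; ring]. }
  assert (A' : (1 + c') = k * k * (1 - c')).
  { apply Rmult_eq_reg_r with (1 - c'); [| lra]. transitivity (s' * s'); [lra | rewrite Es'; ring]. }
  assert (c = c') by nra. subst c'. split; congruence.
Qed.

(** If the curve missed the point of the graph at angle [b], stereographic projection from the
    direction [b] would carry it continuously and injectively into the line, against
    [no_injective_loop]. *)
Lemma circle_included (rho2 : R -> R) (C : plane -> Prop) :
  (forall x, 0 < rho2 x) -> (forall x, rho2 (x + 2 * PI) = rho2 x) ->
  topological_circle C -> (forall X, C X -> circle rho2 X) -> forall X, circle rho2 X -> C X.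
Proof.
  intros Hpos Hper [gam [Hc [Hp [Hi HC]]]] Hsub Y [b HY]. apply NNPP. intros HN.
  pose proof PI_RGT_0.
  assert (HCg : forall t, C (gam t)).
  { intros t. apply HC. destruct (reduce_modulo 0 (2 * PI) t ltac:(lra)) as [n Hn].
    exists (t + IZR n * (2 * PI)). split; [lra |]. now apply (periodic_multiple gam). }
  assert (Hang : forall t, exists x, gam t = polar (sqrt (rho2 x)) x) by (intros; now apply Hsub).
  pose (nrm := fun t => sqrt (fst (gam t) * fst (gam t) + snd (gam t) * snd (gam t))).
  (* Cosine and sine of the angle measured from [b], as continuous functions of the parameter; the
     angle itself need not be chosen continuously. *)
  pose (co := fun t => (fst (gam t) * cos b + snd (gam t) * sin b) / nrm t).
  pose (si := fun t => (snd (gam t) * cos b - fst (gam t) * sin b) / nrm t).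
  assert (Hrep : forall t x, gam t = polar (sqrt (rho2 x)) x ->
    nrm t = sqrt (rho2 x) /\ 0 < nrm t /\ co t = cos (x - b) /\ si t = sin (x - b)).
  { intros t x E. assert (P : 0 < sqrt (rho2 x)) by now apply sqrt_lt_R0.
    assert (En : nrm t = sqrt (rho2 x)).
    { unfold nrm. pose proof (polar_norm (sqrt (rho2 x)) x) as PN. rewrite <- E in PN.
      replace (fst (gam t) * fst (gam t) + snd (gam t) * snd (gam t)) with (sqrt (rho2 x) ^ 2) by (rewrite <- PN; ring).
      replace (sqrt (rho2 x) ^ 2) with (sqrt (rho2 x) * sqrt (rho2 x)) by ring.
      apply sqrt_square. lra. }
    rewrite cos_minus, sin_minus. unfold co, si. rewrite En, E. unfold polar. simpl.
    repeat split; auto; field; lra. }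
  assert (Hn : forall t, 0 < nrm t) by (intros t; destruct (Hang t) as [x Hx]; now apply (Hrep t x)).
  assert (H1 : forall t, co t * co t + si t * si t = 1).
  { intros t. destruct (Hang t) as [x Hx]. destruct (Hrep t x Hx) as [_ [_ [-> ->]]]. apply cos2_sin2. }
  assert (HY' : forall t x, gam t = polar (sqrt (rho2 x)) x -> forall u y, gam u = polar (sqrt (rho2 y)) y ->
    co t = co u -> si t = si u -> gam t = gam u).
  { intros t x E u y E' Ec Es. destruct (Hrep t x E) as [_ [_ [C1 S1]]]. destruct (Hrep u y E') as [_ [_ [C2 S2]]].
    destruct (polar_angle 1 (x - b) (y - b)) as [n En]; [lra | unfold polar; f_equal; f_equal; congruence |].
    rewrite E, E'. replace y with (x + IZR n * (2 * PI)) by lra.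
    rewrite (periodic_multiple rho2) by auto.
    symmetry. apply (periodic_multiple (polar (sqrt (rho2 x)))), polar_shift. }
  assert (Hne : forall t, co t <> 1).
  { intros t Et. assert (Est : si t = 0) by (specialize (H1 t); rewrite Et in H1; nra).
    destruct (Hang t) as [x Hx]. destruct (Hrep t x Hx) as [_ [_ [C1 S1]]].
    apply HN. replace Y with (gam t); [apply HCg |]. rewrite HY, Hx.
    destruct (polar_angle 1 0 (x - b)) as [n En];
      [lra | unfold polar; rewrite cos_0, sin_0; f_equal; f_equal; congruence |].
    replace x with (b + IZR n * (2 * PI)) by lra.
    rewrite (periodic_multiple rho2) by auto.
    apply (periodic_multiple (polar (sqrt (rho2 b)))), polar_shift. }
  apply (no_injective_loop (fun t => si t / (1 - co t)) (2 * PI)).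
  - lra.
  - intros t.
    assert (C1 : continuous (fun t => fst (gam t)) t)
      by (apply (continuous_comp gam fst); [apply Hc | destruct (gam t); apply continuous_fst]).
    assert (C2 : continuous (fun t => snd (gam t)) t)
      by (apply (continuous_comp gam snd); [apply Hc | destruct (gam t); apply continuous_snd]).
    assert (C3 : continuous nrm t).
    { apply (continuous_comp_real (fun t => fst (gam t) * fst (gam t) + snd (gam t) * snd (gam t)) sqrt).
      - apply continuous_plus_R; apply continuous_mult_R; auto.
      - apply continuous_sqrt. }
    specialize (Hn t). specialize (Hne t).
    apply continuous_div_R; [| | lra].
    + apply continuous_div_R; [| auto | lra].
      apply continuous_minus_R; apply continuous_mult_R; auto; apply continuous_const_R.
    + apply continuous_minus_R; [apply continuous_const_R |].
      apply continuous_div_R; [| auto | lra].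
      apply continuous_plus_R; apply continuous_mult_R; auto; apply continuous_const_R.
  - unfold si, co, nrm. replace (gam (2 * PI)) with (gam 0); auto. rewrite <- (Hp 0). f_equal. ring.
  - intros t u Ht Hu E. apply Hi; auto.
    destruct (stereographic_injective (co t) (si t) (co u) (si u)) as [E1 E2]; auto.
    destruct (Hang t) as [x Hx]. destruct (Hang u) as [y Hy]. eapply HY'; eauto.
Qed.

Lemma the_invariant_circle_polar (lambda : R) (Q : plane -> plane) (rho2 : R -> R) (B : R -> R -> R) :
  0 < lambda -> homogeneous_cubic Q -> polar_flow lambda (radial Q) (angular Q) rho2 B ->
  the_invariant_circle (system lambda Q) (circle rho2).
Proof.
  intros Hl HQ HB. split.
  - split; [| split].
    + eapply circle_topological, HB.
    + intros [x Hx]. assert (P : 0 < sqrt (rho2 x)) by (apply sqrt_lt_R0; eapply rho2_pos, HB).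
      pose proof (polar_norm (sqrt (rho2 x)) x) as N. rewrite <- Hx in N. simpl in N. nra.
    + eapply circle_invariant; eassumption.
  - intros C HC X. split.
    + eapply invariant_circle_included; eassumption.
    + apply circle_included; try apply HC.
      * intros x. eapply rho2_pos, HB.
      * intros x. eapply pf_period2, HB.
      * intros Y. eapply invariant_circle_included; eassumption.
Qed.

Lemma equilibrium_on_circle (lambda : R) (Q : plane -> plane) (rho2 : R -> R) (B : R -> R -> R) (X : plane) :
  0 < lambda -> homogeneous_cubic Q -> polar_flow lambda (radial Q) (angular Q) rho2 B ->
  (equilibrium_on (system lambda Q) (circle rho2) X <->
   exists theta, 0 <= theta < 2 * PI /\ angular Q theta = 0 /\ X = polar (sqrt (rho2 theta)) theta).
Proof.
  intros Hl HQ HB.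
  assert (EF : forall x, system lambda Q (polar (sqrt (rho2 x)) x) =
    (sqrt (rho2 x) * ((lambda + radial Q x * rho2 x) * cos x - angular Q x * rho2 x * sin x),
     sqrt (rho2 x) * ((lambda + radial Q x * rho2 x) * sin x + angular Q x * rho2 x * cos x))).
  { intros x. pose proof (rho2_pos _ _ _ _ _ x HB) as P.
    destruct (homogeneous_cubic_polar Q (sqrt (rho2 x)) x HQ) as [E1 E2].
    unfold system. rewrite E1, E2. unfold polar; simpl fst; simpl snd.
    replace (sqrt (rho2 x) ^ 3) with (sqrt (rho2 x) * (sqrt (rho2 x) * sqrt (rho2 x))) by ring.
    rewrite sqrt_sqrt by lra. f_equal; ring. }
  split.
  - intros [HC HE]. destruct (circle_angle _ _ _ _ _ _ HB HC) as [x [Hx E]].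
    exists x. repeat split; try apply Hx; auto. rewrite E, EF in HE. injection HE as H1 H2.
    pose proof (rho2_pos _ _ _ _ _ x HB) as P. assert (P' : 0 < sqrt (rho2 x)) by now apply sqrt_lt_R0.
    apply Rmult_integral in H1. apply Rmult_integral in H2.
    destruct H1 as [H1 | H1]; [lra |]. destruct H2 as [H2 | H2]; [lra |].
    pose proof (cos2_sin2 x).
    apply Rmult_eq_reg_r with (rho2 x); [| lra].
    (* Projection of the field on the direction perpendicular to the ray. *)
    transitivity (angular Q x * rho2 x * (cos x * cos x + sin x * sin x)); [rewrite H; ring |].
    transitivity (((lambda + radial Q x * rho2 x) * sin x + angular Q x * rho2 x * cos x) * cos x
      - ((lambda + radial Q x * rho2 x) * cos x - angular Q x * rho2 x * sin x) * sin x); [ring |].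
    rewrite H1, H2. ring.
  - intros [x [_ [Hg E]]]. split; [exists x; exact E |]. rewrite E, EF, Hg.
    pose proof (rho2_pos _ _ _ _ _ x HB) as P.
    (* At a zero of [g] the angle does not move, so [rho2] is constant along the orbit and the
       right-hand side of [pf_radius] vanishes. This gives the radial component. *)
    assert (Z : rho2 x + radial Q x * rho2 x ^ 2 / lambda = 0).
    { pose proof (pf_radius _ _ _ _ _ HB x 0) as D. rewrite (pf_zero _ _ _ _ _ HB) in D.
      apply is_derive_unique in D. rewrite <- D.
      apply is_derive_unique, (is_derive_ext_R (fun _ => rho2 x)); [| apply is_derive_const_R].
      intros y. now rewrite (pf_fixed _ _ _ _ _ HB). }
    assert (Z' : lambda + radial Q x * rho2 x = 0).
    { apply Rmult_eq_reg_r with (rho2 x / lambda); [| apply Rgt_not_eq, Rdiv_lt_0_compat; lra].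
      rewrite Rmult_0_l, <- Z. field. lra. }
    rewrite Z'. f_equal; ring.
Qed.

(** * From a conjugacy of the invariant circles to an equivalence *)

(** The odd extension of the power function, since [r ^ 2 / rho - 1] is negative inside the
    invariant circle and positive outside. It fixes [-1], the value of this quantity at the
    origin. *)
Definition signed_power (p z : R) : R :=
  if Rlt_dec 0 z then exp (p * ln z)
  else if Rlt_dec z 0 then - exp (p * ln (- z)) else 0.

Lemma signed_power_pos (p z : R) : 0 < z -> signed_power p z = exp (p * ln z).
Proof. intros H. unfold signed_power. destruct (Rlt_dec 0 z); [reflexivity | lra]. Qed.

Lemma signed_power_neg (p z : R) : z < 0 -> signed_power p z = - exp (p * ln (- z)).
Proof.
  intros H. unfold signed_power. destruct (Rlt_dec 0 z); [lra |].
  destruct (Rlt_dec z 0); [reflexivity | lra].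
Qed.

Lemma signed_power_0 (p : R) : signed_power p 0 = 0.
Proof.
  unfold signed_power. destruct (Rlt_dec 0 0); [lra |]. destruct (Rlt_dec 0 0); [lra | reflexivity].
Qed.

Lemma signed_power_m1 (p : R) : signed_power p (-1) = -1.
Proof.
  rewrite signed_power_neg by lra. replace (- -1) with 1 by ring. rewrite ln_1, Rmult_0_r, exp_0. ring.
Qed.

Lemma signed_power_opp (p z : R) : signed_power p (- z) = - signed_power p z.
Proof.
  destruct (Rtotal_order z 0) as [H | [-> | H]].
  - rewrite signed_power_pos, signed_power_neg by lra. ring.
  - rewrite Ropp_0, signed_power_0. ring.
  - rewrite signed_power_neg, signed_power_pos, Ropp_involutive by lra. reflexivity.
Qed.

Lemma signed_power_div (p z x : R) : 0 < x ->
  signed_power p (z / x) = signed_power p z / exp (p * ln x).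
Proof.
  intros Hx.
  assert (P : forall z, 0 < z -> signed_power p (z / x) = signed_power p z / exp (p * ln x)).
  { intros y Hy. assert (0 < y / x) by now apply Rdiv_lt_0_compat.
    rewrite !signed_power_pos, ln_div by assumption.
    unfold Rdiv. rewrite <- exp_Ropp, <- exp_plus. f_equal. ring. }
  destruct (Rtotal_order z 0) as [H | [-> | H]]; auto.
  - replace (z / x) with (- (- z / x)) by (field; lra).
    rewrite signed_power_opp, P, signed_power_opp by lra. field. apply Rgt_not_eq, exp_pos.
  - unfold Rdiv. rewrite Rmult_0_l, signed_power_0. ring.
Qed.

Lemma signed_power_inv (p z : R) : p <> 0 -> signed_power (/ p) (signed_power p z) = z.
Proof.
  intros Hp.
  assert (P : forall z, 0 < z -> signed_power (/ p) (signed_power p z) = z).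
  { intros y Hy. rewrite (signed_power_pos p) by assumption. rewrite signed_power_pos by apply exp_pos.
    rewrite ln_exp, <- Rmult_assoc, Rinv_l, Rmult_1_l by assumption. now apply exp_ln. }
  destruct (Rtotal_order z 0) as [H | [-> | H]]; auto.
  - rewrite <- (Ropp_involutive z). rewrite (signed_power_opp p), signed_power_opp, P; lra.
  - now rewrite !signed_power_0.
Qed.

Lemma signed_power_increasing (p x y : R) : 0 < p -> x < y -> signed_power p x < signed_power p y.
Proof.
  intros Hp Hxy.
  assert (P : forall x y, 0 < x -> x < y -> signed_power p x < signed_power p y).
  { intros a b Ha Hab. rewrite !signed_power_pos by lra. apply exp_increasing.
    apply Rmult_lt_compat_l; auto. now apply ln_increasing. }
  assert (Q : forall x, 0 < x -> 0 < signed_power p x).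
  { intros a Ha. rewrite signed_power_pos by auto. apply exp_pos. }
  assert (N : forall x, x < 0 -> signed_power p x < 0).
  { intros a Ha. rewrite signed_power_neg by auto. pose proof (exp_pos (p * ln (- a))). lra. }
  destruct (Rlt_le_dec 0 x) as [Hx | Hx]; [now apply P |].
  destruct (Rlt_le_dec y 0) as [Hy | Hy].
  - rewrite <- (Ropp_involutive x), <- (Ropp_involutive y), (signed_power_opp p (- x)), (signed_power_opp p (- y)).
    apply Ropp_lt_contravar, P; lra.
  - destruct (Req_dec x 0) as [-> | Hx'].
    + rewrite signed_power_0. apply Q. lra.
    + assert (signed_power p x < 0) by (apply N; lra).
      destruct Hy as [Hy | <-]; [specialize (Q y Hy); lra | rewrite signed_power_0; lra].
Qed.

Lemma signed_power_continuous (p x : R) : 0 < p -> continuous (signed_power p) x.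
Proof.
  intros Hp. apply increasing_surjective_continuous.
  - intros y z. now apply signed_power_increasing.
  - intros y. exists (signed_power (/ p) y).
    rewrite <- (Rinv_inv p) at 1. apply signed_power_inv. apply Rinv_neq_0_compat. lra.
Qed.

Lemma signed_power_ge (p z : R) : 0 < p -> -1 <= z -> -1 <= signed_power p z.
Proof.
  intros Hp [H | <-]; [| rewrite signed_power_m1; lra].
  left. rewrite <- (signed_power_m1 p). now apply signed_power_increasing.
Qed.

Lemma signed_power_gt (p z : R) : 0 < p -> -1 < z -> -1 < signed_power p z.
Proof. intros Hp H. rewrite <- (signed_power_m1 p). now apply signed_power_increasing. Qed.

Definition map_radius (p : R) (rho rho' eta : R -> R) (r x : R) : R :=
  sqrt (rho' (eta x) * (1 + signed_power p (r * r / rho x - 1))).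

(** If [r ^ 2 = rho * (1 + z)], then [z] decays along solutions as [exp (- y)], with [y]
    the time of [polar_flow]; the power [p] compensates a change of time [y -> p * y]
    on the circle. *)
Definition plane_map (p : R) (rho rho' eta : R -> R) (X : plane) : plane :=
  let r := proj1_sig (constructive_indefinite_description _ (polar_coordinates X)) in
  let x := proj1_sig (constructive_indefinite_description _
    (proj2_sig (constructive_indefinite_description _ (polar_coordinates X)))) in
  polar (map_radius p rho rho' eta r x) (eta x).

Lemma map_radius_0 (p : R) (rho rho' eta : R -> R) (x : R) : map_radius p rho rho' eta 0 x = 0.
Proof.
  unfold map_radius. unfold Rdiv. rewrite !Rmult_0_l. unfold Rminus. rewrite Rplus_0_l, signed_power_m1.
  replace (rho' (eta x) * (1 + -1)) with 0 by ring. apply sqrt_0.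
Qed.

Lemma polar_0 (x : R) : polar 0 x = (0, 0).
Proof. unfold polar. f_equal; ring. Qed.

Lemma signed_shift (u : R -> R) (s : R) :
  s = 1 \/ s = -1 -> (forall x, u (x + 2 * PI) = u x + s * (2 * PI)) ->
  forall r n x, polar r (u (x + IZR n * (2 * PI))) = polar r (u x).
Proof.
  intros Hs Hu r n x. rewrite (equivariant_multiple u (2 * PI) _ Hu).
  destruct Hs as [-> | ->].
  - rewrite Rmult_1_l. apply (periodic_multiple (polar r)), polar_shift.
  - replace (u x + IZR n * (-1 * (2 * PI))) with (u x + IZR (- n) * (2 * PI)) by (rewrite opp_IZR; ring).
    apply (periodic_multiple (polar r)), polar_shift.
Qed.

(** The angle picked by choice is determined only modulo [2 * PI]. It does not matter, because [eta]
    shifts by [s * (2 * PI)], and at the origin because [map_radius] vanishes there. *)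
Lemma plane_map_polar (p : R) (rho rho' eta : R -> R) (s r x : R) :
  (forall x, rho (x + 2 * PI) = rho x) -> (forall x, rho' (x + 2 * PI) = rho' x) ->
  s = 1 \/ s = -1 -> (forall x, eta (x + 2 * PI) = eta x + s * (2 * PI)) -> 0 <= r ->
  plane_map p rho rho' eta (polar r x) = polar (map_radius p rho rho' eta r x) (eta x).
Proof.
  intros Hr Hr' Hs He H. unfold plane_map.
  destruct (constructive_indefinite_description _ (polar_coordinates (polar r x))) as [r0 Er]. simpl.
  destruct (constructive_indefinite_description _ Er) as [x0 Ex]. simpl. pose proof Ex as [H0 [_ E]]. clear Ex.
  assert (r = r0) by now apply (polar_radius_unique r r0 x x0). subst r0.
  destruct H as [H | <-].
  - apply polar_angle in E; auto. destruct E as [n ->].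
    rewrite (signed_shift eta s Hs He). f_equal. unfold map_radius.
    rewrite (periodic_multiple rho) by auto. f_equal. f_equal.
    rewrite (equivariant_multiple eta _ _ He).
    destruct Hs as [-> | ->].
    + rewrite Rmult_1_l. now apply periodic_multiple.
    + replace (eta x + IZR n * (-1 * (2 * PI))) with (eta x + IZR (- n) * (2 * PI)) by (rewrite opp_IZR; ring).
      now apply periodic_multiple.
  - now rewrite !map_radius_0, !polar_0.
Qed.

Lemma map_radius_inverse (p : R) (rho rho' eta eta' : R -> R) (r x : R) :
  0 < p -> (forall x, 0 < rho x) -> (forall x, 0 < rho' x) -> eta' (eta x) = x -> 0 <= r ->
  map_radius (/ p) rho' rho eta' (map_radius p rho rho' eta r x) (eta x) = r.
Proof.
  intros Hp Hr Hr' He H. unfold map_radius at 1. rewrite He.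
  pose proof (Hr x). pose proof (Hr' (eta x)).
  assert (K : -1 <= r * r / rho x - 1).
  { assert (0 <= r * r / rho x) by (apply Rdiv_le_0_compat; nra). lra. }
  apply (signed_power_ge p) in K; auto.
  unfold map_radius. rewrite sqrt_sqrt by (apply Rmult_le_pos; lra).
  replace (rho' (eta x) * (1 + signed_power p (r * r / rho x - 1)) / rho' (eta x) - 1)
    with (signed_power p (r * r / rho x - 1)) by (field; lra).
  rewrite signed_power_inv by lra.
  replace (rho x * (1 + (r * r / rho x - 1))) with (r * r) by (field; lra). now apply sqrt_square.
Qed.

Lemma continuous_map_radius {U : UniformSpace} (p : R) (rho rho' eta : R -> R) (r x : U -> R) (q : U) :
  0 < p -> (forall x, 0 < rho x) -> (forall x, continuous rho x) -> (forall x, continuous rho' x) ->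
  (forall x, continuous eta x) -> continuous r q -> continuous x q ->
  continuous (fun y => map_radius p rho rho' eta (r y) (x y)) q.
Proof.
  intros Hp Hr Cr Cr' Ce Hrq Hxq. unfold map_radius.
  apply (continuous_comp_real (fun y => rho' (eta (x y)) * (1 + signed_power p (r y * r y / rho (x y) - 1))) sqrt);
    [| apply continuous_sqrt].
  apply continuous_mult_R.
  - apply (continuous_comp_real (fun y => eta (x y)) rho'); auto. apply (continuous_comp_real x eta); auto.
  - apply continuous_plus_R; [apply continuous_const_R |].
    apply (continuous_comp_real (fun y => r y * r y / rho (x y) - 1)); [| now apply signed_power_continuous].
    apply continuous_minus_R; [| apply continuous_const_R].
    apply continuous_div_R.
    + now apply continuous_mult_R.
    + now apply (continuous_comp_real x rho).
    + specialize (Hr (x q)). lra.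
Qed.

Lemma continuous_fst_R (X : plane) : continuous (fun Y : plane => fst Y) X.
Proof. destruct X. apply continuous_fst. Qed.

Lemma continuous_snd_R (X : plane) : continuous (fun Y : plane => snd Y) X.
Proof. destruct X. apply continuous_snd. Qed.

(** A continuous branch of the angle on the half-plane around the direction [x0], where the chosen
    polar coordinates may jump. *)
Lemma local_angle (x0 : R) (X : plane) :
  let c := fst X * cos x0 + snd X * sin x0 in
  let s := snd X * cos x0 - fst X * sin x0 in
  0 < c -> X = polar (sqrt (fst X * fst X + snd X * snd X)) (x0 + atan (s / c)).
Proof.
  intros c s Hc. destruct X as [x y]. simpl in *.
  pose proof (cos2_sin2 x0) as E.
  assert (En : x * x + y * y = c * c + s * s).
  { unfold c, s. transitivity ((x * x + y * y) * (cos x0 * cos x0 + sin x0 * sin x0)); [rewrite E; ring | ring]. }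
  assert (Er : sqrt (x * x + y * y) = c * sqrt (1 + (s / c)²)).
  { rewrite En. replace (c * c + s * s) with (c * c * (1 + (s / c)²)) by (unfold Rsqr; field; lra).
    rewrite sqrt_mult, sqrt_square by (try nra; pose proof (Rle_0_sqr (s / c)); lra). reflexivity. }
  assert (P : 0 < sqrt (1 + (s / c)²)) by (apply sqrt_lt_R0; pose proof (Rle_0_sqr (s / c)); lra).
  unfold polar. rewrite Er, cos_plus, sin_plus, cos_atan, sin_atan.
  f_equal.
  - transitivity (cos x0 * c - sin x0 * s); [| field; lra].
    unfold c, s. transitivity (x * (cos x0 * cos x0 + sin x0 * sin x0)); [rewrite E; ring | ring].
  - transitivity (sin x0 * c + cos x0 * s); [| field; lra].
    unfold c, s. transitivity (y * (cos x0 * cos x0 + sin x0 * sin x0)); [rewrite E; ring | ring].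
Qed.

Lemma continuous_norm (X : plane) : continuous (fun Y : plane => sqrt (fst Y * fst Y + snd Y * snd Y)) X.
Proof.
  apply (continuous_comp_real (fun Y : plane => fst Y * fst Y + snd Y * snd Y) sqrt); [| apply continuous_sqrt].
  apply continuous_plus_R; apply continuous_mult_R; apply continuous_fst_R || apply continuous_snd_R.
Qed.

(** Away from the origin, replace the chosen angle by a continuous branch. At the origin, bound the
    image by a function of the norm alone, with [c1] in place of [rho] and [c2] in place of
    [rho']. *)
Lemma plane_map_continuous (p : R) (rho rho' eta : R -> R) (s c1 c2 : R) (X : plane) :
  0 < p -> 0 < c1 -> (forall x, c1 <= rho x) -> (forall x, 0 < rho' x <= c2) ->
  (forall x, continuous rho x) -> (forall x, continuous rho' x) -> (forall x, continuous eta x) ->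
  (forall x, rho (x + 2 * PI) = rho x) -> (forall x, rho' (x + 2 * PI) = rho' x) ->
  s = 1 \/ s = -1 -> (forall x, eta (x + 2 * PI) = eta x + s * (2 * PI)) ->
  continuous (plane_map p rho rho' eta) X.
Proof.
  intros Hp Hc1 Hr Hr' Cr Cr' Ce Pr Pr' Hs He.
  assert (Hrp : forall x, 0 < rho x) by (intros x; specialize (Hr x); lra).
  destruct (polar_coordinates X) as [r0 [x0 [Hr0 [_ EX]]]].
  destruct Hr0 as [Hr0 | <-].
  - pose (cc := fun Y : plane => fst Y * cos x0 + snd Y * sin x0).
    pose (ss := fun Y : plane => snd Y * cos x0 - fst Y * sin x0).
    assert (Ccc : forall Y, continuous cc Y).
    { intros Y. apply continuous_plus_R; apply continuous_mult_R;
        first [apply continuous_fst_R | apply continuous_snd_R | apply continuous_const_R]. }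
    assert (Css : forall Y, continuous ss Y).
    { intros Y. apply continuous_minus_R; apply continuous_mult_R;
        first [apply continuous_fst_R | apply continuous_snd_R | apply continuous_const_R]. }
    assert (Hpos : 0 < cc X).
    { unfold cc. rewrite EX. unfold polar; simpl. pose proof (cos2_sin2 x0).
      replace (r0 * cos x0 * cos x0 + r0 * sin x0 * sin x0) with (r0 * (cos x0 * cos x0 + sin x0 * sin x0)) by ring.
      rewrite H. lra. }
    pose (rr := fun Y : plane => sqrt (fst Y * fst Y + snd Y * snd Y)).
    pose (xx := fun Y : plane => x0 + atan (ss Y / cc Y)).
    assert (Cxx : continuous xx X).
    { apply continuous_plus_R; [apply continuous_const_R |].
      apply (continuous_comp_real (fun Y => ss Y / cc Y) atan).
      - apply continuous_div_R; auto. lra.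
      - apply continuity_pt_filterlim. apply derivable_continuous_pt, derivable_pt_atan. }
    apply (continuous_ext_loc (plane_map p rho rho' eta)
      (fun Y => polar (map_radius p rho rho' eta (rr Y) (xx Y)) (eta (xx Y)))).
    + assert (L : locally X (fun Y => 0 < cc Y)).
      { apply (Ccc X (fun z => 0 < z)). now apply open_gt. }
      revert L. apply filter_imp. intros Y HY.
      transitivity (plane_map p rho rho' eta (polar (rr Y) (xx Y))).
      * symmetry. apply (plane_map_polar p rho rho' eta s); auto. apply sqrt_pos.
      * f_equal. symmetry. exact (local_angle x0 Y HY).
    + apply continuous_polar.
      * apply continuous_map_radius; auto. apply continuous_norm.
      * apply (continuous_comp_real xx eta); auto.
  - rewrite polar_0 in EX. subst X.
    pose (m := fun Y : plane => sqrt (c2 * (1 + signed_power p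
      (sqrt (fst Y * fst Y + snd Y * snd Y) * sqrt (fst Y * fst Y + snd Y * snd Y) / c1 - 1)))).
    assert (Cm : continuous m (0, 0)).
    { apply (continuous_comp_real (fun Y : plane => c2 * (1 + signed_power p
      (sqrt (fst Y * fst Y + snd Y * snd Y) * sqrt (fst Y * fst Y + snd Y * snd Y) / c1 - 1))) sqrt); [| apply continuous_sqrt].
      apply continuous_mult_R; [apply continuous_const_R |].
      apply continuous_plus_R; [apply continuous_const_R |].
      apply (continuous_comp_real (fun Y : plane =>
        sqrt (fst Y * fst Y + snd Y * snd Y) * sqrt (fst Y * fst Y + snd Y * snd Y) / c1 - 1));
        [| now apply signed_power_continuous].
      apply continuous_minus_R; [| apply continuous_const_R].
      apply continuous_div_R; [| apply continuous_const_R | lra].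
      apply continuous_mult_R; apply continuous_norm. }
    assert (Em : m (0, 0) = 0).
    { unfold m; simpl. rewrite Rmult_0_l, Rplus_0_l, sqrt_0. unfold Rdiv. rewrite !Rmult_0_l.
      unfold Rminus. rewrite Rplus_0_l, signed_power_m1. replace (c2 * (1 + -1)) with 0 by ring. apply sqrt_0. }
    assert (Hb : forall Y, Rabs (fst (plane_map p rho rho' eta Y)) <= m Y /\ Rabs (snd (plane_map p rho rho' eta Y)) <= m Y).
    { intros Y. destruct (polar_coordinates Y) as [r [x [Hr1 [_ EY]]]]. rewrite EY.
      rewrite (plane_map_polar p rho rho' eta s) by auto.
      assert (B : map_radius p rho rho' eta r x <= m (polar r x)).
      { unfold map_radius, m. apply sqrt_le_1_alt.
        replace (fst (polar r x) * fst (polar r x) + snd (polar r x) * snd (polar r x)) with (r * r)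
          by (pose proof (polar_norm r x); lra).
        rewrite sqrt_square by auto. specialize (Hr x). specialize (Hr' (eta x)).
        assert (K : r * r / rho x <= r * r / c1) by (apply Rmult_le_compat_l; [nra | apply Rinv_le_contravar; lra]).
        assert (K0 : 0 <= r * r / rho x) by (apply Rdiv_le_0_compat; nra).
        assert (K1 : signed_power p (r * r / rho x - 1) <= signed_power p (r * r / c1 - 1)).
        { destruct K as [K | ->]; [left; apply signed_power_increasing; lra | right; reflexivity]. }
        pose proof (signed_power_ge p (r * r / rho x - 1) Hp ltac:(lra)).
        apply Rmult_le_compat; lra. }
      assert (P : 0 <= map_radius p rho rho' eta r x) by apply sqrt_pos.
      unfold polar at 1 3; simpl. rewrite !Rabs_mult, (Rabs_pos_eq (map_radius p rho rho' eta r x)) by auto.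
      pose proof (COS_bound (eta x)). pose proof (SIN_bound (eta x)).
      assert (Rabs (cos (eta x)) <= 1) by (apply Rabs_le; lra).
      assert (Rabs (sin (eta x)) <= 1) by (apply Rabs_le; lra).
      split; eapply Rle_trans; try exact B; rewrite <- (Rmult_1_r (map_radius p rho rho' eta r x)) at 2;
        apply Rmult_le_compat_l; auto. }
    apply (continuous_ext (fun Y => (fst (plane_map p rho rho' eta Y), snd (plane_map p rho rho' eta Y)))).
    { intros Y. now destruct (plane_map p rho rho' eta Y). }
    apply continuous_pair.
    + apply (continuous_squeeze_zero _ m); auto. intros Y. apply Hb.
    + apply (continuous_squeeze_zero _ m); auto. intros Y. apply Hb.
Qed.

(** The homeomorphism of the circle is lifted to the line of angles; [s = -1] means that it reverses
    the orientation. *)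
Record circle_conjugacy (B B' : R -> R -> R) (p : R) (eta eta' : R -> R) : Prop := {
  cc_pos : 0 < p;
  cc_left : forall x, eta' (eta x) = x;
  cc_right : forall x, eta (eta' x) = x;
  cc_cont : forall x, continuous eta x;
  cc_cont' : forall x, continuous eta' x;
  cc_shift : exists s, (s = 1 \/ s = -1) /\ forall x, eta (x + 2 * PI) = eta x + s * (2 * PI);
  cc_flow : forall x y, eta (B x y) = B' (eta x) (p * y)
}.

Lemma inverse_shift (eta eta' : R -> R) (s : R) :
  (s = 1 \/ s = -1) -> (forall x, eta' (eta x) = x) -> (forall x, eta (eta' x) = x) ->
  (forall x, eta (x + 2 * PI) = eta x + s * (2 * PI)) ->
  forall x, eta' (x + 2 * PI) = eta' x + s * (2 * PI).
Proof.
  intros Hs H1 H2 H x. rewrite <- (H1 (eta' x + s * (2 * PI))). f_equal.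
  destruct Hs as [-> | ->].
  - rewrite Rmult_1_l, H, H2. ring.
  - pose proof (H (eta' x + -1 * (2 * PI))) as E.
    replace (eta' x + -1 * (2 * PI) + 2 * PI) with (eta' x) in E by ring. rewrite H2 in E. lra.
Qed.

(** The time at which the clock for [w'] equals the clock for [w] at [t], raised to the power [p]:
    the times on the two circles are the logarithms of the clocks and must be in the ratio [p]. *)
Definition retime (lambda p w w' t0 t : R) : R :=
  t0 + ln ((exp (p * ln (clock lambda w t0 t)) - 1 + w') / w') / (2 * lambda).

(** The clock always exceeds [1 - w]; apply the increasing odd function [signed_power p]. *)
Lemma retime_pos (lambda p w t0 t : R) :
  0 < p -> 0 < w -> 0 < clock lambda w t0 t ->
  0 < exp (p * ln (clock lambda w t0 t)) - 1 + (1 + signed_power p (w - 1)).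
Proof.
  intros Hp Hw Hc. rewrite <- signed_power_pos by assumption.
  assert (K : 1 - w < clock lambda w t0 t).
  { unfold clock. pose proof (exp_pos (2 * lambda * (t - t0))). nra. }
  apply (signed_power_increasing p) in K; auto.
  replace (1 - w) with (- (w - 1)) in K by ring. rewrite signed_power_opp in K. lra.
Qed.

Lemma clock_retime (lambda p w w' t0 t : R) :
  0 < lambda -> 0 < w' -> 0 < exp (p * ln (clock lambda w t0 t)) - 1 + w' ->
  clock lambda w' t0 (retime lambda p w w' t0 t) = exp (p * ln (clock lambda w t0 t)).
Proof.
  intros Hl Hw H. unfold clock at 1, retime.
  match goal with |- context [exp ?a] => replace (exp a) with
    ((exp (p * ln (clock lambda w t0 t)) - 1 + w') / w') end.
  - field. lra.
  - assert (P : 0 < (exp (p * ln (clock lambda w t0 t)) - 1 + w') / w') by now apply Rdiv_lt_0_compat.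
    rewrite <- (exp_ln _ P) at 1. f_equal. field. lra.
Qed.

Lemma clock_injective (lambda w t0 t u : R) :
  0 < lambda -> 0 < w -> clock lambda w t0 t = clock lambda w t0 u -> t = u.
Proof.
  intros Hl Hw E. unfold clock in E.
  assert (E' : exp (2 * lambda * (t - t0)) = exp (2 * lambda * (u - t0))).
  { apply Rmult_eq_reg_l with w; lra. }
  apply exp_inv in E'. apply Rmult_eq_reg_l in E'; lra.
Qed.

Lemma clock_lt (lambda w t0 t u : R) :
  0 < lambda -> 0 < w -> (t < u <-> clock lambda w t0 t < clock lambda w t0 u).
Proof.
  intros Hl Hw.
  assert (P : forall t u, t < u -> clock lambda w t0 t < clock lambda w t0 u).
  { intros a b H. unfold clock. apply Rplus_lt_compat_l, Rmult_lt_compat_l; auto.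
    apply Rplus_lt_compat_r, exp_increasing, Rmult_lt_compat_l; lra. }
  split; auto. intros H. destruct (Rtotal_order t u) as [|[-> | K]]; auto; [lra |].
  apply P in K. lra.
Qed.

Lemma equivalent_of_conjugacy (lambda : R) (Q Q' : plane -> plane) (rho rho' : R -> R)
    (B B' : R -> R -> R) (p : R) (eta eta' : R -> R) :
  0 < lambda -> homogeneous_cubic Q -> homogeneous_cubic Q' ->
  polar_flow lambda (radial Q) (angular Q) rho B ->
  polar_flow lambda (radial Q') (angular Q') rho' B' ->
  circle_conjugacy B B' p eta eta' -> equivalent (system lambda Q) (system lambda Q').
Proof.
  intros Hl HQ HQ' HB HB' [Hp H1 H2 C1 C2 [s [Hs Hsh]] Hflow].
  pose proof (inverse_shift eta eta' s Hs H1 H2 Hsh) as Hsh'.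
  assert (Hip : 0 < / p) by now apply Rinv_0_lt_compat.
  assert (Pr : forall x, rho (x + 2 * PI) = rho x) by (intros; eapply pf_period2, HB).
  assert (Pr' : forall x, rho' (x + 2 * PI) = rho' x) by (intros; eapply pf_period2, HB').
  assert (Hr : forall x, 0 < rho x) by (intros; eapply rho2_pos, HB).
  assert (Hr' : forall x, 0 < rho' x) by (intros; eapply rho2_pos, HB').
  destruct (pf_bounds _ _ _ _ _ HB) as [c1 [c2 [Hc1 Hc2]]].
  destruct (pf_bounds _ _ _ _ _ HB') as [d1 [d2 [Hd1 Hd2]]].
  exists (plane_map p rho rho' eta). split.
  - exists (plane_map (/ p) rho' rho eta'). repeat split.
    + intros X. destruct (polar_coordinates X) as [r [x [Hr0 [_ ->]]]].
      rewrite (plane_map_polar p rho rho' eta s) by auto.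
      rewrite (plane_map_polar (/ p) rho' rho eta' s); auto; [| apply sqrt_pos].
      rewrite (map_radius_inverse p rho rho' eta eta'), H1 by auto. reflexivity.
    + intros X. destruct (polar_coordinates X) as [r [x [Hr0 [_ ->]]]].
      rewrite (plane_map_polar (/ p) rho' rho eta' s) by auto.
      rewrite (plane_map_polar p rho rho' eta s); auto; [| apply sqrt_pos].
      rewrite <- (Rinv_inv p) at 1.
      rewrite (map_radius_inverse (/ p) rho' rho eta' eta), H2 by auto. reflexivity.
    + intros X. apply (plane_map_continuous p rho rho' eta s c1 d2); auto.
      * intros x. apply Hc2.
      * intros x. split; [auto | apply Hd2].
      * intros x. apply (pf_cont _ _ _ _ _ HB).
      * intros x. apply (pf_cont _ _ _ _ _ HB').
    + intros X. apply (plane_map_continuous (/ p) rho' rho eta' s d1 c2); auto.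
      * intros x. apply Hd2.
      * intros x. split; [auto | apply Hc2].
      * intros x. apply (pf_cont _ _ _ _ _ HB').
      * intros x. apply (pf_cont _ _ _ _ _ HB).
  - intros a b phi Hphi.
    destruct (maximal_solution_canonical lambda Q rho B a b phi Hl HQ HB Hphi)
      as [[-> [-> Hz]] | [x [w [t0 [Hw [-> [-> Hcan]]]]]]].
    + exists m_infty, p_infty, (fun _ => (0, 0)), (fun t => t). split; [now apply zero_maximal |].
      split.
      * repeat split; auto. intros v Hv. now exists v.
      * intros t _. rewrite Hz, <- (polar_0 0), (plane_map_polar p rho rho' eta s) by (auto; lra).
        now rewrite map_radius_0, !polar_0.
    (* The ratio of the image point: [w - 1] is the quantity that [plane_map] raises to the power
       [p]. *)
    + pose (w' := 1 + signed_power p (w - 1)).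
      assert (Hw' : 0 < w').
      { unfold w'. pose proof (signed_power_gt p (w - 1) Hp ltac:(lra)). lra. }
      (* With [p] and [/ p] exchanged, [w] and [w'] play symmetric parts; hence the inverse change
         of time is again a [retime]. *)
      assert (Ew : w = 1 + signed_power (/ p) (w' - 1)).
      { unfold w'. replace (1 + signed_power p (w - 1) - 1) with (signed_power p (w - 1)) by ring.
        rewrite signed_power_inv by lra. ring. }
      assert (Hck : forall t, 0 < clock lambda w t0 t ->
        clock lambda w' t0 (retime lambda p w w' t0 t) = exp (p * ln (clock lambda w t0 t))).
      { intros t Ht. apply clock_retime; auto. now apply retime_pos. }
      assert (Hck' : forall t, 0 < clock lambda w' t0 t ->
        clock lambda w t0 (retime lambda (/ p) w' w t0 t) = exp (/ p * ln (clock lambda w' t0 t))).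
      { intros t Ht. apply clock_retime; auto. rewrite Ew. now apply retime_pos. }
      exists (start lambda w' t0), p_infty, (canonical lambda rho' B' (eta x) w' t0), (retime lambda p w w' t0).
      split; [now apply canonical_maximal |]. split; [split; [| split] |].
      * intros t Ht. apply in_start in Ht; auto. apply in_start; auto. rewrite Hck by auto. apply exp_pos.
      * intros t u Ht Hu Htu. apply in_start in Ht; auto. apply in_start in Hu; auto.
        apply (clock_lt lambda w' t0); auto. rewrite !Hck by auto.
        apply exp_increasing, Rmult_lt_compat_l; auto. apply ln_increasing; auto. now apply clock_lt.
      * intros v Hv. apply in_start in Hv; auto. exists (retime lambda (/ p) w' w t0 v). split.
        -- apply in_start; auto. rewrite Hck' by auto. apply exp_pos.
        -- apply (clock_injective lambda w' t0); auto. rewrite Hck by (rewrite Hck' by auto; apply exp_pos).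
           rewrite Hck', ln_exp, <- Rmult_assoc, Rinv_r, Rmult_1_l by (auto; lra). now apply exp_ln.
      * intros t Ht. rewrite (Hcan t Ht). apply in_start in Ht; auto.
        assert (Ea : angle_at lambda B' (eta x) w' t0 (retime lambda p w w' t0 t) = eta (angle_at lambda B x w t0 t)).
        { unfold angle_at. rewrite Hck, ln_exp by auto. symmetry. apply Hflow. }
        unfold canonical. rewrite Ea.
        set (y := angle_at lambda B x w t0 t).
        rewrite (plane_map_polar p rho rho' eta s) by (auto; apply sqrt_pos).
        f_equal. unfold map_radius. f_equal. f_equal.
        pose proof (exp_pos (2 * lambda * (t - t0))).
        specialize (Hr y).
        rewrite sqrt_sqrt by (apply Rmult_le_pos; [lra |]; apply Rdiv_le_0_compat; [apply Rmult_le_pos; lra | lra]).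
        (* Since [w * exp (2 * lambda * (t - t0))] is [clock + (w - 1)], the relative excess of the
           squared radius is [(w - 1) / clock]; the power of this quotient is [(w' - 1)] over the
           new clock. *)
        replace (rho y * (w * exp (2 * lambda * (t - t0)) / clock lambda w t0 t) / rho y - 1)
          with ((w - 1) / clock lambda w t0 t).
        -- rewrite signed_power_div by auto. rewrite <- Hck by auto.
           assert (0 < clock lambda w' t0 (retime lambda p w w' t0 t)) by (rewrite Hck by auto; apply exp_pos).
           replace (w' * exp (2 * lambda * (retime lambda p w w' t0 t - t0)))
             with (clock lambda w' t0 (retime lambda p w w' t0 t) + (w' - 1)) by (unfold clock; ring).
           replace (signed_power p (w - 1)) with (w' - 1) by (unfold w'; ring). field. lra.
        -- replace (w * exp (2 * lambda * (t - t0))) with (clock lambda w t0 t + (w - 1)) by (unfold clock; ring).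
           field. lra.
Qed.

(** * Conjugacies of the invariant circles *)

(** Otherwise [u] would remain in [[u 0, q)] for ever, where [G] has a positive minimum, and would
    move at least at this speed. *)
Lemma reach_up (u G : R -> R) (q : R) :
  (forall y, is_derive u y (G (u y))) -> (forall y, 0 < G (u y)) -> (forall x, continuous G x) ->
  u 0 <= q -> (forall x, u 0 <= x <= q -> 0 < G x) -> exists y, u y = q.
Proof.
  intros Hd Hp HG Hq Hpos. apply NNPP. intros HN.
  assert (Cu : forall y, continuous u y) by (intros; eapply is_derive_continuous, Hd).
  assert (Hlt : forall y, 0 <= y -> u 0 <= u y < q).
  { intros y Hy. split.
    - apply (nondecreasing_derive u (fun y => G (u y))); auto. intros x _. left; apply Hp.
    - apply Rnot_le_lt. intros C. destruct (intermediate_value u 0 y q) as [z [_ Hz]]; auto.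
      apply HN. now exists z. }
  destruct (continuity_ab_min G (u 0) q) as [m [Hm Im]]; auto.
  { intros c _. apply continuity_pt_filterlim, HG. }
  assert (Pm : 0 < G m) by (apply Hpos; lra).
  pose (T := (q - u 0) / G m).
  assert (HT : 0 <= T) by (apply Rdiv_le_0_compat; lra).
  assert (K : u 0 - G m * 0 <= u T - G m * T).
  { apply (nondecreasing_derive (fun y => u y - G m * y) (fun y => G (u y) - G m)); auto.
    - intros y _. apply is_derive_minus_R; auto. eapply is_derive_eq.
      + apply is_derive_mult_R; [apply is_derive_const_R | apply is_derive_id_R].
      + simpl. ring.
    - intros y Hy. destruct (Hlt y ltac:(lra)). specialize (Hm (u y)). lra. }
  assert (E : G m * T = q - u 0) by (unfold T; field; lra).
  specialize (Hlt T HT). lra.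
Qed.

Lemma reach_increasing (u G : R -> R) (q : R) :
  (forall y, is_derive u y (G (u y))) -> (forall y, 0 < G (u y)) -> (forall x, continuous G x) ->
  (forall x, Rmin (u 0) q <= x <= Rmax (u 0) q -> 0 < G x) -> exists y, u y = q.
Proof.
  intros Hd Hp HG Hpos. destruct (Rle_dec (u 0) q) as [Hq | Hq].
  - rewrite Rmin_left, Rmax_right in Hpos by lra. now apply (reach_up u G).
  - rewrite Rmin_right, Rmax_left in Hpos by lra.
    destruct (reach_up (fun y => - u (- y)) (fun x => G (- x)) (- q)) as [y Hy].
    + intros y. rewrite Ropp_involutive. eapply is_derive_eq.
      * apply is_derive_opp_R, is_derive_reflect, Hd.
      * ring.
    + intros y. rewrite Ropp_involutive. apply Hp.
    + intros x. apply (continuous_comp_real Ropp G); [| apply HG]. apply (continuous_opp (fun y : R => y)), continuous_id.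
    + rewrite Ropp_0. lra.
    + rewrite Ropp_0. intros x Hx. apply Hpos. lra.
    + exists (- y). lra.
Qed.

Lemma reach (u G : R -> R) (s : pm) (q : R) :
  (forall y, is_derive u y (G (u y))) -> (forall y, 0 < sign_val s * G (u y)) -> (forall x, continuous G x) ->
  (forall x, Rmin (u 0) q <= x <= Rmax (u 0) q -> 0 < sign_val s * G x) -> exists y, u y = q.
Proof.
  intros Hd Hp HG Hpos. destruct s; simpl sign_val in *.
  - apply (reach_increasing u G); auto.
    + intros y. specialize (Hp y). lra.
    + intros x Hx. specialize (Hpos x Hx). lra.
  - destruct (reach_increasing (fun y => u (- y)) (fun x => - G x) q) as [y Hy].
    + intros y. apply is_derive_reflect, Hd.
    + intros y. specialize (Hp (- y)). lra.
    + intros x. apply (continuous_opp G), HG.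
    + rewrite Ropp_0. intros x Hx. specialize (Hpos x Hx). lra.
    + now exists (- y).
Qed.

Lemma pf_back (lambda : R) (f g rho2 : R -> R) (B : R -> R -> R) (x y : R) :
  polar_flow lambda f g rho2 B -> B (B x y) (- y) = x.
Proof.
  intros HB. now rewrite <- (pf_add _ _ _ _ _ HB), Rplus_opp_r, (pf_zero _ _ _ _ _ HB).
Qed.

Lemma pf_angle_continuous (lambda : R) (f g rho2 : R -> R) (B : R -> R -> R) (x y : R) :
  polar_flow lambda f g rho2 B -> continuous (B x) y.
Proof. intros HB. eapply is_derive_continuous, (pf_angle _ _ _ _ _ HB). Qed.

Lemma pf_not_fixed (lambda : R) (f g rho2 : R -> R) (B : R -> R -> R) (x y z : R) :
  polar_flow lambda f g rho2 B -> g z = 0 -> B x y = z -> x = z.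
Proof.
  intros HB Hz E. rewrite <- (pf_back _ _ _ _ _ x y HB), E. now apply (pf_fixed _ _ _ _ _ HB).
Qed.

(** A zero of [g] on the orbit would be an equilibrium, which no other orbit meets; so [g] cannot
    change sign along the orbit. *)
Lemma pf_sign (lambda : R) (f g rho2 : R -> R) (B : R -> R -> R) (s : pm) (x : R) :
  polar_flow lambda f g rho2 B -> (forall z, continuous g z) -> 0 < sign_val s * g x ->
  forall y, 0 < sign_val s * g (B x y).
Proof.
  intros HB Cg Hs y. apply Rnot_le_lt. intros C.
  pose (h := fun z => sign_val s * g (B x z)).
  assert (Ch : forall z, continuous h z).
  { intros z. apply continuous_mult_R; [apply continuous_const_R |].
    apply (continuous_comp_real (B x) g); auto. eapply pf_angle_continuous, HB. }
  assert (H0 : 0 < h 0) by (unfold h; now rewrite (pf_zero _ _ _ _ _ HB)).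
  assert (Z : exists z, h z = 0).
  { destruct (Rle_dec 0 y) as [Hy | Hy].
    - destruct (intermediate_value h 0 y 0) as [z [_ Hz]]; auto. right. split; [exact C | lra]. now exists z.
    - destruct (intermediate_value h y 0 0) as [z [_ Hz]]; auto; try lra. left. split; [exact C | lra]. now exists z. }
  destruct Z as [z Hz]. assert (gz : g (B x z) = 0) by (unfold h in Hz; destruct s; simpl in Hz; lra).
  rewrite (pf_not_fixed _ _ _ _ _ x z (B x z) HB gz eq_refl) in Hs. rewrite gz in Hs. lra.
Qed.

Lemma pf_monotone (lambda : R) (f g rho2 : R -> R) (B : R -> R -> R) (s : pm) (x y z : R) :
  0 < lambda -> polar_flow lambda f g rho2 B -> (forall z, continuous g z) -> 0 < sign_val s * g x ->
  y < z -> sign_val s * B x y < sign_val s * B x z.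
Proof.
  intros Hl HB Cg Hs Hyz.
  apply (increasing_derive (fun y => sign_val s * B x y)
    (fun y => sign_val s * g (B x y) * (rho2 (B x y) / (2 * lambda)))); auto.
  - intros r _. eapply is_derive_eq.
    + apply is_derive_mult_R; [apply is_derive_const_R | apply (pf_angle _ _ _ _ _ HB)].
    + simpl. field. lra.
  - intros r _. apply Rmult_lt_0_compat.
    + eapply pf_sign; eauto.
    + apply Rdiv_lt_0_compat; [eapply rho2_pos, HB | lra].
Qed.

Lemma pf_time_lt (lambda : R) (f g rho2 : R -> R) (B : R -> R -> R) (s : pm) (x y z : R) :
  0 < lambda -> polar_flow lambda f g rho2 B -> (forall z, continuous g z) -> 0 < sign_val s * g x ->
  (sign_val s * B x y < sign_val s * B x z <-> y < z).
Proof.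
  intros Hl HB Cg Hs. split.
  - intros H. destruct (Rtotal_order y z) as [|[-> | K]]; auto; [lra |].
    pose proof (pf_monotone _ _ _ _ _ s x z y Hl HB Cg Hs K). lra.
  - now apply (pf_monotone lambda f g rho2).
Qed.

Lemma pf_reach (lambda : R) (f g rho2 : R -> R) (B : R -> R -> R) (s : pm) (x q : R) :
  0 < lambda -> polar_flow lambda f g rho2 B -> (forall z, continuous g z) ->
  (forall z, Rmin x q <= z <= Rmax x q -> 0 < sign_val s * g z) -> exists y, B x y = q.
Proof.
  intros Hl HB Cg Hs.
  assert (P : forall z, 0 < rho2 z / (2 * lambda)).
  { intros z. apply Rdiv_lt_0_compat; [eapply rho2_pos, HB | lra]. }
  assert (E : forall z, sign_val s * (g z * rho2 z / (2 * lambda)) = sign_val s * g z * (rho2 z / (2 * lambda)))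
    by (intros; field; lra).
  apply (reach (B x) (fun z => g z * rho2 z / (2 * lambda)) s).
  - intros y. apply (pf_angle _ _ _ _ _ HB).
  - intros y. rewrite E. apply Rmult_lt_0_compat; auto. eapply pf_sign; eauto. apply Hs.
    split; [apply Rmin_l | apply Rmax_l].
  - intros z. apply continuous_mult_R; [| apply continuous_const_R]. apply continuous_mult_R; auto.
    apply (pf_cont _ _ _ _ _ HB).
  - rewrite (pf_zero _ _ _ _ _ HB). intros z Hz. rewrite E. apply Rmult_lt_0_compat; auto.
Qed.

(** * Arcs between consecutive equilibria and chains of arcs *)

(** Time is not rescaled here: an orbit joining two equilibria takes all real times, so two such
    orbits can be matched with factor 1. *)
Record conjugacy_on (B B' : R -> R -> R) (a b a' b' : R) (eta : R -> R) : Prop := {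
  co_range : forall x, a <= x <= b -> a' <= eta x <= b';
  co_left : eta a = a';
  co_right : eta b = b';
  co_incr : forall x y, a <= x -> x < y -> y <= b -> eta x < eta y;
  co_surj : forall z, a' <= z <= b' -> exists x, a <= x <= b /\ eta x = z;
  co_stays : forall x y, a <= x <= b -> a <= B x y <= b;
  co_flow : forall x y, a <= x <= b -> eta (B x y) = B' (eta x) y
}.

Lemma arc_invariant (lambda : R) (f g rho2 : R -> R) (B : R -> R -> R) (a b x y : R) :
  polar_flow lambda f g rho2 B -> g a = 0 -> g b = 0 -> a < x < b -> a < B x y < b.
Proof.
  intros HB Ga Gb Hx.
  assert (N : forall z w, (z = a \/ z = b) -> B x w <> z).
  { intros z w Hz E. apply (pf_not_fixed _ _ _ _ _ _ _ _ HB) in E; [destruct Hz; lra | destruct Hz; subst; auto]. }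
  assert (C : forall z w, (x <= z <= B x w \/ B x w <= z <= x) -> exists r, B x r = z).
  { intros z w Hz. destruct (Rle_dec 0 w) as [Hw | Hw].
    - destruct (intermediate_value (B x) 0 w z) as [r [_ Hr]]; auto.
      + intros; eapply pf_angle_continuous, HB.
      + now rewrite (pf_zero _ _ _ _ _ HB).
      + now exists r.
    - destruct (intermediate_value (B x) w 0 z) as [r [_ Hr]]; try lra.
      + intros; eapply pf_angle_continuous, HB.
      + rewrite (pf_zero _ _ _ _ _ HB). tauto.
      + now exists r. }
  split; apply Rnot_le_lt; intros H.
  - destruct (C a y) as [r Hr]; [lra |]. apply (N a r); auto.
  - destruct (C b y) as [r Hr]; [lra |]. apply (N b r); auto.
Qed.

(** Each open arc is a single orbit. The orbits of the two midpoints are matched time by time, and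
    the common sign [s] makes them run in the same direction. *)
Lemma arc_conjugacy (lambda : R) (f g rho2 f' g' rho2' : R -> R) (B B' : R -> R -> R) (s : pm) (a b a' b' : R) :
  0 < lambda -> polar_flow lambda f g rho2 B -> polar_flow lambda f' g' rho2' B' ->
  (forall z, continuous g z) -> (forall z, continuous g' z) ->
  a < b -> a' < b' -> g a = 0 -> g b = 0 -> g' a' = 0 -> g' b' = 0 ->
  (forall x, a < x < b -> 0 < sign_val s * g x) -> (forall x, a' < x < b' -> 0 < sign_val s * g' x) ->
  exists eta, conjugacy_on B B' a b a' b' eta.
Proof.
  intros Hl HB HB' Cg Cg' Hab Hab' Ga Gb Ga' Gb' Hs Hs'.
  pose (p := (a + b) / 2). pose (p' := (a' + b') / 2).
  assert (Hp : a < p < b) by (unfold p; lra). assert (Hp' : a' < p' < b') by (unfold p'; lra).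
  (* The condition on [x] stands under the quantifier, so that the time [T] becomes a total
     function, with 0 as default value. *)
  assert (HT : forall x, exists y, a < x < b -> B p y = x).
  { intros x. destruct (classic (a < x < b)) as [Hx | Hx]; [| now exists 0].
    destruct (pf_reach lambda f g rho2 B s p x) as [y Hy]; auto.
    - intros z Hz. apply Hs. unfold Rmin, Rmax in Hz. destruct (Rle_dec p x); lra.
    - now exists y. }
  pose (T := fun x => proj1_sig (constructive_indefinite_description _ (HT x))).
  assert (BT : forall x, a < x < b -> B p (T x) = x).
  { intros x. unfold T. destruct (constructive_indefinite_description _ (HT x)) as [y Hy]. exact Hy. }
  clearbody T.
  pose proof (fun y z => pf_time_lt lambda f g rho2 B s p y z Hl HB Cg (Hs p Hp)) as TL.
  pose proof (fun y z => pf_time_lt lambda f' g' rho2' B' s p' y z Hl HB' Cg' (Hs' p' Hp')) as TL'.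
  assert (TB : forall y, T (B p y) = y).
  { intros y. pose proof (arc_invariant _ _ _ _ _ _ _ p y HB Ga Gb Hp) as Hy. specialize (BT _ Hy).
    destruct (Rtotal_order (T (B p y)) y) as [K | [K | K]]; auto; apply TL in K; rewrite BT in K; lra. }
  pose (eta := fun x => if Rle_dec x a then a' else if Rle_dec b x then b' else B' p' (T x)).
  assert (E0 : eta a = a') by (unfold eta; destruct (Rle_dec a a); lra).
  assert (E1 : eta b = b') by (unfold eta; destruct (Rle_dec b a), (Rle_dec b b); lra).
  assert (E2 : forall x, a < x < b -> eta x = B' p' (T x)).
  { intros x Hx. unfold eta. destruct (Rle_dec x a), (Rle_dec b x); lra. }
  assert (R2 : forall x, a < x < b -> a' < eta x < b').
  { intros x Hx. rewrite E2 by auto. apply (arc_invariant _ _ _ _ _ _ _ _ _ HB' Ga' Gb' Hp'). }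
  assert (Tri : forall x, a <= x <= b -> x = a \/ x = b \/ a < x < b) by (intros; lra).
  exists eta. split; auto.
  - intros x Hx. destruct (Tri x Hx) as [-> | [-> | K]]; try lra. apply R2 in K. lra.
  - intros x y Hx Hxy Hy.
    destruct (Tri x) as [-> | [-> | K]]; try lra; destruct (Tri y) as [-> | [-> | K']]; try lra.
    + apply R2 in K'. lra.
    + apply R2 in K. lra.
    + rewrite !E2 by auto.
      assert (TT : sign_val s * T x < sign_val s * T y).
      { pose proof (BT x K). pose proof (BT y K').
        destruct s; simpl sign_val in *.
        - assert (T x < T y) by (apply TL; lra). lra.
        - assert (T y < T x) by (apply TL; lra). lra. }
      destruct s; simpl sign_val in *.
      * assert (K2 : T x < T y) by lra. apply TL' in K2. lra.
      * assert (K2 : T y < T x) by lra. apply TL' in K2. lra.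
  - intros z Hz. assert (z = a' \/ z = b' \/ a' < z < b') as [-> | [-> | K]] by lra.
    + exists a. lra.
    + exists b. lra.
    + destruct (pf_reach lambda f' g' rho2' B' s p' z) as [y Hy]; auto.
      { intros r Hr. apply Hs'. unfold Rmin, Rmax in Hr. destruct (Rle_dec p' z); lra. }
      pose proof (arc_invariant _ _ _ _ _ _ _ p y HB Ga Gb Hp).
      exists (B p y). split; [lra |]. rewrite E2, TB; auto.
  - intros x y Hx. destruct (Tri x Hx) as [-> | [-> | K]].
    + rewrite (pf_fixed _ _ _ _ _ HB) by auto. lra.
    + rewrite (pf_fixed _ _ _ _ _ HB) by auto. lra.
    + pose proof (arc_invariant _ _ _ _ _ _ _ x y HB Ga Gb K). lra.
  - intros x y Hx. destruct (Tri x Hx) as [-> | [-> | K]].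
    + rewrite (pf_fixed _ _ _ _ _ HB), E0 by auto. symmetry. now apply (pf_fixed _ _ _ _ _ HB').
    + rewrite (pf_fixed _ _ _ _ _ HB), E1 by auto. symmetry. now apply (pf_fixed _ _ _ _ _ HB').
    + pose proof (arc_invariant _ _ _ _ _ _ _ x y HB Ga Gb K) as K'. rewrite !E2 by auto.
      rewrite <- (pf_add _ _ _ _ _ HB'). f_equal.
      rewrite <- (BT x K) at 1. now rewrite <- (pf_add _ _ _ _ _ HB), TB.
Qed.

Lemma glue_conjugacies (B B' : R -> R -> R) (a b c a' b' c' : R) (eta1 eta2 : R -> R) :
  a <= b -> b <= c ->
  conjugacy_on B B' a b a' b' eta1 -> conjugacy_on B B' b c b' c' eta2 ->
  exists eta, conjugacy_on B B' a c a' c' eta.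
Proof.
  intros Hab Hbc H1 H2.
  pose (eta := fun x => if Rle_dec x b then eta1 x else eta2 x).
  assert (E1 : forall x, x <= b -> eta x = eta1 x) by (intros; unfold eta; destruct (Rle_dec x b); lra).
  assert (E2 : forall x, b <= x -> eta x = eta2 x).
  { intros x Hx. unfold eta. destruct (Rle_dec x b); auto. replace x with b by lra.
    now rewrite (co_right _ _ _ _ _ _ _ H1), (co_left _ _ _ _ _ _ _ H2). }
  assert (Hb' : a' <= b' <= c').
  { pose proof (co_range _ _ _ _ _ _ _ H1 a ltac:(lra)) as K1. rewrite (co_left _ _ _ _ _ _ _ H1) in K1.
    pose proof (co_range _ _ _ _ _ _ _ H2 b ltac:(lra)) as K2. rewrite (co_left _ _ _ _ _ _ _ H2) in K2. lra. }
  exists eta. split.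
  - intros x Hx. destruct (Rle_dec x b).
    + rewrite E1 by auto. pose proof (co_range _ _ _ _ _ _ _ H1 x ltac:(lra)). lra.
    + rewrite E2 by lra. pose proof (co_range _ _ _ _ _ _ _ H2 x ltac:(lra)). lra.
  - rewrite E1 by auto. apply H1.
  - rewrite E2 by auto. apply H2.
  - intros x y Hx Hxy Hy. destruct (Rle_dec y b).
    + rewrite !E1 by lra. apply (co_incr _ _ _ _ _ _ _ H1); lra.
    + destruct (Rle_dec b x).
      * rewrite !E2 by lra. apply (co_incr _ _ _ _ _ _ _ H2); lra.
      * rewrite E1, E2 by lra.
        pose proof (co_range _ _ _ _ _ _ _ H1 x ltac:(lra)).
        pose proof (co_incr _ _ _ _ _ _ _ H2 b y ltac:(lra) ltac:(lra) ltac:(lra)) as K.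
        rewrite (co_left _ _ _ _ _ _ _ H2) in K. lra.
  - intros z Hz. destruct (Rle_dec z b').
    + destruct (co_surj _ _ _ _ _ _ _ H1 z ltac:(lra)) as [x [Hx E]]. exists x. rewrite E1 by lra. split; [lra | auto].
    + destruct (co_surj _ _ _ _ _ _ _ H2 z ltac:(lra)) as [x [Hx E]]. exists x. rewrite E2 by lra. split; [lra | auto].
  - intros x y Hx. destruct (Rle_dec x b).
    + pose proof (co_stays _ _ _ _ _ _ _ H1 x y ltac:(lra)). lra.
    + pose proof (co_stays _ _ _ _ _ _ _ H2 x y ltac:(lra)). lra.
  - intros x y Hx. destruct (Rle_dec x b).
    + pose proof (co_stays _ _ _ _ _ _ _ H1 x y ltac:(lra)). rewrite !E1 by lra. apply (co_flow _ _ _ _ _ _ _ H1). lra.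
    + pose proof (co_stays _ _ _ _ _ _ _ H2 x y ltac:(lra)). rewrite !E2 by lra. apply (co_flow _ _ _ _ _ _ _ H2). lra.
Qed.

(** The invariant that decides the conjugacy of circle flows with isolated equilibria: the signs of
    [g] on the successive arcs, without the multiplicities of the zeros. *)
Inductive chain (g : R -> R) : R -> list pm -> R -> Prop :=
  | chain_nil a : g a = 0 -> chain g a [] a
  | chain_cons a b c s l : a < b -> g a = 0 -> (forall x, a < x < b -> 0 < sign_val s * g x) ->
      chain g b l c -> chain g a (s :: l) c.

Lemma chain_ends (g : R -> R) (a b : R) (l : list pm) : chain g a l b -> g a = 0 /\ g b = 0 /\ a <= b.
Proof.
  induction 1 as [a H | a b c s l Hab Ha Hs Hc [IH1 [IH2 IH3]]]; repeat split; auto; lra.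
Qed.

Lemma chain_conjugacy (lambda : R) (f g rho2 f' g' rho2' : R -> R) (B B' : R -> R -> R) (l : list pm) (a b a' b' : R) :
  0 < lambda -> polar_flow lambda f g rho2 B -> polar_flow lambda f' g' rho2' B' ->
  (forall z, continuous g z) -> (forall z, continuous g' z) ->
  chain g a l b -> chain g' a' l b' -> exists eta, conjugacy_on B B' a b a' b' eta.
Proof.
  intros Hl HB HB' Cg Cg'. revert a b a' b'. induction l as [| s l IH]; intros a b a' b' H H'.
  - inversion H as [a0 Ha | ]; inversion H' as [a0' Ha' | ]; subst.
    exists (fun _ => b'). split; intros; auto; try lra.
    + exists b. lra.
    + assert (x = b) by lra. subst. rewrite (pf_fixed _ _ _ _ _ HB); auto.
    + symmetry. now apply (pf_fixed _ _ _ _ _ HB').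
  - inversion H as [| a0 m c0 s0 l0 Ham Ha Hs Hc]; inversion H' as [| a0' m' c0' s0' l0' Ham' Ha' Hs' Hc']; subst.
    pose proof (chain_ends _ _ _ _ Hc) as [Gm [_ Hmb]]. pose proof (chain_ends _ _ _ _ Hc') as [Gm' _].
    destruct (arc_conjugacy lambda f g rho2 f' g' rho2' B B' s a m a' m') as [e1 He1]; auto.
    destruct (IH _ _ _ _ Hc Hc') as [e2 He2].
    apply (glue_conjugacies B B' a m b a' m' b' e1 e2); auto; lra.
Qed.

Lemma increasing_conjugacy (B B' : R -> R -> R) (p : R) (eta : R -> R) :
  0 < p -> (forall x y, x < y -> eta x < eta y) -> (forall z, exists x, eta x = z) ->
  (forall x, eta (x + PI) = eta x + PI) -> (forall x y, eta (B x y) = B' (eta x) (p * y)) ->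
  exists eta', circle_conjugacy B B' p eta eta'.
Proof.
  intros Hp Hi Hs Hsh Hf.
  pose (eta' := fun z => proj1_sig (constructive_indefinite_description _ (Hs z))).
  assert (R' : forall z, eta (eta' z) = z).
  { intros z. unfold eta'. destruct (constructive_indefinite_description _ (Hs z)). assumption. }
  clearbody eta'.
  assert (Hinj : forall x y, eta x = eta y -> x = y).
  { intros x y E. destruct (Rtotal_order x y) as [K | [K | K]]; auto; apply Hi in K; lra. }
  assert (L' : forall x, eta' (eta x) = x) by (intros; now apply Hinj).
  exists eta'. split; auto.
  - now apply increasing_surjective_continuous.
  - apply increasing_surjective_continuous.
    + intros x y H. destruct (Rtotal_order (eta' x) (eta' y)) as [|[K | K]]; auto.
      * rewrite <- (R' x), <- (R' y), K in H. lra.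
      * apply Hi in K. rewrite !R' in K. lra.
    + intros x. exists (eta x). apply L'.
  - exists 1. split; auto. intros x. replace (x + 2 * PI) with (x + PI + PI) by ring. rewrite !Hsh. ring.
Qed.

(** Both flows commute with the translation by [PI], so a conjugacy on half a turn is repeated by
    translations. *)
Lemma periodic_conjugacy (lambda : R) (f g rho2 f' g' rho2' : R -> R) (B B' : R -> R -> R) (a a' : R) (eta0 : R -> R) :
  polar_flow lambda f g rho2 B -> polar_flow lambda f' g' rho2' B' ->
  conjugacy_on B B' a (a + PI) a' (a' + PI) eta0 ->
  exists eta eta', circle_conjugacy B B' 1 eta eta'.
Proof.
  intros HB HB' H. pose proof PI_RGT_0.
  pose (n := fun x => Int_part ((x - a) / PI)).
  assert (Hn : forall x, a <= x - IZR (n x) * PI < a + PI).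
  { intros x. unfold n. destruct (base_Int_part ((x - a) / PI)) as [H1 H2].
    assert (E : (x - a) / PI * PI = x - a) by (field; lra).
    set (k := IZR (Int_part ((x - a) / PI))) in *. set (q := (x - a) / PI) in *. nra. }
  pose (eta := fun x => eta0 (x - IZR (n x) * PI) + IZR (n x) * PI).
  assert (Hlt : forall k m : Z, IZR k * PI < IZR m * PI + PI -> (k <= m)%Z).
  { intros k m K. apply Z.lt_succ_r, lt_IZR. rewrite succ_IZR. nra. }
  (* At the right end of a period two translates overlap; they agree because [eta0] sends ends to
     ends. *)
  assert (He : forall x m, a <= x - IZR m * PI <= a + PI -> eta x = eta0 (x - IZR m * PI) + IZR m * PI).
  { intros x m Hm. specialize (Hn x). unfold eta.
    destruct (Rle_lt_or_eq_dec _ _ (proj2 Hm)) as [K | K].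
    - assert (n x = m) as -> by (apply Z.le_antisymm; apply Hlt; lra). reflexivity.
    - assert (E : n x = (m + 1)%Z).
      { apply Z.le_antisymm; apply Hlt; rewrite plus_IZR; lra. }
      rewrite E, plus_IZR. replace (x - (IZR m + 1) * PI) with a by lra.
      rewrite K, (co_left _ _ _ _ _ _ _ H), (co_right _ _ _ _ _ _ _ H). ring. }
  destruct (increasing_conjugacy B B' 1 eta) as [eta' He']; [lra | | | | | now exists eta, eta'].
  - intros x y Hxy. pose proof (Hn x) as Hx. pose proof (Hn y) as Hy.
    assert (K : (n x <= n y)%Z) by (apply Hlt; lra).
    destruct (Z.eq_dec (n x) (n y)) as [E | E].
    + unfold eta. rewrite <- E in *. pose proof (co_incr _ _ _ _ _ _ _ H (x - IZR (n x) * PI) (y - IZR (n x) * PI)). lra.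
    + assert (K' : IZR (n x) + 1 <= IZR (n y)) by (rewrite <- succ_IZR; apply IZR_le; lia).
      unfold eta.
      pose proof (co_incr _ _ _ _ _ _ _ H (x - IZR (n x) * PI) (a + PI) ltac:(lra) ltac:(lra) ltac:(lra)) as K1.
      rewrite (co_right _ _ _ _ _ _ _ H) in K1.
      pose proof (co_range _ _ _ _ _ _ _ H (y - IZR (n y) * PI) ltac:(lra)). nra.
  - intros z. destruct (reduce_modulo a' PI z ltac:(lra)) as [k Hk].
    destruct (co_surj _ _ _ _ _ _ _ H (z + IZR k * PI) ltac:(lra)) as [x [Hx E]].
    exists (x + IZR (- k) * PI).
    rewrite (He (x + IZR (- k) * PI) (- k)%Z) by lra.
    replace (x + IZR (- k) * PI - IZR (- k) * PI) with x by ring. rewrite E, opp_IZR. ring.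
  - intros x. pose proof (Hn x).
    rewrite (He (x + PI) (n x + 1)%Z) by (rewrite plus_IZR; lra).
    rewrite (He x (n x)) by lra. rewrite plus_IZR.
    replace (x + PI - (IZR (n x) + 1) * PI) with (x - IZR (n x) * PI) by ring. ring.
  - intros x y. pose proof (Hn x). rewrite Rmult_1_l.
    assert (E : B x y = B (x - IZR (n x) * PI) y + IZR (n x) * PI).
    { rewrite <- (equivariant_multiple (fun x => B x y) PI PI) by (intros; apply (pf_shift _ _ _ _ _ HB)).
      f_equal. ring. }
    pose proof (co_stays _ _ _ _ _ _ _ H (x - IZR (n x) * PI) y ltac:(lra)) as S.
    rewrite (He (B x y) (n x)) by (rewrite E; lra). rewrite (He x (n x)) by lra.
    rewrite (equivariant_multiple (fun x => B' x y) PI PI) by (intros; apply (pf_shift _ _ _ _ _ HB')).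
    f_equal. rewrite <- (co_flow _ _ _ _ _ _ _ H) by lra. f_equal. rewrite E. ring.
Qed.

Lemma circle_conjugacy_chain (lambda : R) (f g rho2 f' g' rho2' : R -> R) (B B' : R -> R -> R) (l : list pm) (a a' : R) :
  0 < lambda -> polar_flow lambda f g rho2 B -> polar_flow lambda f' g' rho2' B' ->
  (forall z, continuous g z) -> (forall z, continuous g' z) ->
  chain g a l (a + PI) -> chain g' a' l (a' + PI) ->
  exists p eta eta', circle_conjugacy B B' p eta eta'.
Proof.
  intros Hl HB HB' Cg Cg' H H'.
  destruct (chain_conjugacy lambda f g rho2 f' g' rho2' B B' l a (a + PI) a' (a' + PI)) as [e He]; auto.
  exists 1. now apply (periodic_conjugacy lambda f g rho2 f' g' rho2' B B' a a' e).
Qed.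

Lemma circle_conjugacy_fixed (lambda : R) (f g rho2 f' g' rho2' : R -> R) (B B' : R -> R -> R) :
  polar_flow lambda f g rho2 B -> polar_flow lambda f' g' rho2' B' ->
  (forall z, g z = 0) -> (forall z, g' z = 0) ->
  exists p eta eta', circle_conjugacy B B' p eta eta'.
Proof.
  intros HB HB' H H'. exists 1, (fun x => x), (fun x => x). split; auto; try lra.
  - intros; apply continuous_id.
  - intros; apply continuous_id.
  - exists 1. split; auto. intros; ring.
  - intros x y. rewrite (pf_fixed _ _ _ _ _ HB) by auto. symmetry. now apply (pf_fixed _ _ _ _ _ HB').
Qed.

(** Without equilibria the two circle flows have different periods, whence the factor [p]. *)
Lemma circle_conjugacy_rotation (lambda : R) (f g rho2 f' g' rho2' : R -> R) (B B' : R -> R -> R) (s : pm) :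
  0 < lambda -> polar_flow lambda f g rho2 B -> polar_flow lambda f' g' rho2' B' ->
  (forall z, continuous g z) -> (forall z, continuous g' z) ->
  (forall z, 0 < sign_val s * g z) -> (forall z, 0 < sign_val s * g' z) ->
  exists p eta eta', circle_conjugacy B B' p eta eta'.
Proof.
  intros Hl HB HB' Cg Cg' H H'. pose proof PI_RGT_0.
  assert (HT : forall x, exists y, B 0 y = x) by (intros; apply (pf_reach lambda _ _ _ _ s 0 x Hl HB); auto).
  assert (HT' : forall x, exists y, B' 0 y = x) by (intros; apply (pf_reach lambda _ _ _ _ s 0 x Hl HB'); auto).
  pose (T := fun x => proj1_sig (constructive_indefinite_description _ (HT x))).
  assert (BT : forall x, B 0 (T x) = x).
  { intros x. unfold T. destruct (constructive_indefinite_description _ (HT x)). assumption. }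
  clearbody T.
  pose proof (fun y z => pf_time_lt lambda f g rho2 B s 0 y z Hl HB Cg (H 0)) as TL.
  pose proof (fun y z => pf_time_lt lambda f' g' rho2' B' s 0 y z Hl HB' Cg' (H' 0)) as TL'.
  assert (TB : forall y, T (B 0 y) = y).
  { intros y. specialize (BT (B 0 y)).
    destruct (Rtotal_order (T (B 0 y)) y) as [K | [K | K]]; auto; apply TL in K; rewrite BT in K; lra. }
  destruct (HT' PI) as [y1 Hy1]. pose (y0 := T PI). assert (Hy0 : B 0 y0 = PI) by apply BT.
  assert (S0 : 0 < sign_val s * y0).
  { pose proof (pf_zero _ _ _ _ _ HB 0) as Z. destruct s; simpl sign_val in *.
    - assert (0 < y0) by (apply TL; lra). lra.
    - assert (y0 < 0) by (apply TL; lra). lra. }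
  assert (S1 : 0 < sign_val s * y1).
  { pose proof (pf_zero _ _ _ _ _ HB' 0) as Z. destruct s; simpl sign_val in *.
    - assert (0 < y1) by (apply TL'; lra). lra.
    - assert (y1 < 0) by (apply TL'; lra). lra. }
  (* [y0] and [y1] are the times of half a turn for the two flows; both are negative if the rotation
     is clockwise. *)
  pose (p := y1 / y0).
  assert (Hy0' : y0 <> 0) by (intros E; rewrite E in S0; lra).
  assert (Hp : 0 < p).
  { replace p with (sign_val s * y1 / (sign_val s * y0)).
    - now apply Rdiv_lt_0_compat.
    - unfold p. field. split; auto. destruct s; simpl; lra. }
  exists p, (fun x => B' 0 (p * T x)). apply increasing_conjugacy; auto.
  - intros x y Hxy. pose proof (BT x). pose proof (BT y).
    destruct s; simpl sign_val in *.
    + assert (T x < T y) by (apply TL; lra).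
      assert (K : p * T x < p * T y) by now apply Rmult_lt_compat_l.
      apply TL' in K. lra.
    + assert (T y < T x) by (apply TL; lra).
      assert (K : p * T y < p * T x) by now apply Rmult_lt_compat_l.
      apply TL' in K. lra.
  - intros z. destruct (HT' z) as [y Hy]. exists (B 0 (y / p)). rewrite TB.
    replace (p * (y / p)) with y by (field; lra). exact Hy.
  - intros x. assert (E : T (x + PI) = y0 + T x).
    { rewrite <- (TB (y0 + T x)). f_equal.
      rewrite (pf_add _ _ _ _ _ HB), Hy0, <- (Rplus_0_l PI), (pf_shift _ _ _ _ _ HB), BT. ring. }
    rewrite E. replace (p * (y0 + T x)) with (y1 + p * T x) by (unfold p; field; auto).
    rewrite (pf_add _ _ _ _ _ HB'), Hy1, <- (Rplus_0_l PI), (pf_shift _ _ _ _ _ HB'). ring.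
  - intros x y. rewrite <- (pf_add _ _ _ _ _ HB'). f_equal. rewrite <- Rmult_plus_distr_l. f_equal.
    rewrite <- (BT x) at 1. now rewrite <- (pf_add _ _ _ _ _ HB), TB.
Qed.

(** * Reflection of the angle *)

(** The change of variable [x -> - x], under which a velocity [g] becomes [- g (- x)]. It turns two
    arcs with [g < 0] into two arcs with [g > 0]. *)
Lemma polar_flow_reflect (lambda : R) (f g rho2 : R -> R) (B : R -> R -> R) :
  polar_flow lambda f g rho2 B ->
  polar_flow lambda (fun x => f (- x)) (fun x => - g (- x)) (fun x => rho2 (- x)) (fun x y => - B (- x) y).
Proof.
  intros HB. split.
  - destruct (pf_bounds _ _ _ _ _ HB) as [c1 [c2 [H1 H2]]]. exists c1, c2. split; auto.
  - intros x. apply (continuous_comp_real Ropp rho2); [| apply (pf_cont _ _ _ _ _ HB)].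
    apply (continuous_opp (fun y : R => y)), continuous_id.
  - intros x. rewrite <- (pf_period _ _ _ _ _ HB). f_equal. ring.
  - intros x. rewrite (pf_zero _ _ _ _ _ HB). ring.
  - intros x y z. now rewrite Ropp_involutive, (pf_add _ _ _ _ _ HB).
  - intros x y. pose proof (pf_shift _ _ _ _ _ HB (- (x + PI)) y) as E.
    replace (- (x + PI) + PI) with (- x) in E by ring. lra.
  - intros x y H. rewrite (pf_fixed _ _ _ _ _ HB) by lra. ring.
  - intros x y. rewrite Ropp_involutive. eapply is_derive_eq.
    + apply is_derive_opp_R, (pf_angle _ _ _ _ _ HB).
    + unfold Rdiv. ring.
  - intros x y. rewrite Ropp_involutive.
    apply (is_derive_ext_R (fun z => rho2 (B (- x) z))); [intros; now rewrite Ropp_involutive |].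
    apply (pf_radius _ _ _ _ _ HB).
Qed.

Lemma circle_conjugacy_reflect (B B' : R -> R -> R) (p : R) (eta eta' : R -> R) :
  circle_conjugacy (fun x y => - B (- x) y) B' p eta eta' ->
  circle_conjugacy B B' p (fun x => eta (- x)) (fun x => - eta' x).
Proof.
  intros [Hp H1 H2 C1 C2 [s [Hs Hsh]] Hf]. split; auto.
  - intros x. rewrite H1. ring.
  - intros x. now rewrite Ropp_involutive.
  - intros x. apply (continuous_comp_real Ropp eta); auto.
    apply (continuous_opp (fun y : R => y)), continuous_id.
  - intros x. apply (continuous_opp eta'), C2.
  - exists (- s). split; [destruct Hs as [-> | ->]; [right | left]; ring |].
    intros x. pose proof (Hsh (- (x + 2 * PI))) as E.
    replace (- (x + 2 * PI) + 2 * PI) with (- x) in E by ring. lra.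
  - intros x y. pose proof (Hf (- x) y) as E. now rewrite Ropp_involutive in E.
Qed.

(** * Zeros of trigonometric polynomials *)

(** A class of bounded Lipschitz functions that is stable under products and derivatives: it serves
    both the flows and the multiplicities of zeros. *)
Inductive trig : (R -> R) -> Prop :=
  | trig_const c : trig (fun _ => c)
  | trig_sin : trig sin
  | trig_cos : trig cos
  | trig_plus u w : trig u -> trig w -> trig (fun x => u x + w x)
  | trig_mult u w : trig u -> trig w -> trig (fun x => u x * w x).

Lemma trig_ext (u w : R -> R) : (forall x, u x = w x) -> trig u -> trig w.
Proof. intros H Hu. now rewrite <- (functional_extensionality u w H). Qed.

Lemma trig_bounded_lipschitz (u : R -> R) : trig u -> bounded_lipschitz u.
Proof.
  induction 1.
  - apply bounded_lipschitz_const.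
  - apply bounded_lipschitz_sin.
  - apply bounded_lipschitz_cos.
  - now apply bounded_lipschitz_plus.
  - now apply bounded_lipschitz_mult.
Qed.

Lemma trig_continuous (u : R -> R) (x : R) : trig u -> continuous u x.
Proof. intros H. now apply bounded_lipschitz_continuous, trig_bounded_lipschitz. Qed.

Lemma trig_derive (u : R -> R) : trig u -> exists u', trig u' /\ forall x, is_derive u x (u' x).
Proof.
  induction 1 as [c | | | u w Hu [u' [Tu Du]] Hw [w' [Tw Dw]] | u w Hu [u' [Tu Du]] Hw [w' [Tw Dw]]].
  - exists (fun _ => 0). split; [apply trig_const | intros; apply is_derive_const_R].
  - exists cos. split; [apply trig_cos | intros; apply is_derive_sin].
  - exists (fun x => - 1 * sin x). split; [apply trig_mult; [apply trig_const | apply trig_sin] |].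
    intros x. eapply is_derive_eq; [apply is_derive_cos | ring].
  - exists (fun x => u' x + w' x). split; [now apply trig_plus | intros; now apply is_derive_plus_R].
  - exists (fun x => u' x * w x + u x * w' x). split; [| intros; now apply is_derive_mult_R].
    apply trig_plus; now apply trig_mult.
Qed.

Lemma trig_sin_shift (z : R) : trig (fun x => sin (x - z)).
Proof.
  apply (trig_ext (fun x => sin x * cos z + (-1 * cos x) * sin z)).
  - intros x. rewrite sin_minus. ring.
  - repeat first [apply trig_plus | apply trig_mult | apply trig_const | apply trig_sin | apply trig_cos].
Qed.

Lemma trig_cos_shift (z : R) : trig (fun x => cos (x - z)).
Proof.
  apply (trig_ext (fun x => cos x * cos z + sin x * sin z)).
  - intros x. rewrite cos_minus. ring.
  - repeat first [apply trig_plus | apply trig_mult | apply trig_const | apply trig_sin | apply trig_cos].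
Qed.

Lemma trig_pow (u : R -> R) (n : nat) : trig u -> trig (fun x => u x ^ n).
Proof.
  intros H. induction n as [| n IH]; simpl; [apply trig_const | now apply trig_mult].
Qed.

(** [sin (x - z)] replaces the local coordinate [x - z], which is not a trigonometric polynomial;
    [s] is the sign of the leading coefficient at [z]. *)
Definition zero_form (g : R -> R) (z : R) (m : nat) (s : pm) : Prop :=
  exists u, trig u /\ 0 < sign_val s * u z /\ forall x, g x = sin (x - z) ^ m * u x.

Lemma is_derive_sin_shift (z x : R) : is_derive (fun x => sin (x - z)) x (cos (x - z)).
Proof. auto_derive; [trivial | unfold Rminus; ring]. Qed.

(** Differentiation lowers the exponent by one and multiplies the leading coefficient by the
    positive number [INR (S m)]. All successive derivatives at [z] follow. *)
Lemma zero_form_derive (g : R -> R) (z : R) (m : nat) (s : pm) :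
  zero_form g z (S m) s -> zero_form (Derive g) z m s /\ forall x, is_derive g x (Derive g x).
Proof.
  intros [u [Tu [Hu Hg]]]. destruct (trig_derive u Tu) as [u' [Tu' Du]].
  pose (u1 := fun x => (INR (S m) * cos (x - z)) * u x + sin (x - z) * u' x).
  assert (D : forall x, is_derive g x (sin (x - z) ^ m * u1 x)).
  { intros x. apply (is_derive_ext_R (fun x => sin (x - z) ^ (S m) * u x)); [intros; now rewrite Hg |].
    eapply is_derive_eq.
    - apply is_derive_mult_R; [| apply Du].
      apply (is_derive_pow (fun x => sin (x - z)) (S m)). apply is_derive_sin_shift.
    - unfold u1. simpl Init.Nat.pred. change (sin (x - z) ^ S m) with (sin (x - z) * sin (x - z) ^ m).
      simpl. ring. }
  split.
  - exists u1. split; [| split].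
    + apply trig_plus; apply trig_mult; auto using trig_sin_shift.
      apply trig_mult; [apply trig_const | apply trig_cos_shift].
    + unfold u1. rewrite Rminus_diag, sin_0, cos_0.
      replace (sign_val s * (INR (S m) * 1 * u z + 0 * u' z)) with (INR (S m) * (sign_val s * u z)) by ring.
      apply Rmult_lt_0_compat; auto. apply lt_0_INR. lia.
    + intros x. now apply is_derive_unique.
  - intros x. apply Derive_correct. eexists. apply D.
Qed.

Lemma zero_form_multiplicity (g : R -> R) (z : R) (m : nat) (s : pm) :
  zero_form g z m s -> multiplicity g z m.
Proof.
  revert g. induction m as [| m IH]; intros g H.
  - split; [intros; lia |]. destruct H as [u [_ [Hu Hg]]]. simpl. rewrite Hg. simpl.
    intros E. rewrite Rmult_1_l in E. rewrite E in Hu. lra.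
  - pose proof (zero_form_derive g z m s H) as [H' _]. destruct (IH _ H') as [I1 I2].
    assert (E : forall k, Derive_n g (S k) z = Derive_n (Derive g) k z).
    { intros k. replace (S k) with (k + 1)%nat by lia. symmetry. apply (Derive_n_comp g k 1). }
    split.
    + intros [| k] Hk.
      * destruct H as [u [_ [_ Hg]]]. simpl. rewrite Hg, Rminus_diag, sin_0. simpl. ring.
      * rewrite E. apply I1. lia.
    + now rewrite E.
Qed.

Lemma multiplicity_unique (g : R -> R) (z : R) (m n : nat) :
  multiplicity g z m -> multiplicity g z n -> m = n.
Proof.
  intros [H1 H2] [H3 H4]. destruct (Nat.lt_total m n) as [H | [H | H]]; auto.
  - exfalso. now apply H2, H3.
  - exfalso. now apply H4, H1.
Qed.

Lemma zero_form_zero (g : R -> R) (z : R) (m : nat) (s : pm) :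
  zero_form g z m s -> (0 < m)%nat -> g z = 0.
Proof.
  intros [u [_ [_ Hg]]] Hm. rewrite Hg, Rminus_diag, sin_0, pow_i by lia. ring.
Qed.

Lemma zero_form_opp (g : R -> R) (z : R) (m : nat) (s : pm) :
  zero_form g z m s -> zero_form (fun x => - g x) z m (opp_sign s).
Proof.
  intros [u [Tu [Hu Hg]]]. exists (fun x => -1 * u x). split; [apply trig_mult; auto; apply trig_const |].
  split.
  - destruct s; simpl in *; lra.
  - intros x. rewrite Hg. ring.
Qed.

Lemma sign_near (u : R -> R) (z : R) :
  continuous u z -> 0 < u z -> exists eps, 0 < eps /\ forall x, z - eps < x < z + eps -> 0 < u x.
Proof.
  intros Hc Hu. apply continuity_pt_filterlim in Hc.
  destruct (Hc (u z) Hu) as [eps [He H]]. exists eps. split; auto.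
  intros x Hx. destruct (Req_dec x z) as [-> | N]; auto.
  assert (K : Rabs (u x - u z) < u z).
  { apply (H x). split; [split; [exact I | auto] |]. apply Rabs_lt_between. simpl. unfold R_dist. lra. }
  apply Rabs_lt_between in K. lra.
Qed.

(** The cut at 1, which is less than [PI], makes the sign of [sin (x - z)] that of [x - z]. *)
Lemma sin_near (z eps x : R) :
  z - Rmin eps 1 < x < z + Rmin eps 1 ->
  z - eps < x < z + eps /\ (x < z -> sin (x - z) < 0) /\ (z < x -> 0 < sin (x - z)).
Proof.
  intros H. pose proof (Rmin_l eps 1). pose proof (Rmin_r eps 1). pose proof PI2_1. pose proof PI_RGT_0.
  split; [lra |]. split; intros K.
  - apply sin_lt_0_var; lra.
  - apply sin_gt_0; lra.
Qed.

Lemma even_pow_pos (m : nat) (x : R) : Nat.Even m -> x <> 0 -> 0 < x ^ m.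
Proof.
  intros [k ->] H. rewrite pow_mult. apply pow_lt, pow2_gt_0, H.
Qed.

Lemma even_pow_nonneg (m : nat) (x : R) : Nat.Even m -> 0 <= x ^ m.
Proof. intros [k ->]. rewrite pow_mult. apply pow_le, pow2_ge_0. Qed.

(** The derivative has the even exponent [2 * k] and a positive cofactor near [z], hence it is
    nonnegative there and can vanish only at [z]. *)
Lemma zero_form_increasing (g : R -> R) (z : R) (m : nat) :
  zero_form g z m Plus -> Nat.Odd m -> increasing_around g z.
Proof.
  intros H [k Hk]. subst m. rewrite Nat.add_1_r in H.
  destruct (zero_form_derive _ _ _ _ H) as [[u [Tu [Hu HD]]] Hd].
  simpl in Hu. rewrite Rmult_1_l in Hu.
  destruct (sign_near u z (trig_continuous u z Tu) Hu) as [eps [He Hp]].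
  assert (Ev : Nat.Even (2 * k)) by now exists k.
  assert (HE : 0 < Rmin eps 1) by (apply Rmin_pos; lra).
  assert (D0 : forall x, z - Rmin eps 1 < x < z + Rmin eps 1 -> 0 <= Derive g x).
  { intros x Hx. apply sin_near in Hx. rewrite HD. apply Rmult_le_pos.
    - now apply even_pow_nonneg.
    - left. now apply Hp. }
  assert (D1 : forall x, z - Rmin eps 1 < x < z + Rmin eps 1 -> x <> z -> 0 < Derive g x).
  { intros x Hx N. apply sin_near in Hx. rewrite HD. apply Rmult_lt_0_compat.
    - apply even_pow_pos; auto. destruct (Rlt_or_le x z); [apply Rlt_not_eq | apply Rgt_not_eq]; apply Hx; lra.
    - now apply Hp. }
  (* The midpoint keeps the strict inequality on a segment that avoids [z]; on the other half
     monotonicity is enough. *)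
  assert (L : forall t u, z - Rmin eps 1 < t -> t < u -> u <= z -> g t < g u).
  { intros t v H1 H2 H3. apply Rlt_le_trans with (g ((t + v) / 2)).
    - apply (increasing_derive g (Derive g)); [lra | auto | intros; apply D1; lra].
    - apply (nondecreasing_derive g (Derive g)); [lra | auto | intros; apply D0; lra]. }
  assert (R' : forall t u, z <= t -> t < u -> u < z + Rmin eps 1 -> g t < g u).
  { intros t v H1 H2 H3. apply Rle_lt_trans with (g ((t + v) / 2)).
    - apply (nondecreasing_derive g (Derive g)); [lra | auto | intros; apply D0; lra].
    - apply (increasing_derive g (Derive g)); [lra | auto | intros; apply D1; lra]. }
  exists (Rmin eps 1). split; auto. intros t v H1 H2 H3.
  destruct (Rle_dec v z); [apply L; lra |]. destruct (Rle_dec z t); [apply R'; lra |].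
  apply Rlt_trans with (g z); [apply L | apply R']; lra.
Qed.

Lemma zero_form_local_min (g : R -> R) (z : R) (m : nat) :
  zero_form g z m Plus -> Nat.Even m -> (0 < m)%nat -> local_min g z.
Proof.
  intros H Ev Hm. pose proof (zero_form_zero _ _ _ _ H Hm) as Z. destruct H as [u [Tu [Hu Hg]]].
  simpl in Hu. rewrite Rmult_1_l in Hu.
  destruct (sign_near u z (trig_continuous u z Tu) Hu) as [eps [He Hp]].
  exists eps. split; auto. intros t Ht. rewrite Z, Hg. apply Rmult_le_pos.
  - now apply even_pow_nonneg.
  - left. now apply Hp.
Qed.

Lemma zero_form_isolated (g : R -> R) (z : R) (m : nat) (s : pm) :
  zero_form g z m s -> (0 < m)%nat -> isolated_zero g z.
Proof.
  intros H Hm. split; [eapply zero_form_zero; eauto |]. destruct H as [u [Tu [Hu Hg]]].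
  destruct (sign_near (fun x => sign_val s * u x) z) as [eps [He Hp]]; auto.
  { apply (trig_continuous (fun x => sign_val s * u x)), trig_mult; auto. apply trig_const. }
  exists (Rmin eps 1). split; [apply Rmin_pos; lra |]. intros t [H0 Ht].
  assert (K : z - Rmin eps 1 < t < z + Rmin eps 1) by (apply Rabs_lt_between in Ht; lra).
  apply sin_near in K. destruct K as [K1 [K2 K3]]. specialize (Hp t K1).
  assert (t <> z) by (intros ->; rewrite Rminus_diag, Rabs_R0 in H0; lra).
  rewrite Hg. apply Rmult_integral_contrapositive_currified.
  - apply pow_nonzero. destruct (Rlt_or_le t z); [apply Rlt_not_eq | apply Rgt_not_eq]; auto. apply K3; lra.
  - intros E. rewrite E in Hp. lra.
Qed.

Definition symbol_of (m : nat) (s : pm) : symbol := (if Nat.odd m then One else Two, s).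

Lemma zero_form_symbol (g : R -> R) (z : R) (m : nat) (s : pm) :
  zero_form g z m s -> (0 < m)%nat -> symbol_at g z (symbol_of m s).
Proof.
  intros H Hm. pose proof (zero_form_zero _ _ _ _ H Hm) as Z.
  pose proof (zero_form_multiplicity _ _ _ _ H) as M.
  pose proof (zero_form_opp _ _ _ _ H) as H'.
  unfold symbol_of. destruct (Nat.odd m) eqn:E.
  - apply Nat.odd_spec in E. destruct s; split; try (split; auto; now exists m); eapply zero_form_increasing; eauto.
  - assert (E' : Nat.Even m) by (apply Nat.even_spec; now rewrite <- Nat.negb_odd, E).
    destruct s; split; try (split; auto; now exists m); eapply zero_form_local_min; eauto.
Qed.

(** This and the next two lemmas turn the kinds of zeros into boolean tests on the exponent, so that
    equilibria are counted by computation. *)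
Lemma zero_form_odd (g : R -> R) (z : R) (m : nat) (s : pm) :
  zero_form g z m s -> (0 < m)%nat -> (odd_zero g z <-> Nat.odd m = true).
Proof.
  intros H Hm. pose proof (zero_form_multiplicity _ _ _ _ H) as M. rewrite Nat.odd_spec. split.
  - intros [_ [n [Hn Mn]]]. now rewrite (multiplicity_unique _ _ _ _ M Mn).
  - intros Ho. split; [eapply zero_form_zero; eauto | now exists m].
Qed.

Lemma zero_form_simple (g : R -> R) (z : R) (m : nat) (s : pm) :
  zero_form g z m s -> (0 < m)%nat -> (simple_zero g z <-> Nat.eqb m 1 = true).
Proof.
  intros H Hm. pose proof (zero_form_multiplicity _ _ _ _ H) as M. rewrite Nat.eqb_eq. split.
  - intros [_ M1]. now apply (multiplicity_unique g z).
  - intros ->. split; [eapply zero_form_zero; eauto | auto].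
Qed.

Lemma zero_form_saddle_node (g : R -> R) (z : R) (m : nat) (s : pm) :
  zero_form g z m s -> (0 < m)%nat -> (saddle_node_zero g z <-> Nat.even m = true).
Proof.
  intros H Hm. pose proof (zero_form_multiplicity _ _ _ _ H) as M. rewrite Nat.even_spec. split.
  - intros [_ [_ [n [Hn Mn]]]]. now rewrite (multiplicity_unique _ _ _ _ M Mn).
  - intros He. split; [eapply zero_form_isolated; eauto |].
    split; [eapply zero_form_zero; eauto | now exists m].
Qed.

(** * Factored trigonometric polynomials *)

(** A list of pairs (zero, multiplicity). *)
Fixpoint zero_product (l : list (R * nat)) (x : R) : R :=
  match l with
  | [] => 1
  | (z, m) :: l => sin (x - z) ^ m * zero_product l x
  end.

Definition degree (l : list (R * nat)) : nat := list_sum (map snd l).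

Definition flip (s : pm) (n : nat) : pm := if Nat.even n then s else opp_sign s.

(** The sign of the leading coefficient at each zero, which is also the sign between
    it and the next one. *)
Fixpoint signs (s : pm) (l : list (R * nat)) : list pm :=
  match l with
  | [] => []
  | _ :: l => flip s (degree l) :: signs s l
  end.

Definition fst_lt (p q : R * nat) : Prop := fst p < fst q.

(** [s] is the sign of the cofactor without zeros, hence of [g] between the last zero and the first
    one translated by [PI], where all the sines are positive. *)
Record factored (g : R -> R) (s : pm) (l : list (R * nat)) : Prop := {
  fa_sorted : StronglySorted fst_lt l;
  fa_range : Forall (fun p : R * nat => 0 <= fst p < PI /\ (0 < snd p)%nat) l;
  fa_product : exists q, trig q /\ (forall x, 0 < sign_val s * q x) /\
    forall x, g x = q x * zero_product l x
}.

Lemma zero_product_app (l l' : list (R * nat)) (x : R) :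
  zero_product (l ++ l') x = zero_product l x * zero_product l' x.
Proof.
  induction l as [| [z m] l IH]; simpl; [ring | rewrite IH; ring].
Qed.

Lemma zero_product_trig (l : list (R * nat)) : trig (zero_product l).
Proof.
  induction l as [| [z m] l IH]; simpl; [apply trig_const |].
  apply (trig_mult (fun x => sin (x - z) ^ m)); auto. apply (trig_pow (fun x => sin (x - z))), trig_sin_shift.
Qed.

Lemma zero_product_pos (l : list (R * nat)) (x : R) :
  Forall (fun p : R * nat => 0 < sin (x - fst p)) l -> 0 < zero_product l x.
Proof.
  induction 1 as [| [z m] l H Hl IH]; simpl in *; [lra |].
  apply Rmult_lt_0_compat; auto. now apply pow_lt.
Qed.

Lemma zero_product_neg (l : list (R * nat)) (x : R) :
  Forall (fun p : R * nat => sin (x - fst p) < 0) l -> 0 < (-1) ^ degree l * zero_product l x.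
Proof.
  induction 1 as [| [z m] l H Hl IH]; [simpl; lra |].
  unfold degree in *. simpl in *. rewrite pow_add.
  replace ((-1) ^ m * (-1) ^ list_sum (map snd l) * (sin (x - z) ^ m * zero_product l x))
    with (((-1) ^ m * sin (x - z) ^ m) * ((-1) ^ list_sum (map snd l) * zero_product l x)) by ring.
  apply Rmult_lt_0_compat; auto. rewrite <- Rpow_mult_distr. apply pow_lt. lra.
Qed.

Lemma sign_flip (s : pm) (n : nat) : sign_val (flip s n) = sign_val s * (-1) ^ n.
Proof.
  unfold flip. destruct (Nat.even n) eqn:E.
  - apply Nat.even_spec in E. destruct E as [k ->]. rewrite pow_1_even. ring.
  - assert (O : Nat.odd n = true) by (now rewrite <- Nat.negb_even, E).
    apply Nat.odd_spec in O. destruct O as [k ->]. rewrite Nat.add_1_r, pow_1_odd. destruct s; simpl; ring.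
Qed.

Lemma zero_product_sign (s : pm) (q x : R) (l1 l2 : list (R * nat)) :
  0 < sign_val s * q ->
  Forall (fun p : R * nat => 0 < sin (x - fst p)) l1 -> Forall (fun p : R * nat => sin (x - fst p) < 0) l2 ->
  0 < sign_val (flip s (degree l2)) * (q * (zero_product l1 x * zero_product l2 x)).
Proof.
  intros Hq H1 H2. apply zero_product_pos in H1. apply zero_product_neg in H2. rewrite sign_flip.
  replace (sign_val s * (-1) ^ degree l2 * (q * (zero_product l1 x * zero_product l2 x)))
    with (sign_val s * q * (zero_product l1 x * ((-1) ^ degree l2 * zero_product l2 x))) by ring.
  apply Rmult_lt_0_compat; [exact Hq | apply Rmult_lt_0_compat; assumption].
Qed.

Lemma sorted_app (l1 l2 : list (R * nat)) (p : R * nat) :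
  StronglySorted fst_lt (l1 ++ p :: l2) -> Forall (fun q => fst q < fst p) l1 /\ Forall (fun q => fst p < fst q) l2.
Proof.
  induction l1 as [| a l1 IH]; simpl; intros H; apply StronglySorted_inv in H; destruct H as [H1 H2].
  - split; [constructor | exact H2].
  - destruct (IH H1) as [I1 I2]. split; auto. constructor; auto.
    apply Forall_app in H2. destruct H2 as [_ H2]. apply Forall_inv in H2. exact H2.
Qed.

Lemma factored_zero_form (g : R -> R) (s : pm) (l1 l2 : list (R * nat)) (z : R) (m : nat) :
  factored g s (l1 ++ (z, m) :: l2) -> zero_form g z m (flip s (degree l2)).
Proof.
  intros [Hs Hr [q [Tq [Hq Hg]]]].
  apply sorted_app in Hs. destruct Hs as [S1 S2]. apply Forall_app in Hr. destruct Hr as [R1 R2].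
  apply Forall_cons_iff in R2. destruct R2 as [Rz R2]. simpl in *.
  exists (fun x => q x * (zero_product l1 x * zero_product l2 x)). split; [| split].
  - repeat apply trig_mult; auto using zero_product_trig.
  - apply zero_product_sign; auto.
    + rewrite Forall_forall in *. intros p Hp. specialize (S1 p Hp). specialize (R1 p Hp).
      apply sin_gt_0; lra.
    + rewrite Forall_forall in *. intros p Hp. specialize (S2 p Hp). specialize (R2 p Hp).
      apply sin_lt_0_var; lra.
  - intros x. rewrite Hg, zero_product_app. simpl. ring.
Qed.

Lemma factored_zero_forms (g : R -> R) (s : pm) (l : list (R * nat)) :
  factored g s l -> Forall2 (fun p t => zero_form g (fst p) (snd p) t) l (signs s l).
Proof.
  intros H.
  assert (G : forall l2 l1, factored g s (l1 ++ l2) ->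
    Forall2 (fun p t => zero_form g (fst p) (snd p) t) l2 (signs s l2)).
  { induction l2 as [| [z m] l2 IH]; intros l1 H1; simpl; constructor.
    - eapply factored_zero_form, H1.
    - apply (IH (l1 ++ [(z, m)])). now rewrite <- app_assoc. }
  now apply (G l []).
Qed.

Lemma factored_zeros (g : R -> R) (s : pm) (l : list (R * nat)) (x : R) :
  factored g s l -> 0 <= x < PI -> (g x = 0 <-> In x (map fst l)).
Proof.
  intros [_ Hr [q [_ [Hq Hg]]]] Hx. rewrite Hg.
  assert (E : zero_product l x = 0 <-> In x (map fst l)).
  { clear Hg. induction Hr as [| [z m] l [Hz Hm] Hl IH]; simpl in *; [split; [lra | tauto] |].
    rewrite <- IH. split.
    - intros H. apply Rmult_integral in H. destruct H as [H | H]; auto. left.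
      destruct (Req_dec (sin (x - z)) 0) as [E | E]; [| now apply (pow_nonzero _ m) in E].
      destruct (Rtotal_order x z) as [K | [K | K]]; auto.
      + assert (sin (x - z) < 0) by (apply sin_lt_0_var; lra). lra.
      + assert (0 < sin (x - z)) by (apply sin_gt_0; lra). lra.
    - intros [-> | H]; [| rewrite H; ring]. rewrite Rminus_diag, sin_0, pow_i by auto. ring. }
  rewrite <- E. specialize (Hq x). split; [| intros ->; ring].
  intros H. apply Rmult_integral in H. destruct H as [H | H]; auto. rewrite H in Hq. lra.
Qed.

(** On the arc that follows a zero, the factors of the zeros up to it are positive and those of the
    later zeros negative. The last arc ends at [z1 + PI], a zero by periodicity. *)
Lemma factored_chain (g : R -> R) (s : pm) (z1 : R) (m1 : nat) (l : list (R * nat)) :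
  (forall x, g (x + PI) = g x) -> factored g s ((z1, m1) :: l) ->
  chain g z1 (signs s ((z1, m1) :: l)) (z1 + PI).
Proof.
  intros Hper H.
  (* Induction on the zeros still ahead, with those already passed in [l1]; the condition on [hd]
     remembers that the list begins with [z1]. *)
  assert (G : forall l2 l1 z m, factored g s (l1 ++ (z, m) :: l2) ->
    hd z1 (map fst (l1 ++ (z, m) :: l2)) = z1 -> chain g z (signs s ((z, m) :: l2)) (z1 + PI)).
  { induction l2 as [| [z' m'] l2 IH]; intros l1 z m Hf Hh.
    - pose proof (factored_zero_form _ _ _ _ _ _ Hf) as Zf. destruct Hf as [Hs Hr [q [Tq [Hq Hg]]]].
      assert (Hfirst : Forall (fun p => z1 <= fst p) (l1 ++ [(z, m)])).
      { destruct l1 as [| p l1]; simpl in *; apply StronglySorted_inv in Hs; destruct Hs as [_ Hs].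
        - rewrite Hh. constructor; [simpl; lra | constructor].
        - constructor; [lra |]. eapply Forall_impl; [| exact Hs]. intros r Hrr.
          unfold fst_lt in Hrr. lra. }
      assert (Hlast : Forall (fun p => fst p <= z) (l1 ++ [(z, m)])).
      { apply sorted_app in Hs. destruct Hs as [Hs _]. apply Forall_app. split.
        - eapply Forall_impl; [| exact Hs]. simpl. intros; lra.
        - constructor; [simpl; lra | constructor]. }
      assert (Hz : 0 <= z < PI /\ (0 < m)%nat) by (apply Forall_app in Hr; destruct Hr as [_ Hr]; now apply Forall_inv in Hr).
      assert (Hz1 : z1 <= z) by (apply Forall_app in Hfirst; destruct Hfirst as [_ Hr2]; now apply Forall_inv in Hr2).
      assert (Z1 : 0 <= z1 < PI /\ g z1 = 0).
      { destruct l1 as [| [z0 m0] l1]; simpl in Hh; subst z1.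
        - split; [tauto | eapply zero_form_zero; [exact Zf | tauto]].
        - apply Forall_inv in Hr. simpl in Hr. split; [tauto |].
          rewrite Hg. simpl. rewrite Rminus_diag, sin_0, pow_i by tauto. ring. }
      apply chain_cons with (z1 + PI).
      + lra.
      + eapply zero_form_zero; [exact Zf | tauto].
      + intros x Hx. rewrite Hg.
        pose proof (zero_product_sign s (q x) x (l1 ++ [(z, m)]) []) as K. simpl zero_product at 2 in K.
        rewrite Rmult_1_r in K. apply K; auto.
        rewrite Forall_forall in *. intros p Hp. specialize (Hfirst p Hp). specialize (Hlast p Hp).
        specialize (Hr p Hp). apply sin_gt_0; lra.
      + apply chain_nil. rewrite Hper. tauto.
    - assert (Hf' : factored g s ((l1 ++ [(z, m)]) ++ (z', m') :: l2)) by now rewrite <- app_assoc.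
      assert (Ch : chain g z' (signs s ((z', m') :: l2)) (z1 + PI)).
      { apply (IH (l1 ++ [(z, m)]) z' m'); auto. now rewrite <- app_assoc. }
      apply chain_cons with z'; auto.
      + destruct Hf' as [Hs _ _]. apply sorted_app in Hs. destruct Hs as [Hs _].
        apply Forall_app in Hs. destruct Hs as [_ Hs]. now apply Forall_inv in Hs.
      + pose proof (factored_zero_form _ _ _ _ _ _ Hf) as Zf. destruct Hf as [_ Hr _].
        apply Forall_app in Hr. destruct Hr as [_ Hr]. apply Forall_inv in Hr.
        eapply zero_form_zero; [exact Zf | tauto].
      + destruct Hf' as [Hs Hr [q [Tq [Hq Hg]]]]. intros x Hx. rewrite Hg, zero_product_app.
        pose proof (sorted_app _ _ _ Hs) as [S1 S2].
        rewrite <- app_assoc in Hs. simpl in Hs. pose proof (sorted_app _ _ _ Hs) as [S3 _].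
        apply Forall_app in Hr. destruct Hr as [R1 R2].
        apply zero_product_sign; auto.
        * rewrite Forall_forall in *. intros p Hp. specialize (R1 p Hp).
          assert (Rz' : 0 <= z' < PI) by (apply (R2 (z', m')); now left).
          assert (Hpz : fst p <= z).
          { apply in_app_or in Hp. destruct Hp as [Hp | [<- | []]]; [left; now apply S3 | simpl; lra]. }
          apply sin_gt_0; lra.
        * rewrite Forall_forall in *. intros p Hp. specialize (R2 p Hp).
          assert (Rz : 0 <= z < PI) by (apply (R1 (z, m)); apply in_or_app; right; now left).
          assert (Hpz : z' <= fst p).
          { destruct Hp as [<- | Hp]; [simpl; lra | left; now apply S2]. }
          apply sin_lt_0_var; lra. }
  apply (G l [] z1 m1); auto.
Qed.

(** A zero already present has its multiplicity raised. The clause about [y] is what the induction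
    needs to keep the list sorted. *)
Lemma factored_insert (l : list (R * nat)) (z : R) :
  0 <= z < PI -> StronglySorted fst_lt l -> Forall (fun p : R * nat => 0 <= fst p < PI /\ (0 < snd p)%nat) l ->
  exists l', StronglySorted fst_lt l' /\ Forall (fun p : R * nat => 0 <= fst p < PI /\ (0 < snd p)%nat) l' /\
    degree l' = S (degree l) /\ (forall y, y < z -> Forall (fun p : R * nat => y < fst p) l -> Forall (fun p : R * nat => y < fst p) l') /\
    forall x, zero_product l' x = sin (x - z) * zero_product l x.
Proof.
  intros Hz. induction l as [| [z0 m0] l IH]; intros Hs Hr.
  - exists [(z, 1%nat)]. split; [| split; [| split; [reflexivity | split; [auto |]]]].
    + repeat constructor.
    + constructor; [simpl; split; [lra | lia] | constructor].
    + intros x. simpl. ring.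
  - apply StronglySorted_inv in Hs. destruct Hs as [Hs H0]. apply Forall_cons_iff in Hr. destruct Hr as [Hr0 Hr].
    destruct (IH Hs Hr) as [l' [S' [R' [D' [B' P']]]]]. simpl in Hr0.
    destruct (Rtotal_order z z0) as [K | [K | K]].
    + exists ((z, 1%nat) :: (z0, m0) :: l). split; [| split; [| split; [reflexivity | split]]].
      * constructor; [now constructor |]. constructor; [exact K |].
        eapply Forall_impl; [| exact H0]. unfold fst_lt. simpl. intros; lra.
      * constructor; [simpl; split; [lra | lia] |]. now constructor.
      * intros y Hy Hl. now constructor.
      * intros x. simpl. ring.
    + subst z0. exists ((z, S m0) :: l). split; [| split; [| split; [reflexivity | split]]].
      * now constructor.
      * constructor; [simpl; split; [lra | lia] | auto].
      * intros y Hy Hl. apply Forall_cons_iff in Hl. constructor; tauto.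
      * intros x. simpl. ring.
    + exists ((z0, m0) :: l'). split; [| split; [| split; [| split]]].
      * constructor; auto. unfold fst_lt in *. simpl in *. apply B'; auto.
      * now constructor.
      * unfold degree in *. simpl. rewrite D'. lia.
      * intros y Hy Hl. apply Forall_cons_iff in Hl. constructor; [tauto |]. now apply B'.
      * intros x. simpl. rewrite P'. ring.
Qed.

(** Restrictions to the unit circle of forms of degree [d]. *)
Fixpoint trig_form (d : nat) (u : R -> R) : Prop :=
  match d with
  | O => exists c, forall x, u x = c
  | S d => exists v w, trig_form d v /\ trig_form d w /\ forall x, u x = cos x * v x + sin x * w x
  end.

Lemma trig_form_trig (d : nat) (u : R -> R) : trig_form d u -> trig u.
Proof.
  revert u. induction d as [| d IH]; simpl; intros u.
  - intros [c H]. apply (trig_ext (fun _ => c)); [auto | apply trig_const].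
  - intros [v [w [Hv [Hw H]]]]. apply (trig_ext (fun x => cos x * v x + sin x * w x)); auto.
    apply trig_plus; apply trig_mult; auto using trig_sin, trig_cos.
Qed.

Lemma trig_form_comb (d : nat) (a b : R) (u w : R -> R) :
  trig_form d u -> trig_form d w -> trig_form d (fun x => a * u x + b * w x).
Proof.
  revert u w. induction d as [| d IH]; simpl; intros u w.
  - intros [c H] [c' H']. exists (a * c + b * c'). intros x. now rewrite H, H'.
  - intros [u1 [u2 [H1 [H2 H]]]] [w1 [w2 [H1' [H2' H']]]].
    exists (fun x => a * u1 x + b * w1 x), (fun x => a * u2 x + b * w2 x).
    repeat split; auto. intros x. rewrite H, H'. ring.
Qed.

Lemma trig_form_parity (d : nat) (u : R -> R) (x : R) :
  trig_form d u -> u (x + PI) = (-1) ^ d * u x.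
Proof.
  revert u. induction d as [| d IH]; simpl; intros u.
  - intros [c H]. rewrite !H. ring.
  - intros [v [w [Hv [Hw H]]]]. rewrite !H, neg_cos, neg_sin, (IH v), (IH w) by assumption. ring.
Qed.

(** The factor theorem for binary forms: the cosine and sine of [x - a] are linear coordinates, and
    in them every monomial except [cos (x - a) ^ S d] contains the sine. *)
Lemma trig_form_divide (d : nat) (u : R -> R) (a : R) :
  trig_form (S d) u ->
  exists w, trig_form d w /\ forall x, u x = u a * cos (x - a) ^ S d + sin (x - a) * w x.
Proof.
  assert (Ec : forall x, cos x = cos a * cos (x - a) - sin a * sin (x - a)).
  { intros x. rewrite <- cos_plus. f_equal. ring. }
  assert (Es : forall x, sin x = sin a * cos (x - a) + cos a * sin (x - a)).
  { intros x. rewrite <- sin_plus. f_equal. ring. }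
  revert u. induction d as [| d IH]; intros u [v [w [Hv [Hw H]]]].
  - destruct Hv as [c Hc]. destruct Hw as [c' Hc'].
    exists (fun _ => - sin a * c + cos a * c'). split; [now eexists |].
    intros x. rewrite !H, !Hc, !Hc', (Ec x), (Es x). ring.
  - destruct (IH v Hv) as [v1 [Hv1 Ev]]. destruct (IH w Hw) as [w1 [Hw1 Ew]].
    pose (k := fun x => cos a * v1 x + sin a * w1 x).
    assert (Hk : trig_form d k) by now apply trig_form_comb.
    (* The quotient is [cos (x - a) * k x - sin a * v x + cos a * w x]; the unit and zero
       coefficients give it the shape produced by [trig_form_comb]. *)
    exists (fun x => 1 * (cos x * (cos a * k x + 0 * k x) + sin x * (sin a * k x + 0 * k x))
      + 1 * (- sin a * v x + cos a * w x)).
    split.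
    + apply (trig_form_comb (S d) 1 1 (fun x => cos x * (cos a * k x + 0 * k x) + sin x * (sin a * k x + 0 * k x))).
      * exists (fun x => cos a * k x + 0 * k x), (fun x => sin a * k x + 0 * k x).
        repeat split; now apply trig_form_comb.
      * now apply trig_form_comb.
    + intros x.
      replace (cos x * (cos a * k x + 0 * k x) + sin x * (sin a * k x + 0 * k x))
        with (cos (x - a) * k x) by (rewrite cos_minus; ring).
      rewrite (H x), (H a). unfold k.
      transitivity (cos (x - a) * (cos a * v x + sin a * w x) + sin (x - a) * (- sin a * v x + cos a * w x)).
      * rewrite (Ec x) at 1. rewrite (Es x) at 1. ring.
      * rewrite (Ev x) at 1. rewrite (Ew x) at 1.
        change (cos (x - a) ^ S (S d)) with (cos (x - a) * cos (x - a) ^ S d). ring.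
Qed.

Lemma constant_sign (u : R -> R) :
  (forall x, continuous u x) -> (forall x, u x <> 0) -> exists s, forall x, 0 < sign_val s * u x.
Proof.
  intros Hc H.
  assert (K : forall x y, u x < 0 -> 0 < u y -> False).
  { intros x y Hx Hy. destruct (Rle_dec x y) as [L | L].
    - destruct (intermediate_value u x y 0) as [z [_ Hz]]; auto; try lra. now apply (H z).
    - destruct (intermediate_value u y x 0) as [z [_ Hz]]; auto; try lra. now apply (H z). }
  destruct (Rtotal_order (u 0) 0) as [H0 | [H0 | H0]].
  - exists Minus. intros x. simpl. destruct (Rtotal_order (u x) 0) as [Hx | [Hx | Hx]]; [lra | now apply H in Hx |].
    exfalso. now apply (K 0 x).
  - now apply H in H0.
  - exists Plus. intros x. simpl. destruct (Rtotal_order (u x) 0) as [Hx | [Hx | Hx]]; [| now apply H in Hx | lra].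
    exfalso. now apply (K x 0).
Qed.

(** In odd degree [u PI = - u 0], so [u] vanishes within half a turn. *)
Lemma trig_form_odd_zero (d : nat) (u : R -> R) :
  trig_form d u -> Nat.Odd d -> exists z, 0 <= z < PI /\ u z = 0.
Proof.
  intros H [k ->]. pose proof PI_RGT_0.
  pose proof (trig_form_parity _ _ 0 H) as E. rewrite Nat.add_1_r, pow_1_odd, Rplus_0_l in E.
  assert (Cu : forall x, continuous u x) by (intros; eapply trig_continuous, trig_form_trig, H).
  destruct (intermediate_value u 0 PI 0) as [z [Hz Ez]]; auto; try lra.
  destruct (Req_dec z PI) as [-> | N].
  - exists 0. split; [lra |]. lra.
  - exists z. split; [lra | auto].
Qed.

Lemma trig_form_zero_range (d : nat) (u : R -> R) (x : R) :
  trig_form d u -> u x = 0 -> exists z, 0 <= z < PI /\ u z = 0.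
Proof.
  intros H Hx. pose proof PI_RGT_0. destruct (reduce_modulo 0 PI x) as [n Hn]; auto.
  exists (x + IZR n * PI). split; [lra |].
  (* The square has period [PI] whatever the parity of [d]. *)
  assert (P : forall y, (fun y => u y * u y) (y + PI) = (fun y => u y * u y) y).
  { intros y. rewrite !(trig_form_parity d u y) by auto.
    replace ((-1) ^ d * u y * ((-1) ^ d * u y)) with (((-1) * (-1)) ^ d * (u y * u y)) by (rewrite Rpow_mult_distr; ring).
    replace (-1 * -1) with 1 by ring. rewrite pow1. ring. }
  pose proof (periodic_multiple _ PI P n x) as E. simpl in E. rewrite Hx in E. nra.
Qed.

Lemma trig_form_split (d : nat) (u : R -> R) (z : R) :
  trig_form (S d) u -> u z = 0 -> exists w, trig_form d w /\ forall x, u x = sin (x - z) * w x.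
Proof.
  intros H Hz. destruct (trig_form_divide d u z H) as [w [Hw E]]. exists w. split; auto.
  intros x. rewrite E, Hz. ring.
Qed.

(** Zeros come in pairs: once one is split off, the quotient has odd degree and must vanish
    somewhere. This is why the degree of the list is even. *)
Lemma quadratic_trig_form_factored (u : R -> R) :
  trig_form 2 u -> (exists x, u x <> 0) ->
  exists s l q, trig q /\ (forall x, 0 < sign_val s * q x) /\
    StronglySorted fst_lt l /\ Forall (fun p : R * nat => 0 <= fst p < PI /\ (0 < snd p)%nat) l /\
    (degree l = 0 \/ degree l = 2)%nat /\ forall x, u x = q x * zero_product l x.
Proof.
  intros H [x0 Hx0].
  destruct (classic (exists x, u x = 0)) as [[x Hx] | N].
  - destruct (trig_form_zero_range 2 u x H Hx) as [z [Hz Ez]].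
    destruct (trig_form_split 1 u z H Ez) as [w [Hw Ew]].
    destruct (trig_form_odd_zero 1 w Hw) as [y [Hy Ey]]; [now exists 0%nat |].
    destruct (trig_form_split 0 w y Hw Ey) as [c [[k Hk] Ec]].
    assert (Nk : k <> 0) by (intros E; apply Hx0; rewrite Ew, Ec, Hk, E; ring).
    destruct (constant_sign (fun _ => k)) as [s Hs]; auto.
    { intros; apply continuous_const. }
    destruct (factored_insert [] y Hy) as [l1 [S1 [R1 [D1 [_ P1]]]]]; [constructor | constructor |].
    destruct (factored_insert l1 z Hz) as [l2 [S2 [R2 [D2 [_ P2]]]]]; auto.
    exists s, l2, (fun _ => k). repeat split; auto using trig_const.
    + right. rewrite D2, D1. reflexivity.
    + intros a. rewrite P2, P1, Ew, Ec, Hk. simpl. ring.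
  - destruct (constant_sign u) as [s Hs].
    { intros; eapply trig_continuous, trig_form_trig, H. }
    { intros x Hx. apply N. now exists x. }
    exists s, [], u. repeat split; auto.
    + eapply trig_form_trig, H.
    + constructor.
    + intros x. simpl. ring.
Qed.

Lemma quartic_trig_form_factored (g : R -> R) :
  trig_form 4 g -> (exists x, g x <> 0) ->
  exists s l, factored g s l /\ (degree l = 0 \/ degree l = 2 \/ degree l = 4)%nat.
Proof.
  intros H [x0 Hx0].
  destruct (classic (exists x, g x = 0)) as [[x Hx] | N].
  - destruct (trig_form_zero_range 4 g x H Hx) as [z [Hz Ez]].
    destruct (trig_form_split 3 g z H Ez) as [w [Hw Ew]].
    destruct (trig_form_odd_zero 3 w Hw) as [y [Hy Ey]]; [now exists 1%nat |].
    destruct (trig_form_split 2 w y Hw Ey) as [v [Hv Ev]].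
    destruct (quadratic_trig_form_factored v Hv) as [s [l [q [Tq [Hq [Sl [Rl [Dl El]]]]]]]].
    { exists x0. intros E. apply Hx0. rewrite Ew, Ev, E. ring. }
    destruct (factored_insert l y Hy) as [l1 [S1 [R1 [D1 [_ P1]]]]]; auto.
    destruct (factored_insert l1 z Hz) as [l2 [S2 [R2 [D2 [_ P2]]]]]; auto.
    exists s, l2. split.
    + split; auto. exists q. repeat split; auto. intros a. rewrite P2, P1, Ew, Ev, El. ring.
    + lia.
  - destruct (constant_sign g) as [s Hs].
    { intros; eapply trig_continuous, trig_form_trig, H. }
    { intros x Hx. apply N. now exists x. }
    exists s, []. split; [| now left]. split.
    + constructor.
    + constructor.
    + exists g. repeat split; auto; [eapply trig_form_trig, H |]. intros x. simpl. ring.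
Qed.

(** * Symbol sequences and numbers of equilibria *)

(** The signs depend only on the multiplicities. On explicit multiplicities these lists compute,
    which reduces the cases of the classification to [reflexivity]. *)
Fixpoint sign_list (s : pm) (ms : list nat) : list pm :=
  match ms with
  | [] => []
  | _ :: ms => flip s (list_sum ms) :: sign_list s ms
  end.

Fixpoint symbol_list (s : pm) (ms : list nat) : list symbol :=
  match ms with
  | [] => []
  | m :: ms => symbol_of m (flip s (list_sum ms)) :: symbol_list s ms
  end.

Lemma signs_sign_list (s : pm) (l : list (R * nat)) : signs s l = sign_list s (map snd l).
Proof. induction l as [| p l IH]; simpl; [reflexivity |]. now rewrite IH. Qed.

Lemma factored_symbol_sequence (G : plane -> R) (s : pm) (l : list (R * nat)) (t : list symbol) :
  factored (on_circle G) s l -> cyclic_eq (symbol_list s (map snd l)) t ->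
  symbol_sequence G (Finite_seq t).
Proof.
  intros H Ht. exists (map fst l), (symbol_list s (map snd l)). split; [| split; [| split]]; auto.
  - destruct H as [Hs _ _]. clear Ht. induction Hs as [| p l Hs IH Hp]; simpl; constructor.
    + exact IH.
    + rewrite Forall_map. exact Hp.
  - intros x. split.
    + intros Hx. apply in_map_iff in Hx as Hx'. destruct Hx' as [p [<- Hp]].
      pose proof (fa_range _ _ _ H) as Hr. rewrite Forall_forall in Hr. specialize (Hr p Hp).
      split; [lra |]. apply (factored_zeros _ _ _ _ H); [lra | exact Hx].
    + intros [Hx E]. now apply (factored_zeros _ _ _ _ H).
  - pose proof (factored_zero_forms _ _ _ H) as Z. pose proof (fa_range _ _ _ H) as Hr.
    clear H Ht. induction l as [| [z m] l IH]; simpl in *; constructor.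
    + inversion Z; subst. apply Forall_inv in Hr. simpl in *. eapply zero_form_symbol; [eassumption | tauto].
    + inversion Z; subst. apply IH; [assumption |]. now apply Forall_inv_tail in Hr.
Qed.

Lemma Derive_n_shift (g : R -> R) (P : R) :
  (forall x, g (x + P) = g x) -> forall n x, Derive_n g n (x + P) = Derive_n g n x.
Proof.
  intros H n x. rewrite <- Derive_n_comp_trans. apply Derive_n_ext. intros t. apply H.
Qed.

Lemma multiplicity_shift (g : R -> R) (P : R) :
  (forall x, g (x + P) = g x) -> forall n x, multiplicity g (x + P) n <-> multiplicity g x n.
Proof.
  intros H n x. unfold multiplicity. split; intros [H1 H2]; split.
  - intros k Hk. rewrite <- (Derive_n_shift g P H). auto.
  - now rewrite <- (Derive_n_shift g P H).
  - intros k Hk. rewrite (Derive_n_shift g P H). auto.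
  - now rewrite (Derive_n_shift g P H).
Qed.

(** The period is arbitrary because two are used: [PI] to pass from half a turn to the circle,
    [2 * PI] for the angle of a point. *)
Definition periodic_zero_predicate (P : (R -> R) -> R -> Prop) : Prop :=
  forall g p, (forall x, g (x + p) = g x) -> forall x, P g (x + p) <-> P g x.

Lemma odd_zero_periodic : periodic_zero_predicate odd_zero.
Proof.
  intros g p H x. unfold odd_zero. rewrite H. split; intros [H1 [m [H2 H3]]]; (split; [auto |]); exists m.
  - now rewrite <- (multiplicity_shift g p H).
  - now rewrite (multiplicity_shift g p H).
Qed.

Lemma simple_zero_periodic : periodic_zero_predicate simple_zero.
Proof.
  intros g p H x. unfold simple_zero. now rewrite H, (multiplicity_shift g p H).
Qed.

Lemma saddle_node_zero_periodic : periodic_zero_predicate saddle_node_zero.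
Proof.
  intros g p H x. unfold saddle_node_zero, isolated_zero, even_zero. rewrite H.
  split; intros [[H1 [e [He Hi]]] [_ [m [H2 H3]]]]; (split; [split; [auto |]; exists e; split; auto | split; auto; exists m; split; auto]).
  - intros t Ht. rewrite <- H. apply Hi. now replace (t + p - (x + p)) with (t - x) by ring.
  - now rewrite <- (multiplicity_shift g p H).
  - intros t Ht. replace t with (t - p + p) by ring. rewrite H. apply Hi.
    now replace (t - p - x) with (t - (x + p)) by ring.
  - now rewrite (multiplicity_shift g p H).
Qed.

Lemma has_card_iff {A : Type} (P Q : A -> Prop) (n : nat) :
  (forall x, P x <-> Q x) -> has_card P n -> has_card Q n.
Proof.
  intros H [l [H1 [H2 H3]]]. exists l. repeat split; auto.
  - intros Hx. now apply H, H3.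
  - intros Hx. now apply H3, H.
Qed.

Lemma sorted_fst_nodup (l : list (R * nat)) (b : R * nat -> bool) :
  StronglySorted fst_lt l -> NoDup (map fst (filter b l)).
Proof.
  induction 1 as [| p l Hs IH Hp]; simpl; [constructor |].
  destruct (b p); simpl; auto. constructor; auto.
  intros Hin. apply in_map_iff in Hin. destruct Hin as [q [E Hq]]. apply filter_In in Hq.
  rewrite Forall_forall in Hp. destruct Hq as [Hq _]. specialize (Hp q Hq). unfold fst_lt in Hp. lra.
Qed.

(** The zeros of the second half-turn are the translates by [PI] of those of the first, whence the
    factor 2. *)
Lemma factored_has_card (g : R -> R) (s : pm) (l : list (R * nat)) (P : R -> Prop) (b : nat -> bool) :
  (forall x, g (x + PI) = g x) -> factored g s l -> (forall x, P (x + PI) <-> P x) ->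
  (forall z m t, zero_form g z m t -> (0 < m)%nat -> (P z <-> b m = true)) ->
  has_card (fun x => (0 <= x < 2 * PI /\ g x = 0) /\ P x) (2 * length (filter b (map snd l))).
Proof.
  intros Hg H HP Hb. pose proof PI_RGT_0.
  pose (L := map fst (filter (fun p => b (snd p)) l)).
  assert (HL : forall x, 0 <= x < PI -> (In x L <-> g x = 0 /\ P x)).
  { intros x Hx. rewrite (factored_zeros g s l x H Hx). unfold L.
    pose proof (factored_zero_forms _ _ _ H) as Z. pose proof (fa_range _ _ _ H) as Hr.
    assert (Zp : forall p, In p l -> P (fst p) <-> b (snd p) = true).
    { clear -Z Hb Hr. revert Z Hr. generalize (signs s l). induction l as [| a l IH]; intros ts Z Hr p Hp; [destruct Hp |].
      inversion Z; subst. apply Forall_cons_iff in Hr. destruct Hp as [<- | Hp].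
      - eapply Hb; [eassumption | tauto].
      - eapply IH; [eassumption | tauto | exact Hp]. }
    rewrite !in_map_iff. split.
    - intros [p [<- Hp]]. apply filter_In in Hp. split; [exists p; tauto | apply Zp; tauto].
    - intros [[p [<- Hp]] Px]. exists p. split; auto. apply filter_In. split; auto. now apply Zp. }
  assert (HLr : forall x, In x L -> 0 <= x < PI).
  { intros x Hx. unfold L in Hx. apply in_map_iff in Hx. destruct Hx as [p [<- Hp]]. apply filter_In in Hp.
    pose proof (fa_range _ _ _ H) as Hr. rewrite Forall_forall in Hr. apply Hr. tauto. }
  assert (HN : NoDup L) by (apply sorted_fst_nodup, H).
  exists (L ++ map (fun x => x + PI) L). split; [| split].
  - apply NoDup_app; auto.
    + apply FinFun.Injective_map_NoDup; auto. intros x y E. lra.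
    + intros x Hx Hx'. apply HLr in Hx. apply in_map_iff in Hx'. destruct Hx' as [y [<- Hy]]. apply HLr in Hy. lra.
  - rewrite length_app, length_map. unfold L. rewrite length_map.
    assert (E : length (filter (fun p : R * nat => b (snd p)) l) = length (filter b (map snd l))).
    { clear. induction l as [| p l IH]; simpl; auto. destruct (b (snd p)); simpl; auto. }
    rewrite E. lia.
  - intros x. rewrite in_app_iff, in_map_iff. split.
    + intros [Hx | [y [<- Hy]]].
      * pose proof (HLr x Hx). apply HL in Hx; auto. split; [split; [lra | tauto] | tauto].
      * pose proof (HLr y Hy). apply HL in Hy; auto. rewrite Hg, HP. split; [split; [lra | tauto] | tauto].
    + intros [[Hx Ex] Px]. destruct (Rlt_or_le x PI) as [K | K].
      * left. apply HL; [lra | auto].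
      * right. exists (x - PI). split; [ring |]. apply HL; [lra |].
        rewrite <- Hg, <- HP. replace (x - PI + PI) with x by ring. auto.
Qed.

(** The linear part is radial and contributes nothing, and the cubic part divided by [r ^ 3] does
    not depend on [r]. *)
Lemma infinity_field_angular (lambda : R) (Q : plane -> plane) (x : R) :
  homogeneous_cubic Q -> infinity_field (system lambda Q) x = angular Q x.
Proof.
  intros HQ. unfold infinity_field.
  replace (Lim _ p_infty) with (Finite (angular Q x)); [reflexivity |].
  symmetry. apply is_lim_unique.
  apply (is_lim_ext_loc (fun _ => angular Q x)); [| apply is_lim_const].
  exists 1. intros r Hr. destruct (homogeneous_cubic_polar Q r x HQ) as [E1 E2].
  change (r * cos x, r * sin x) with (polar r x). unfold dot, perp, unit_vec, system; simpl fst; simpl snd.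
  rewrite E1, E2. pose proof (cos2_sin2 x) as E.
  transitivity (angular Q x * (cos x * cos x + sin x * sin x)); [rewrite E; ring |].
  unfold polar; simpl fst; simpl snd. field. lra.
Qed.

Lemma infinite_equilibrium_angular (lambda : R) (Q : plane -> plane) (x : R) :
  homogeneous_cubic Q ->
  (infinite_equilibrium (system lambda Q) x <-> 0 <= x < 2 * PI /\ angular Q x = 0).
Proof. intros HQ. unfold infinite_equilibrium. now rewrite infinity_field_angular. Qed.

Lemma portrait_at_infinity_factored (hyp : (R -> R) -> R -> Prop) (b : nat -> bool) (N : normal_form)
    (lambda : R) (Q : plane -> plane) (s : pm) (l : list (R * nat)) (h k : nat) :
  homogeneous_cubic Q -> (forall x, angular Q (x + PI) = angular Q x) -> factored (angular Q) s l ->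
  periodic_zero_predicate hyp ->
  (forall g z m t, zero_form g z m t -> (0 < m)%nat -> (hyp g z <-> b m = true)) ->
  nf_counts N = Some (h, k) -> h = (2 * length (filter b (map snd l)))%nat ->
  k = (2 * length (filter Nat.even (map snd l)))%nat -> (h + k = 2 * length (map snd l))%nat ->
  portrait_at_infinity hyp N lambda Q.
Proof.
  intros HQ Hper H Hp Hb HN Hh Hk Hhk. unfold portrait_at_infinity. rewrite HN.
  change (on_circle (LQ Q)) with (angular Q).
  assert (K : forall P b, (forall x, P (x + PI) <-> P x) ->
    (forall z m t, zero_form (angular Q) z m t -> (0 < m)%nat -> (P z <-> b m = true)) ->
    has_card (fun x => infinite_equilibrium (system lambda Q) x /\ P x) (2 * length (filter b (map snd l)))).
  { intros P b' HP HPb. eapply has_card_iff; [| apply (factored_has_card (angular Q) s l P b' Hper H HP HPb)].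
    intros x. simpl. now rewrite (infinite_equilibrium_angular lambda Q x HQ). }
  split; [| split].
  (* The total number is the count for the test that always succeeds. *)
  - rewrite Hhk. rewrite <- (forallb_filter_id (fun _ => true) (map snd l)) by (apply forallb_forall; auto).
    eapply has_card_iff; [| apply (K (fun _ => True)); tauto]. tauto.
  - rewrite Hh. apply K; [apply Hp, Hper | apply Hb].
  - rewrite Hk. apply K; [apply saddle_node_zero_periodic, Hper | apply zero_form_saddle_node].
Qed.

Lemma angular_period2 (Q : plane -> plane) (x : R) : angular Q (x + 2 * PI) = angular Q x.
Proof. unfold angular, on_circle, unit_vec. now rewrite cos_shift, sin_shift. Qed.

(** On both circles the equilibria are the zeros of the angular component; [pt] carries an angle to
    the point of the invariant circle on the same ray. *)
Lemma portrait_on_of_infinity (hyp : (R -> R) -> R -> Prop) (N : normal_form) (lambda : R)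
    (Q : plane -> plane) (rho2 : R -> R) (B : R -> R -> R) :
  0 < lambda -> homogeneous_cubic Q -> polar_flow lambda (radial Q) (angular Q) rho2 B ->
  periodic_zero_predicate hyp ->
  portrait_at_infinity hyp N lambda Q -> portrait_on hyp N lambda Q (circle rho2).
Proof.
  intros Hl HQ HB Hp. unfold portrait_at_infinity, portrait_on.
  change (on_circle (LQ Q)) with (angular Q).
  pose (pt := fun x => polar (sqrt (rho2 x)) x).
  assert (P0 : forall x, 0 < sqrt (rho2 x)) by (intros; apply sqrt_lt_R0; eapply rho2_pos, HB).
  assert (K : forall P n, (forall x, P (x + 2 * PI) <-> P x) ->
    has_card (fun x => infinite_equilibrium (system lambda Q) x /\ P x) n ->
    has_card (fun X => equilibrium_on (system lambda Q) (circle rho2) X /\ exists x, has_angle X x /\ P x) n).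
  { intros P n HP [L [H1 [H2 H3]]].
    assert (H3' : forall x, In x L <-> (0 <= x < 2 * PI /\ angular Q x = 0) /\ P x).
    { intros x. rewrite H3. now rewrite (infinite_equilibrium_angular lambda Q x HQ). }
    exists (map pt L). split; [| split].
    - clear H2 H3. assert (Hin : forall x y, In x L -> In y L -> pt x = pt y -> x = y).
      { intros x y Hx Hy E. apply H3' in Hx. apply H3' in Hy. unfold pt in E.
        assert (E' : sqrt (rho2 x) = sqrt (rho2 y)).
        { apply (polar_radius_unique _ _ x y); auto; left; apply P0. }
        rewrite E' in E. unfold polar in E. injection E as E1 E2. specialize (P0 y).
        apply unit_vec_injective; try tauto; eapply Rmult_eq_reg_l; try eassumption; lra. }
      clear H3'. induction H1 as [| x L Hx HL IH]; simpl; constructor.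
      + intros Hc. apply in_map_iff in Hc. destruct Hc as [y [E Hy]].
        apply Hx. rewrite <- (Hin y x); [exact Hy | now right | now left | exact E].
      + apply IH. intros; apply Hin; auto; now right.
    - now rewrite length_map.
    - intros X. rewrite in_map_iff, (equilibrium_on_circle lambda Q rho2 B X Hl HQ HB). split.
      + intros [x [<- Hx]]. apply H3' in Hx. split.
        * exists x. repeat split; try tauto; lra.
        * exists x. split; [| tauto]. exists (sqrt (rho2 x)). split; [apply P0 | reflexivity].
      + intros [[x [Hx [Gx EX]]] [y [[r [Hr EX']] Py]]]. exists x. split; [now rewrite EX |].
        apply H3'. split; [tauto |].
        assert (Er : sqrt (rho2 x) = r).
        { apply (polar_radius_unique _ _ x y); [left; apply P0 | lra |]. rewrite <- EX. exact EX'. }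
        rewrite EX, Er in EX'. apply polar_angle in EX'; auto. destruct EX' as [k ->].
        assert (PP : forall n x, P (x + IZR n * (2 * PI)) <-> P x).
        (* Seen as a function with values in propositions, [P] is periodic, and [periodic_multiple]
           applies to it. *)
        { intros n' x'. assert (Q' : P (x' + IZR n' * (2 * PI)) = P x').
          { apply (periodic_multiple P). intros z. apply propositional_extensionality, HP. }
          now rewrite Q'. }
        now apply PP in Py. }
  destruct (nf_counts N) as [[h k] |].
  - intros [H1 [H2 H3]]. split; [| split].
    + eapply has_card_iff; [| apply (K (fun _ => True) (h + k)%nat); [tauto |]].
      * intros X. split; [tauto |]. intros HE. split; auto.
        apply (equilibrium_on_circle lambda Q rho2 B X Hl HQ HB) in HE. destruct HE as [x [_ [_ EX]]].
        exists x. split; auto. exists (sqrt (rho2 x)). split; [apply P0 | exact EX].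
      * eapply has_card_iff; [| exact H1]. tauto.
    + apply (K (hyp (angular Q))); auto. intros x. apply Hp, angular_period2.
    + apply (K (saddle_node_zero (angular Q))); auto. intros x. apply saddle_node_zero_periodic, angular_period2.
  - intros H X HX. destruct (circle_angle _ _ _ _ _ _ HB HX) as [x [Hx EX]].
    apply (equilibrium_on_circle lambda Q rho2 B X Hl HQ HB). exists x. split; [auto |]. split; auto.
    apply (infinite_equilibrium_angular lambda Q x HQ). auto.
Qed.

(** * Rotation and reflection of chains *)

Lemma chain_app (g : R -> R) (a b c : R) (l l' : list pm) :
  chain g a l b -> chain g b l' c -> chain g a (l ++ l') c.
Proof.
  induction 1 as [a H | a m b s l Ham Ha Hs Hc IH]; simpl; auto.
  intros H'. eapply chain_cons; eauto.
Qed.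

Lemma chain_split (g : R -> R) (a c : R) (l l' : list pm) :
  chain g a (l ++ l') c -> exists b, chain g a l b /\ chain g b l' c.
Proof.
  revert a. induction l as [| s l IH]; simpl; intros a H.
  - exists a. split; auto. constructor. now apply (chain_ends g a c l').
  - inversion H as [| a0 m c0 s0 l0 Ham Ha Hs Hc]; subst. destruct (IH _ Hc) as [b [K1 K2]]. exists b. split; auto.
    eapply chain_cons; eauto.
Qed.

Lemma chain_shift (g : R -> R) (a b p : R) (l : list pm) :
  (forall x, g (x + p) = g x) -> chain g a l b -> chain g (a + p) l (b + p).
Proof.
  intros Hp. induction 1 as [a H | a m b s l Ham Ha Hs Hc IH].
  - constructor. now rewrite Hp.
  - apply chain_cons with (m + p); auto; try lra.
    + now rewrite Hp.
    + intros x Hx. replace x with (x - p + p) by ring. rewrite Hp. apply Hs. lra.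
Qed.

(** The first part of the chain, translated by [PI], is put after the second: a change of the zero
    at which half a turn begins. *)
Lemma chain_rotate (g : R -> R) (a : R) (l l' : list pm) :
  (forall x, g (x + PI) = g x) -> chain g a (l ++ l') (a + PI) ->
  exists b, chain g b (l' ++ l) (b + PI).
Proof.
  intros Hp H. destruct (chain_split _ _ _ _ _ H) as [b [H1 H2]]. exists b.
  apply (chain_app g b (a + PI)); auto. now apply chain_shift.
Qed.

(** The map [x -> - x] reverses the order of the arcs and the direction of motion on each of
    them. *)
Lemma chain_reflect (g : R -> R) (a b : R) (l : list pm) :
  chain g a l b -> chain (fun x => - g (- x)) (- b) (rev (map opp_sign l)) (- a).
Proof.
  induction 1 as [a H | a m b s l Ham Ha Hs Hc IH]; simpl.
  - constructor. rewrite Ropp_involutive. lra.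
  - apply (chain_app _ _ (- m)); auto.
    apply chain_cons with (- a); try lra.
    + rewrite Ropp_involutive. apply chain_ends in Hc. lra.
    + intros x Hx. specialize (Hs (- x) ltac:(lra)). destruct s; simpl in *; lra.
    + constructor. rewrite Ropp_involutive. lra.
Qed.

(** * The normal forms *)

Lemma cubic_form_homogeneous (G : plane -> R) (a b c d : R) :
  (forall x y, G (x, y) = cubic_form a b c d x y) -> homogeneous_poly 3 G.
Proof.
  intros H. exists (fun i => nth i [a; b; c; d] 0). intros x y. rewrite H. unfold cubic_form. simpl. ring.
Qed.

Lemma nf_homogeneous (N : normal_form) : homogeneous_cubic (nf_field N).
Proof.
  destruct N as [mu | alpha mu | mu | alpha | alpha | |]; split;
    [apply (cubic_form_homogeneous _ (3 * mu) 0 (3 * mu) (-1))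
    |apply (cubic_form_homogeneous _ 1 (3 * mu) (6 * mu) (3 * mu))
    |apply (cubic_form_homogeneous _ (- K_of mu) 0 (- K_of mu) (- sign_val alpha))
    |apply (cubic_form_homogeneous _ (sign_val alpha) (- K_of mu) (sign_val alpha * (6 * mu)) (- K_of mu))
    |apply (cubic_form_homogeneous _ (- K_of mu) 0 (- K_of mu) 1)
    |apply (cubic_form_homogeneous _ 1 (- K_of mu) (6 * mu) (- K_of mu))
    |apply (cubic_form_homogeneous _ (-4) (- sign_val alpha * 6) (-4) (- sign_val alpha))
    |apply (cubic_form_homogeneous _ 0 (-4) 0 (-4))
    |apply (cubic_form_homogeneous _ (-1) (- sign_val alpha * 6) (-1) (sign_val alpha))
    |apply (cubic_form_homogeneous _ 0 (-1) 0 (-1))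
    |apply (cubic_form_homogeneous _ (-1) 0 (-1) 0)
    |apply (cubic_form_homogeneous _ 0 (-1) 6 (-1))
    |apply (cubic_form_homogeneous _ (-1) 0 (-1) 0)
    |apply (cubic_form_homogeneous _ 0 (-1) 0 (-1))];
    intros x y; unfold cubic_form; simpl; ring.
Qed.

Lemma nf_LQ_correct (N : normal_form) (X : plane) : LQ (nf_field N) X = nf_LQ N X.
Proof.
  destruct X as [x y]. unfold LQ, dot, perp. destruct N; simpl; ring.
Qed.

Lemma nf_angular (N : normal_form) (x : R) : angular (nf_field N) x = nf_LQ N (cos x, sin x).
Proof. apply nf_LQ_correct. Qed.

Lemma cubic_trig_form (a b c d : R) : trig_form 3 (fun x => cubic_form a b c d (cos x) (sin x)).
Proof.
  exists (fun x => cos x * (cos x * a + sin x * b) + sin x * (cos x * 0 + sin x * c)),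
    (fun x => cos x * (cos x * 0 + sin x * 0) + sin x * (cos x * 0 + sin x * d)).
  assert (T1 : forall p q, trig_form 1 (fun x => cos x * p + sin x * q)).
  { intros p q. exists (fun _ => p), (fun _ => q). repeat split; simpl; eauto. }
  split; [| split].
  - eexists _, _. split; [apply (T1 a b) | split; [apply (T1 0 c) | reflexivity]].
  - eexists _, _. split; [apply (T1 0 0) | split; [apply (T1 0 d) | reflexivity]].
  - intros x. unfold cubic_form. ring.
Qed.

Lemma radial_angular_trig_form (Q : plane -> plane) :
  homogeneous_cubic Q -> trig_form 4 (radial Q) /\ trig_form 4 (angular Q).
Proof.
  intros [H1 H2].
  apply homogeneous_cubic_form in H1. destruct H1 as [a [b [c [d H1]]]].
  apply homogeneous_cubic_form in H2. destruct H2 as [a' [b' [c' [d' H2]]]].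
  pose proof (cubic_trig_form a b c d) as T1. pose proof (cubic_trig_form a' b' c' d') as T2.
  split.
  - exists (fun x => cubic_form a b c d (cos x) (sin x)), (fun x => cubic_form a' b' c' d' (cos x) (sin x)).
    split; [exact T1 | split; [exact T2 |]]. intros x. unfold radial, on_circle, dot, unit_vec. now rewrite H1, H2.
  - exists (fun x => cubic_form a' b' c' d' (cos x) (sin x)),
      (fun x => -1 * cubic_form a b c d (cos x) (sin x) + 0 * cubic_form a b c d (cos x) (sin x)).
    split; [exact T2 | split; [now apply trig_form_comb |]]. intros x.
    unfold angular, LQ, on_circle, dot, perp, unit_vec. simpl fst; simpl snd. rewrite H1, H2. ring.
Qed.

Lemma radial_period (Q : plane -> plane) (x : R) : homogeneous_cubic Q -> radial Q (x + PI) = radial Q x.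
Proof.
  intros H. rewrite (trig_form_parity 4) by now apply radial_angular_trig_form. ring.
Qed.

Lemma angular_period (Q : plane -> plane) (x : R) : homogeneous_cubic Q -> angular Q (x + PI) = angular Q x.
Proof.
  intros H. rewrite (trig_form_parity 4) by now apply radial_angular_trig_form. ring.
Qed.

Lemma radial_trig (Q : plane -> plane) : homogeneous_cubic Q -> trig (radial Q).
Proof. intros H. apply (trig_form_trig 4). now apply radial_angular_trig_form. Qed.

Lemma angular_trig (Q : plane -> plane) : homogeneous_cubic Q -> trig (angular Q).
Proof. intros H. apply (trig_form_trig 4). now apply radial_angular_trig_form. Qed.

Lemma contracting_polar_flow (lambda : R) (Q : plane -> plane) :
  0 < lambda -> homogeneous_cubic Q -> contracting Q ->
  exists rho2 B, polar_flow lambda (radial Q) (angular Q) rho2 B.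
Proof.
  intros Hl HQ HC. pose proof PI_RGT_0.
  assert (Hneg : forall x, radial Q x < 0).
  { intros x. apply HC. unfold dot, unit_vec. simpl. apply cos2_sin2. }
  destruct (continuity_ab_maj (radial Q) 0 PI) as [m [Hm _]]; [lra | |].
  { intros c _. apply continuity_pt_filterlim, trig_continuous, radial_trig, HQ. }
  apply (polar_flow_exists lambda (radial Q) (angular Q) (- radial Q m)); auto.
  - specialize (Hneg m). lra.
  - now apply trig_bounded_lipschitz, radial_trig.
  - now apply trig_bounded_lipschitz, angular_trig.
  - intros x. now apply radial_period.
  - intros x. now apply angular_period.
  - intros x. destruct (reduce_modulo 0 PI x) as [n Hn]; [lra |].
    rewrite <- (periodic_multiple (radial Q) PI (fun y => radial_period Q y HQ) n x).
    specialize (Hm (x + IZR n * PI) ltac:(lra)). lra.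
Qed.

Lemma K_of_half (mu : R) : (3 * mu) ^ 2 <= 1 / 2 -> K_of mu = 1 / 2.
Proof. intros H. unfold K_of. now apply Rmax_right. Qed.

(** The contraction of several reference forms is proved by writing a multiple of [- dot X (Q X)] in
    this way, with [A] and [B] positive definite quadratic forms that share the term in
    [x ^ 2 * y ^ 2]. *)
Lemma pos_def_sum (x y A B : R) :
  x * x + y * y = 1 -> (x <> 0 -> 0 < A) -> (y <> 0 -> 0 < B) -> 0 < x * x * A + y * y * B.
Proof.
  intros H HA HB.
  assert (PX : x <> 0 -> 0 < x * x * A) by (intros N; apply Rmult_lt_0_compat; [nra | auto]).
  assert (PY : y <> 0 -> 0 < y * y * B) by (intros N; apply Rmult_lt_0_compat; [nra | auto]).
  destruct (Req_dec x 0) as [Ex | Nx]; destruct (Req_dec y 0) as [Ey | Ny].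
  - rewrite Ex, Ey in H. lra.
  - specialize (PY Ny). rewrite Ex. lra.
  - specialize (PX Nx). rewrite Ey. lra.
  - specialize (PX Nx). specialize (PY Ny). lra.
Qed.

Lemma quadratic_pos (a b c x y : R) :
  0 < a -> b * b < 4 * a * c -> x <> 0 \/ y <> 0 -> 0 < a * (x * x) + b * (x * y) + c * (y * y).
Proof.
  intros Ha Hd Hxy. apply Rmult_lt_reg_l with (4 * a); [lra |]. rewrite Rmult_0_r.
  replace (4 * a * (a * (x * x) + b * (x * y) + c * (y * y)))
    with ((2 * a * x + b * y) ^ 2 + (4 * a * c - b * b) * (y * y)) by ring.
  pose proof (pow2_ge_0 (2 * a * x + b * y)).
  destruct (Req_dec y 0) as [-> | Ny].
  - destruct Hxy as [Nx | Nx]; [| lra].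
    assert (0 < (2 * a * x + b * 0) ^ 2); [| lra]. apply pow2_gt_0.
    rewrite Rmult_0_r, Rplus_0_r. apply Rmult_integral_contrapositive_currified; lra.
  - assert (0 < (4 * a * c - b * b) * (y * y)) by (apply Rmult_lt_0_compat; nra). lra.
Qed.

Lemma nf_I_contracting : contracting (nf_field (NF_I (-1))).
Proof.
  intros [x y]. unfold dot. simpl. intros H.
  pose proof (pos_def_sum x y (3 * (x * x) + -1 * (x * y) + 1 * (y * y)) (5 * (x * x) + 7 * (x * y) + 3 * (y * y)) H) as K.
  assert (0 < x * x * (3 * (x * x) + -1 * (x * y) + 1 * (y * y)) + y * y * (5 * (x * x) + 7 * (x * y) + 3 * (y * y)))
    by (apply K; intros N; apply quadratic_pos; (lra || auto)).
  lra.
Qed.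

Lemma nf_II_contracting (alpha : pm) : contracting (nf_field (NF_II alpha 0)).
Proof.
  intros [x y]. unfold dot, nf_field. rewrite K_of_half by lra. simpl fst; simpl snd. intros H.
  assert (E : forall s, s = 1 \/ s = -1 -> x * (- (1 / 2) * x * (x ^ 2 + y ^ 2) - s * y ^ 3) +
    y * (- (1 / 2) * y * (x ^ 2 + y ^ 2) + s * x * (x ^ 2 + 6 * 0 * y ^ 2)) < 0).
  { intros s Hs.
    replace (x * (- (1 / 2) * x * (x ^ 2 + y ^ 2) - s * y ^ 3) +
      y * (- (1 / 2) * y * (x ^ 2 + y ^ 2) + s * x * (x ^ 2 + 6 * 0 * y ^ 2)))
      with (- (1 / 2) * (x * x + y * y) ^ 2 + s * (x * y) * (x * x - y * y)) by ring.
    (* On the unit circle these are [cos (2 theta)] and [sin (2 theta) / 2], so that their product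
       is at most 1/4 in absolute value. *)
    set (p := x * x - y * y). set (q := x * y).
    assert (Epq : p * p + 4 * (q * q) = 1).
    { unfold p, q. transitivity ((x * x + y * y) * (x * x + y * y)); [ring | rewrite H; ring]. }
    rewrite H. destruct Hs as [-> | ->]; nra. }
  apply E. destruct alpha; simpl; auto.
Qed.

(** At [mu = 0] the radial part would be [- (x ^ 2 + y ^ 2) * (x - y) ^ 2 / 2], which vanishes on
    the diagonal; hence a slightly negative parameter. The form split in the proof is twice
    [- dot X (Q X)]. *)
Lemma nf_III_contracting : contracting (nf_field (NF_III (- (1 / 12)))).
Proof.
  intros [x y]. unfold dot, nf_field. rewrite K_of_half by lra. simpl fst; simpl snd. intros H.
  pose proof (pos_def_sum x y (1 * (x * x) + -2 * (x * y) + 3 / 2 * (y * y)) (1 / 2 * (x * x) + -1 * (x * y) + 1 * (y * y)) H) as K.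
  assert (0 < x * x * (1 * (x * x) + -2 * (x * y) + 3 / 2 * (y * y)) + y * y * (1 / 2 * (x * x) + -1 * (x * y) + 1 * (y * y)))
    by (apply K; intros N; apply quadratic_pos; (lra || auto)).
  lra.
Qed.

Lemma nf_IV_contracting (alpha : pm) : contracting (nf_field (NF_IV alpha)).
Proof.
  intros [x y]. unfold dot. simpl. intros H.
  assert (K : forall s, s = 1 \/ s = -1 ->
    0 < x * x * (4 * (x * x) + 6 * s * (x * y) + 4 * (y * y)) + y * y * (4 * (x * x) + s * (x * y) + 4 * (y * y))).
  { intros s Hs. apply pos_def_sum; auto; intros N; apply quadratic_pos; auto; destruct Hs as [-> | ->]; lra. }
  destruct alpha; simpl.
  - specialize (K 1 ltac:(auto)). lra.
  - specialize (K (-1) ltac:(auto)). lra.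
Qed.

Lemma nf_VII_contracting : contracting (nf_field NF_VII).
Proof.
  intros [x y]. unfold dot. simpl. intros H.
  replace (x * (- x * (x * (x * 1) + y * (y * 1))) + y * (- y * (x * (x * 1) + y * (y * 1))))
    with (- (x * x + y * y) ^ 2) by ring. rewrite H. lra.
Qed.

(** From the square of [Rabs t - 1 / 4] one gets [8 * Rabs t <= 16 * t ^ 2 + 1]; with a coefficient
    at most 6 the remainder is at most 6/8, which is less than 1. *)
Lemma modulation_bound (t q c : R) :
  -1 <= t <= 1 -> 0 <= q <= 6 -> -1 <= c <= 1 ->
  Rabs (c * t * q / (16 * (t * t) + 1)) <= 3 / 4.
Proof.
  intros Ht Hq Hc. assert (P : 0 < 16 * (t * t) + 1) by nra.
  unfold Rdiv at 1. rewrite Rabs_mult, Rabs_inv, (Rabs_pos_eq (16 * (t * t) + 1)) by lra.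
  apply Rmult_le_reg_r with (16 * (t * t) + 1); auto.
  rewrite Rmult_assoc, Rinv_l, Rmult_1_r by lra.
  rewrite !Rabs_mult, (Rabs_pos_eq q) by lra.
  assert (Rabs c <= 1) by (apply Rabs_le; lra). pose proof (Rabs_pos c). pose proof (Rabs_pos t).
  assert (Rabs c * Rabs t <= Rabs t) by nra.
  assert (E : t * t = Rabs t * Rabs t) by (rewrite <- Rabs_mult, Rabs_pos_eq; nra).
  rewrite E. pose proof (Rle_0_sqr (Rabs t - 1 / 4)) as S. unfold Rsqr in S. nra.
Qed.

Lemma nf_V_polar_flow (lambda : R) (alpha : pm) :
  0 < lambda -> exists rho2 B, polar_flow lambda (radial (nf_field (NF_V alpha))) (angular (nf_field (NF_V alpha))) rho2 B.
Proof.
  intros Hl. pose proof (nf_homogeneous (NF_V alpha)) as HQ.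
  (* Here [r ^ 2 * m] is [y ^ 2 + r ^ 2 / 16]. As [g] has the factor [sin ^ 2], the weight [sin ^ 2]
     alone would cancel the shear in the radial part; adding 1/16 keeps [m] positive and leaves a
     remainder with denominator [16 * sin ^ 2 + 1]. *)
  apply (polar_flow_exists_modulated lambda _ _ (fun x => sin x * sin x + 1 / 16)
    (fun x => 2 * (sin x * cos x)) (1 / 4) (1 / 16)); try lra.
  - now apply trig_bounded_lipschitz, radial_trig.
  - now apply trig_bounded_lipschitz, angular_trig.
  - apply trig_bounded_lipschitz, trig_plus; [apply trig_mult; apply trig_sin | apply trig_const].
  - apply trig_bounded_lipschitz. apply (trig_mult (fun _ => 2)); [apply trig_const |].
    apply trig_mult; [apply trig_sin | apply trig_cos].
  - intros x. auto_derive; [trivial | ring].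
  - intros x. nra.
  - intros x. now apply radial_period.
  - intros x. now apply angular_period.
  - intros x. rewrite neg_sin. ring.
  - intros x. rewrite neg_sin, neg_cos. ring.
  - intros x. rewrite nf_angular. unfold radial, on_circle, dot, unit_vec. cbn [fst snd]. unfold nf_LQ, nf_field.
    cbn [fst snd]. pose proof (cos2_sin2 x) as E. pose proof (SIN_bound x). pose proof (COS_bound x).
    set (c := cos x) in *. set (t := sin x) in *.
    assert (P : 0 < 16 * (t * t) + 1) by nra.
    replace (c * (- c * (c ^ 2 + t ^ 2) - sign_val alpha * t * (6 * c ^ 2 - t ^ 2)) + t * (- t * (c ^ 2 + t ^ 2)) +
      sign_val alpha * (6 * c ^ 2 * t ^ 2 - t ^ 4) * (2 * (t * c) / (2 * (t * t + 1 / 16))))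
      with (- (c * c + t * t) ^ 2 - sign_val alpha * ((6 * (c * c) - t * t) * (c * t / (16 * (t * t) + 1)))) by (field; lra).
    assert (K : Rabs ((6 * (c * c) - t * t) * (c * t / (16 * (t * t) + 1))) <= 3 / 4).
    { rewrite Rabs_mult.
      assert (A1 : Rabs (6 * (c * c) - t * t) <= 6) by (apply Rabs_le; nra).
      pose proof (modulation_bound t 6 c ltac:(lra) ltac:(lra) ltac:(lra)) as M.
      replace (c * t * 6 / (16 * (t * t) + 1)) with (6 * (c * t / (16 * (t * t) + 1))) in M by (field; lra).
      rewrite Rabs_mult, (Rabs_pos_eq 6) in M by lra.
      pose proof (Rabs_pos (c * t / (16 * (t * t) + 1))). nra. }
    apply Rabs_le_between in K. rewrite E. destruct alpha; simpl; lra.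
Qed.

Lemma nf_VI_polar_flow (lambda : R) :
  0 < lambda -> exists rho2 B, polar_flow lambda (radial (nf_field NF_VI)) (angular (nf_field NF_VI)) rho2 B.
Proof.
  intros Hl. pose proof (nf_homogeneous NF_VI) as HQ.
  (* The same device with [x] in place of [y], for the shear [6 * x * y ^ 2] in the second component
     and the factor [cos ^ 2] of [g]. *)
  apply (polar_flow_exists_modulated lambda _ _ (fun x => cos x * cos x + 1 / 16)
    (fun x => - 2 * (sin x * cos x)) (1 / 4) (1 / 16)); try lra.
  - now apply trig_bounded_lipschitz, radial_trig.
  - now apply trig_bounded_lipschitz, angular_trig.
  - apply trig_bounded_lipschitz, trig_plus; [apply trig_mult; apply trig_cos | apply trig_const].
  - apply trig_bounded_lipschitz. apply (trig_mult (fun _ => - 2)); [apply trig_const |].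
    apply trig_mult; [apply trig_sin | apply trig_cos].
  - intros x. auto_derive; [trivial | ring].
  - intros x. nra.
  - intros x. now apply radial_period.
  - intros x. now apply angular_period.
  - intros x. rewrite neg_cos. ring.
  - intros x. rewrite neg_sin, neg_cos. ring.
  - intros x. rewrite nf_angular. unfold radial, on_circle, dot, unit_vec. cbn [fst snd]. unfold nf_LQ, nf_field.
    cbn [fst snd]. pose proof (cos2_sin2 x) as E. pose proof (SIN_bound x). pose proof (COS_bound x).
    set (c := cos x) in *. set (t := sin x) in *.
    assert (P : 0 < 16 * (c * c) + 1) by nra.
    replace (c * (- c * (c ^ 2 + t ^ 2)) + t * (- t * (c ^ 2 + t ^ 2) + 6 * c * t ^ 2) +
      6 * c ^ 2 * t ^ 2 * (- 2 * (t * c) / (2 * (c * c + 1 / 16))))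
      with (- (c * c + t * t) ^ 2 + t * c * (6 * (t * t)) / (16 * (c * c) + 1)) by (field; lra).
    pose proof (modulation_bound c (6 * (t * t)) t ltac:(lra) ltac:(nra) ltac:(lra)) as K.
    apply Rabs_le_between in K. rewrite E. lra.
Qed.

(** Sign of the cofactor in [nf_factored]; [nf_multiplicities] lists the zeros from the smallest one
    in [[0, PI)]. *)
Definition nf_sign (N : normal_form) : pm :=
  match N with
  | NF_II alpha _ | NF_IV alpha | NF_V alpha => alpha
  | _ => Plus
  end.

Definition nf_multiplicities (N : normal_form) : list nat :=
  match N with
  | NF_I _ => [1; 1; 1; 1]
  | NF_II _ _ | NF_VII => []
  | NF_III _ => [1; 1]
  | NF_IV _ => [2]
  | NF_V _ => [2; 1; 1]
  | NF_VI => [2; 2]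
  end%nat.

(** The zeros are the two angles of [[0, PI)] whose tangent has square [t]. *)
Lemma sin2_cos2_factor (t x : R) :
  0 < t ->
  sin x ^ 2 - t * cos x ^ 2 = - (1 + t) * (sin (x - atan (sqrt t)) * sin (x - (PI - atan (sqrt t)))).
Proof.
  intros Ht. set (a := atan (sqrt t)).
  assert (P : 0 < sqrt (1 + (sqrt t)²)) by (apply sqrt_lt_R0; pose proof (Rle_0_sqr (sqrt t)); lra).
  assert (E2 : sqrt (1 + (sqrt t)²) * sqrt (1 + (sqrt t)²) = 1 + t).
  { rewrite sqrt_sqrt by (pose proof (Rle_0_sqr (sqrt t)); lra). rewrite Rsqr_sqrt; lra. }
  assert (Ec : cos a * cos a = / (1 + t)).
  { unfold a. rewrite cos_atan, <- E2. field. lra. }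
  assert (Es : sin a * sin a = t / (1 + t)).
  { pose proof (cos2_sin2 a). rewrite Ec in H. apply Rplus_eq_reg_l with (/ (1 + t)). rewrite H. field. lra. }
  replace (x - (PI - a)) with (x + a - PI) by ring.
  assert (En : sin (x + a - PI) = - sin (x + a)) by (rewrite sin_minus, cos_PI, sin_PI; ring).
  rewrite En, sin_minus, sin_plus.
  replace (- (1 + t) * ((sin x * cos a - cos x * sin a) * - (sin x * cos a + cos x * sin a)))
    with ((1 + t) * (sin x ^ 2 * (cos a * cos a) - cos x ^ 2 * (sin a * sin a))) by ring.
  rewrite Ec, Es. field. lra.
Qed.

Lemma atan_sqrt_bound (t : R) : 0 < t -> 0 < atan (sqrt t) < PI / 2.
Proof.
  intros Ht. pose proof (atan_bound (sqrt t)). split; [| tauto].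
  rewrite <- atan_0. apply atan_increasing. now apply sqrt_lt_R0.
Qed.

Ltac solve_trig :=
  repeat first [apply trig_const | apply trig_sin | apply trig_cos | apply trig_plus | apply trig_mult].

Ltac solve_zeros :=
  repeat match goal with
  | |- Forall _ [] => constructor
  | |- Forall _ (_ :: _) => constructor; [simpl; try unfold fst_lt; simpl; try split; first [lra | lia] |]
  | |- StronglySorted _ [] => constructor
  | |- StronglySorted _ (_ :: _) => constructor
  end.

Lemma nf_factored (N : normal_form) :
  admissible N -> N <> NF_VII ->
  exists l, map snd l = nf_multiplicities N /\ factored (angular (nf_field N)) (nf_sign N) l.
Proof.
  intros HA HN. pose proof PI_RGT_0 as HPI.
  destruct N as [mu | alpha mu | mu | alpha | alpha | |]; simpl in HA; try congruence.
  (* [t1] and [t2] are the roots of [T ^ 2 + 6 * mu * T + 1] in [T = tan ^ 2]: real, distinct and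
     positive because [mu < - 1/3]. *)
  - pose (d := sqrt (9 * (mu * mu) - 1)).
    assert (Hd : d * d = 9 * (mu * mu) - 1) by (apply sqrt_sqrt; nra).
    assert (Hd0 : 0 < d) by (apply sqrt_lt_R0; nra).
    pose (t1 := - 3 * mu - d). pose (t2 := - 3 * mu + d).
    assert (H1 : 0 < t1) by (unfold t1; nra). assert (H2 : t1 < t2) by (unfold t1, t2; lra).
    pose proof (atan_sqrt_bound t1 H1) as B1. pose proof (atan_sqrt_bound t2 ltac:(lra)) as B2.
    assert (B3 : atan (sqrt t1) < atan (sqrt t2)) by (apply atan_increasing, sqrt_lt_1; lra).
    exists [(atan (sqrt t1), 1%nat); (atan (sqrt t2), 1%nat); (PI - atan (sqrt t2), 1%nat); (PI - atan (sqrt t1), 1%nat)].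
    split; [reflexivity |]. split; [solve_zeros | solve_zeros |].
    exists (fun _ => (1 + t1) * (1 + t2)). split; [solve_trig | split].
    + intros _. simpl. assert (0 < (1 + t1) * (1 + t2)) by (apply Rmult_lt_0_compat; lra). lra.
    + intros x. rewrite nf_angular. simpl nf_LQ.
      pose proof (sin2_cos2_factor t1 x H1) as F1. pose proof (sin2_cos2_factor t2 x ltac:(lra)) as F2.
      transitivity ((sin x ^ 2 - t1 * cos x ^ 2) * (sin x ^ 2 - t2 * cos x ^ 2)).
      * unfold t1, t2. transitivity (cos x ^ 4 * (9 * (mu * mu) - d * d) + 6 * mu * cos x ^ 2 * sin x ^ 2 + sin x ^ 4);
          [rewrite Hd |]; ring.
      * rewrite F1, F2. simpl. ring.
  - exists []. split; [reflexivity |]. split; [constructor | constructor |].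
    exists (angular (nf_field (NF_II alpha mu))). split; [apply angular_trig, nf_homogeneous | split].
    + intros x. rewrite nf_angular. simpl nf_LQ. pose proof (cos2_sin2 x) as E.
      assert (K : 0 < cos x ^ 4 + 6 * mu * cos x ^ 2 * sin x ^ 2 + sin x ^ 4).
      { set (c := cos x) in *. set (t := sin x) in *.
        (* On the axes the form equals 1; elsewhere it is a square plus a positive multiple of
           [(c * t) ^ 2], because [mu > - 1/3]. *)
        destruct (Req_dec (c * t) 0) as [Z | Z].
        - replace (c ^ 4 + 6 * mu * c ^ 2 * t ^ 2 + t ^ 4)
            with ((c * c + t * t) ^ 2 + (6 * mu - 2) * ((c * t) * (c * t))) by ring.
          rewrite E, Z. lra.
        - assert (0 < (c * t) * (c * t)) by nra.
          replace (c ^ 4 + 6 * mu * c ^ 2 * t ^ 2 + t ^ 4)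
            with ((c * c - t * t) ^ 2 + (6 * mu + 2) * ((c * t) * (c * t))) by ring.
          pose proof (pow2_ge_0 (c * c - t * t)).
          assert (0 < (6 * mu + 2) * ((c * t) * (c * t))) by (apply Rmult_lt_0_compat; lra). lra. }
      destruct alpha; simpl sign_val; lra.
    + intros x. simpl. ring.
  (* [T ^ 2 - 6 * mu * T - 1] has the roots [t1 > 0] and [- t2 < 0]; only the first is a squared
     tangent, and the second gives the cofactor. *)
  - pose (d := sqrt (9 * (mu * mu) + 1)).
    assert (Hd : d * d = 9 * (mu * mu) + 1) by (apply sqrt_sqrt; nra).
    assert (Hd0 : 0 < d) by (apply sqrt_lt_R0; nra).
    pose (t1 := 3 * mu + d). pose (t2 := - 3 * mu + d).
    assert (H1 : 0 < t1) by (unfold t1; nra). assert (H2 : 0 < t2) by (unfold t2; nra).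
    pose proof (atan_sqrt_bound t1 H1) as B1.
    exists [(atan (sqrt t1), 1%nat); (PI - atan (sqrt t1), 1%nat)].
    split; [reflexivity |]. split; [solve_zeros | solve_zeros |].
    exists (fun x => (1 + t1) * (sin x * sin x + t2 * (cos x * cos x))). split; [solve_trig | split].
    + intros x. simpl. pose proof (cos2_sin2 x).
      assert (0 < sin x * sin x + t2 * (cos x * cos x)).
      { destruct (Req_dec (cos x) 0) as [Z | Z]; [rewrite Z in *; lra |].
        assert (0 < cos x * cos x) by nra. assert (0 < t2 * (cos x * cos x)) by now apply Rmult_lt_0_compat. nra. }
      assert (0 < (1 + t1) * (sin x * sin x + t2 * (cos x * cos x))) by (apply Rmult_lt_0_compat; lra). lra.
    + intros x. rewrite nf_angular. simpl nf_LQ.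
      pose proof (sin2_cos2_factor t1 x H1) as F1.
      transitivity (- (sin x ^ 2 - t1 * cos x ^ 2) * (sin x * sin x + t2 * (cos x * cos x))).
      * unfold t1, t2. transitivity (cos x ^ 4 * (d * d - 9 * (mu * mu)) + 6 * mu * cos x ^ 2 * sin x ^ 2 - sin x ^ 4);
          [rewrite Hd |]; ring.
      * rewrite F1. simpl. ring.
  - exists [(0, 2%nat)]. split; [reflexivity |]. split; [solve_zeros | solve_zeros |].
    exists (fun x => sign_val alpha * (6 * (cos x * cos x) + sin x * sin x)). split; [solve_trig | split].
    + intros x. pose proof (cos2_sin2 x). destruct alpha; simpl; nra.
    + intros x. rewrite nf_angular. simpl nf_LQ. simpl zero_product. rewrite Rminus_0_r. ring.
  - pose proof (atan_sqrt_bound 6 ltac:(lra)) as B1.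
    exists [(0, 2%nat); (atan (sqrt 6), 1%nat); (PI - atan (sqrt 6), 1%nat)].
    split; [reflexivity |]. split; [solve_zeros | solve_zeros |].
    exists (fun x => sign_val alpha * 7). split; [solve_trig | split].
    + intros x. destruct alpha; simpl; lra.
    + intros x. rewrite nf_angular. simpl nf_LQ. simpl zero_product. rewrite Rminus_0_r.
      pose proof (sin2_cos2_factor 6 x ltac:(lra)) as F1.
      transitivity (sign_val alpha * (- (sin x ^ 2 - 6 * cos x ^ 2) * sin x ^ 2)); [ring |].
      rewrite F1. ring.
  - exists [(0, 2%nat); (PI / 2, 2%nat)]. split; [reflexivity |]. split; [solve_zeros | solve_zeros |].
    exists (fun _ => 6). split; [solve_trig | split].
    + intros _. simpl. lra.
    + intros x. rewrite nf_angular. simpl nf_LQ. simpl zero_product. rewrite Rminus_0_r.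
      rewrite sin_minus, cos_PI2, sin_PI2. ring.
Qed.

Lemma cyclic_eq_refl {A : Type} (l : list A) : cyclic_eq l l.
Proof. exists l, []. split; [now rewrite app_nil_r | reflexivity]. Qed.

Lemma nf_symbol_sequence (N : normal_form) :
  admissible N -> symbol_sequence (LQ (nf_field N)) (nf_symbols N).
Proof.
  intros HA. destruct (classic (N = NF_VII)) as [-> | HN].
  - intros X. now rewrite nf_LQ_correct; destruct X.
  - destruct (nf_factored N HA HN) as [l [El H]].
    assert (K : forall t, cyclic_eq (symbol_list (nf_sign N) (map snd l)) t ->
      symbol_sequence (LQ (nf_field N)) (Finite_seq t)).
    { intros t. now apply factored_symbol_sequence. }
    rewrite El in K.
    destruct N as [mu | alpha mu | mu | alpha | alpha | |]; simpl; try congruence; apply K.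
    (* The form is positive at angle 0, so the first zero is a decreasing one and the listed
       sequence begins with the second. *)
    + now exists [(One, Minus)], [(One, Plus); (One, Minus); (One, Plus)].
    + apply cyclic_eq_refl.
    + now exists [(One, Minus)], [(One, Plus)].
    + apply cyclic_eq_refl.
    + apply cyclic_eq_refl.
    + apply cyclic_eq_refl.
Qed.

Lemma nf_portrait_at_infinity (lambda : R) (N : normal_form) :
  admissible N -> portrait_at_infinity simple_zero N lambda (nf_field N).
Proof.
  intros HA. pose proof (nf_homogeneous N) as HQ. destruct (classic (N = NF_VII)) as [-> | HN].
  - intros x Hx. apply infinite_equilibrium_angular; auto. split; auto. now rewrite nf_angular.
  - destruct (nf_factored N HA HN) as [l [El H]].
    assert (K : forall h k, nf_counts N = Some (h, k) ->
      h = (2 * length (filter (fun m => Nat.eqb m 1) (map snd l)))%nat ->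
      k = (2 * length (filter Nat.even (map snd l)))%nat -> (h + k = 2 * length (map snd l))%nat ->
      portrait_at_infinity simple_zero N lambda (nf_field N)).
    { intros h k H1 H2 H3 H4.
      apply (portrait_at_infinity_factored simple_zero (fun m => Nat.eqb m 1) N lambda (nf_field N) (nf_sign N) l h k); auto.
      - intros x. now apply angular_period.
      - apply simple_zero_periodic.
      - apply zero_form_simple. }
    rewrite El in K. destruct N; simpl in *; try congruence; eapply K; reflexivity.
Qed.

Lemma nf_VI_axis (lambda x : R) :
  infinite_equilibrium (system lambda (nf_field NF_VI)) x <-> In x axis_angles.
Proof.
  pose proof (nf_homogeneous NF_VI) as HQ. pose proof PI_RGT_0 as HPI.
  assert (K : forall y, 0 <= y < PI -> (angular (nf_field NF_VI) y = 0 <-> y = 0 \/ y = PI / 2)).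
  { intros y Hy. rewrite nf_angular. simpl nf_LQ. split.
    - intros H. destruct (Req_dec y 0) as [|N0]; auto. destruct (Req_dec y (PI / 2)) as [|N1]; auto. exfalso.
      assert (0 < sin y) by (apply sin_gt_0; lra).
      assert (cos y <> 0).
      { destruct (Rlt_or_le y (PI / 2)) as [L | L]; [apply Rgt_not_eq, cos_gt_0; lra | apply Rlt_not_eq, cos_lt_0; lra]. }
      assert (0 < cos y * cos y) by nra. assert (0 < (cos y * cos y) * (sin y * sin y)) by (apply Rmult_lt_0_compat; nra).
      nra.
    - intros [-> | ->]; [rewrite sin_0 | rewrite cos_PI2]; ring. }
  rewrite infinite_equilibrium_angular by auto. unfold axis_angles. simpl. split.
  - intros [Hx Hg]. destruct (Rlt_or_le x PI) as [L | L].
    + apply K in Hg; [| lra]. destruct Hg as [-> | ->]; auto.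
    + replace x with (x - PI + PI) in Hg by ring. rewrite angular_period in Hg by auto. apply K in Hg; [| lra].
      destruct Hg as [Hg | Hg]; [right; right; left; lra | right; right; right; left; lra].
  - intros Hx. assert (E : forall y, angular (nf_field NF_VI) (y + PI) = angular (nf_field NF_VI) y)
      by (intros; now apply angular_period).
    destruct Hx as [<- | [<- | [<- | [<- | []]]]].
    + split; [lra |]. apply K; [lra | auto].
    + split; [lra |]. apply K; [lra | auto].
    + split; [lra |]. rewrite <- (Rplus_0_l PI), E. apply K; [lra | auto].
    + split; [lra |]. replace (3 * PI / 2) with (PI / 2 + PI) by field. rewrite E. apply K; [lra | auto].
Qed.

(** * Classification *)

(** One admissible parameter in each family: the fields [NF_II] and [NF_III] are not
    contracting for all of them. *)
Definition reference (N : normal_form) : Prop :=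
  match N with
  | NF_I mu => mu = -1
  | NF_II _ mu => mu = 0
  | NF_III mu => mu = - (1 / 12)
  | _ => True
  end.

Lemma reference_admissible (N : normal_form) : reference N -> admissible N.
Proof. destruct N; simpl; intros H; subst; auto; lra. Qed.

Lemma reference_polar_flow (lambda : R) (N : normal_form) :
  0 < lambda -> reference N ->
  exists rho2 B, polar_flow lambda (radial (nf_field N)) (angular (nf_field N)) rho2 B.
Proof.
  intros Hl HR. destruct N; simpl in HR; subst.
  - apply contracting_polar_flow; auto using nf_homogeneous, nf_I_contracting.
  - apply contracting_polar_flow; auto using nf_homogeneous, nf_II_contracting.
  - apply contracting_polar_flow; auto using nf_homogeneous, nf_III_contracting.
  - apply contracting_polar_flow; auto using nf_homogeneous, nf_IV_contracting.
  - now apply nf_V_polar_flow.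
  - now apply nf_VI_polar_flow.
  - apply contracting_polar_flow; auto using nf_homogeneous, nf_VII_contracting.
Qed.

Definition conclusion (lambda : R) (Q : plane -> plane) (N : normal_form) : Prop :=
  admissible N /\
  equivalent (system lambda Q) (system lambda (nf_field N)) /\
  symbols_as N (LQ Q) /\
  portrait_at_infinity (hyperbolic_as N) N lambda Q /\
  (exists C : plane -> Prop,
     the_invariant_circle (system lambda Q) C /\
     portrait_on (hyperbolic_as N) N lambda Q C) /\
  (exists C : plane -> Prop,
     the_invariant_circle (system lambda (nf_field N)) C /\
     portrait_on simple_zero N lambda (nf_field N) C /\
     (N = NF_VI -> forall theta : R, 0 <= theta < 2 * PI ->
        ((exists X : plane,
            equilibrium_on (system lambda (nf_field N)) C X /\
            has_angle X theta) <->
         In theta axis_angles))).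

Lemma hyperbolic_as_periodic (N : normal_form) : periodic_zero_predicate (hyperbolic_as N).
Proof. destruct N; try apply simple_zero_periodic; apply odd_zero_periodic. Qed.

Lemma conclusion_of_conjugacy (lambda : R) (Q : plane -> plane) (N : normal_form) (rho rho' : R -> R)
    (B B' : R -> R -> R) :
  0 < lambda -> homogeneous_cubic Q -> reference N ->
  polar_flow lambda (radial Q) (angular Q) rho B ->
  polar_flow lambda (radial (nf_field N)) (angular (nf_field N)) rho' B' ->
  (exists p eta eta', circle_conjugacy B B' p eta eta') ->
  symbols_as N (LQ Q) -> portrait_at_infinity (hyperbolic_as N) N lambda Q -> conclusion lambda Q N.
Proof.
  intros Hl HQ HR HB HB' [p [eta [eta' Hc]]] Hs Hp. pose proof (nf_homogeneous N) as HQ'.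
  pose proof (reference_admissible N HR) as HA.
  split; [auto |]. split; [eapply equivalent_of_conjugacy; eauto |]. split; [auto |]. split; [auto |]. split.
  - exists (circle rho). split; [eapply the_invariant_circle_polar; eauto |].
    eapply portrait_on_of_infinity; eauto using hyperbolic_as_periodic.
  - exists (circle rho'). split; [eapply the_invariant_circle_polar; eauto |]. split.
    + eapply portrait_on_of_infinity; eauto using simple_zero_periodic, nf_portrait_at_infinity.
    + intros -> x Hx. rewrite <- (nf_VI_axis lambda).
      rewrite infinite_equilibrium_angular by auto. split.
      * intros [X [HE [r [Hr EX]]]]. split; auto.
        apply (equilibrium_on_circle _ _ _ _ _ Hl HQ' HB') in HE. destruct HE as [y [Hy [Gy EY]]].
        assert (P : 0 < sqrt (rho' y)) by (apply sqrt_lt_R0; eapply rho2_pos, HB').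
        change (X = polar r x) in EX. rewrite EX in EY.
        assert (Er : r = sqrt (rho' y)) by (apply (polar_radius_unique _ _ x y); auto; lra).
        rewrite <- Er in EY. unfold polar in EY. injection EY as E1 E2.
        replace x with y; auto. apply unit_vec_injective; auto; eapply Rmult_eq_reg_l with r; lra.
      * intros [_ Gx]. exists (polar (sqrt (rho' x)) x). split.
        -- apply (equilibrium_on_circle _ _ _ _ _ Hl HQ' HB'). exists x. auto.
        -- exists (sqrt (rho' x)). split; [apply sqrt_lt_R0; eapply rho2_pos, HB' | reflexivity].
Qed.

(** The circle flows are conjugate once the cyclic lists of signs agree, either directly or after a
    reflection. The hypotheses on signs and counts are finite computations on the multiplicities. *)
Lemma factored_conclusion (lambda : R) (Q : plane -> plane) (N : normal_form) (rho : R -> R) (B : R -> R -> R)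
    (s : pm) (l : list (R * nat)) (l1 l2 : list pm) (h k : nat) :
  0 < lambda -> homogeneous_cubic Q -> polar_flow lambda (radial Q) (angular Q) rho B ->
  factored (angular Q) s l -> map snd l <> [] -> reference N -> nf_multiplicities N <> [] ->
  sign_list s (map snd l) = l1 ++ l2 ->
  sign_list (nf_sign N) (nf_multiplicities N) = l2 ++ l1 \/
    sign_list (nf_sign N) (nf_multiplicities N) = rev (map opp_sign (l1 ++ l2)) ->
  symbols_as N (LQ Q) -> nf_counts N = Some (h, k) ->
  h = (2 * length (filter (match N with NF_III _ => Nat.odd | _ => fun m => Nat.eqb m 1 end) (map snd l)))%nat ->
  k = (2 * length (filter Nat.even (map snd l)))%nat -> (h + k = 2 * length (map snd l))%nat ->
  conclusion lambda Q N.
Proof.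
  intros Hl HQ HB Hf Hne HR Hne' Hs Hs' Hsym Hc Hh Hk Hhk.
  assert (HA := reference_admissible N HR).
  assert (N <> NF_VII) as H7 by (intros ->; now apply Hne').
  destruct (nf_factored N HA H7) as [l' [El' Hf']].
  destruct (reference_polar_flow lambda N Hl HR) as [rho' [B' HB']].
  pose proof (nf_homogeneous N) as HQ'.
  assert (Pg : forall x, angular Q (x + PI) = angular Q x) by (intros; now apply angular_period).
  assert (Pg' : forall x, angular (nf_field N) (x + PI) = angular (nf_field N) x) by (intros; now apply angular_period).
  assert (Cg : forall x, continuous (angular Q) x) by (intros; now apply trig_continuous, angular_trig).
  assert (Cg' : forall x, continuous (angular (nf_field N)) x) by (intros; now apply trig_continuous, angular_trig).
  assert (Ch : exists a, chain (angular Q) a (l1 ++ l2) (a + PI)).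
  { rewrite <- Hs, <- signs_sign_list. destruct l as [| [z m] l0]; [now elim Hne |].
    exists z. now apply factored_chain. }
  assert (Ch' : exists a, chain (angular (nf_field N)) a (sign_list (nf_sign N) (nf_multiplicities N)) (a + PI)).
  { rewrite <- El', <- signs_sign_list. destruct l' as [| [z m] l0]; [now elim Hne' |].
    exists z. now apply factored_chain. }
  destruct Ch as [a Ch]. destruct Ch' as [a' Ch'].
  apply (conclusion_of_conjugacy lambda Q N rho rho' B B'); auto.
  - destruct Hs' as [Hs' | Hs']; rewrite Hs' in Ch'.
    + destruct (chain_rotate _ _ _ _ Pg Ch) as [b Chb].
      eapply (circle_conjugacy_chain lambda); [exact Hl | exact HB | exact HB' | exact Cg | exact Cg' | exact Chb | exact Ch'].
    + apply chain_reflect in Ch.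
      assert (Ec : - a = - (a + PI) + PI) by ring. rewrite Ec in Ch.
      assert (Hconj : exists p eta eta', circle_conjugacy (fun x y => - B (- x) y) B' p eta eta').
      { eapply (circle_conjugacy_chain lambda);
          [exact Hl | apply polar_flow_reflect, HB | exact HB' | | exact Cg' | exact Ch | exact Ch'].
        intros z. apply (continuous_opp (fun x => angular Q (- x))).
        apply (continuous_comp_real Ropp (angular Q)); auto.
        apply (continuous_opp (fun y : R => y)), continuous_id. }
      destruct Hconj as [p [eta [eta' Hconj]]].
      exists p, (fun x => eta (- x)), (fun x => - eta' x). now apply circle_conjugacy_reflect.
  - apply (portrait_at_infinity_factored (hyperbolic_as N)
      (match N with NF_III _ => Nat.odd | _ => fun m => Nat.eqb m 1 end) N lambda Q s l h k); auto.
    + apply hyperbolic_as_periodic.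
    + destruct N; try apply zero_form_simple; apply zero_form_odd.
Qed.

(** These are the compositions of 0, 2 and 4. Signs depend only on parities, so a fourfold zero
    behaves as a double one and a triple zero as a simple one. *)
Lemma small_multiplicities (ms : list nat) :
  Forall (fun m => (0 < m)%nat) ms -> (list_sum ms = 0 \/ list_sum ms = 2 \/ list_sum ms = 4)%nat ->
  In ms [[]; [2]; [4]; [1; 1]; [1; 3]; [3; 1]; [2; 2]; [2; 1; 1]; [1; 2; 1]; [1; 1; 2]; [1; 1; 1; 1]]%nat.
Proof.
  intros H Hs.
  destruct ms as [| m1 [| m2 [| m3 [| m4 [| m5 r]]]]]; repeat apply Forall_cons_iff in H as [? H]; simpl in Hs.
  - now left.
  - assert (m1 = 2 \/ m1 = 4)%nat as [-> | ->] by lia; simpl; tauto.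
  - assert ((m1 = 1 /\ m2 = 1) \/ (m1 = 1 /\ m2 = 3) \/ (m1 = 3 /\ m2 = 1) \/ (m1 = 2 /\ m2 = 2))%nat
      as [[-> ->] | [[-> ->] | [[-> ->] | [-> ->]]]] by lia; simpl; tauto.
  - assert ((m1 = 2 /\ m2 = 1 /\ m3 = 1) \/ (m1 = 1 /\ m2 = 2 /\ m3 = 1) \/ (m1 = 1 /\ m2 = 1 /\ m3 = 2))%nat
      as [[-> [-> ->]] | [[-> [-> ->]] | [-> [-> ->]]]] by lia; simpl; tauto.
  - assert (m1 = 1 /\ m2 = 1 /\ m3 = 1 /\ m4 = 1)%nat as [-> [-> [-> ->]]] by lia; simpl; tauto.
  - lia.
Qed.

Lemma classification (lambda : R) (Q : plane -> plane) :
  0 < lambda -> homogeneous_cubic Q -> contracting Q -> exists N, conclusion lambda Q N.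
Proof.
  intros Hl HQ HC. destruct (contracting_polar_flow lambda Q Hl HQ HC) as [rho [B HB]].
  destruct (classic (exists x, angular Q x <> 0)) as [Hnz | Hz].
  - destruct (quartic_trig_form_factored (angular Q)) as [s [l [Hf Hdeg]]]; auto.
    { now apply radial_angular_trig_form. }
    assert (Hpos : Forall (fun m => (0 < m)%nat) (map snd l)).
    { rewrite Forall_map. eapply Forall_impl; [| exact (fa_range _ _ _ Hf)]. simpl. tauto. }
    pose proof (small_multiplicities _ Hpos Hdeg) as Hms.
    assert (Sym : forall N t, nf_symbols N = Finite_seq t -> cyclic_eq (symbol_list s (map snd l)) t -> symbols_as N (LQ Q)).
    { intros N t E Ht. left. rewrite E. now apply (factored_symbol_sequence (LQ Q) s l). }
    (* [i] rotates the signs of [Q] to those of the normal form, [j] rotates its symbols to the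
       listed sequence; the two rotations may differ. *)
    assert (Main : forall N i j t h k, map snd l <> [] -> reference N -> nf_multiplicities N <> [] ->
      sign_list (nf_sign N) (nf_multiplicities N) = skipn i (sign_list s (map snd l)) ++ firstn i (sign_list s (map snd l)) ->
      nf_symbols N = Finite_seq t -> t = skipn j (symbol_list s (map snd l)) ++ firstn j (symbol_list s (map snd l)) ->
      nf_counts N = Some (h, k) ->
      h = (2 * length (filter (match N with NF_III _ => Nat.odd | _ => fun m => Nat.eqb m 1 end) (map snd l)))%nat ->
      k = (2 * length (filter Nat.even (map snd l)))%nat -> (h + k = 2 * length (map snd l))%nat ->
      exists N, conclusion lambda Q N).
    { intros N i j t h k H1 H2 H3 H4 H5 H6 H7 H8 H9 H10. exists N.
      apply (factored_conclusion lambda Q N rho B s l (firstn i (sign_list s (map snd l))) (skipn i (sign_list s (map snd l))) h k); auto.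
      - now rewrite firstn_skipn.
      - apply (Sym N t); auto. exists (firstn j (symbol_list s (map snd l))), (skipn j (symbol_list s (map snd l))).
        split; auto. now rewrite firstn_skipn. }
    destruct (map snd l) as [| m0 ms] eqn:El.
    + clear Main. exists (NF_II s 0). destruct l; [| discriminate].
      destruct (reference_polar_flow lambda (NF_II s 0) Hl eq_refl) as [rho' [B' HB']].
      pose proof (nf_homogeneous (NF_II s 0)) as HQ'.
      destruct (nf_factored (NF_II s 0)) as [l' [El' Hf']]; [simpl; lra | discriminate |].
      destruct l'; [| discriminate].
      assert (Sg : forall g t, factored g t [] -> forall x, 0 < sign_val t * g x).
      { intros g t [_ _ [q [_ [Hq Hg]]]] x. rewrite Hg. simpl. rewrite Rmult_1_r. auto. }
      apply (conclusion_of_conjugacy lambda Q (NF_II s 0) rho rho' B B'); auto.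
      * reflexivity.
      * eapply (circle_conjugacy_rotation lambda); [exact Hl | exact HB | exact HB' | | | apply Sg, Hf | apply Sg, Hf'];
          intros; now apply trig_continuous, angular_trig.
      * apply (Sym (NF_II s 0) []); [reflexivity | apply cyclic_eq_refl].
      * apply (portrait_at_infinity_factored simple_zero (fun m => Nat.eqb m 1) (NF_II s 0) lambda Q s [] 0 0); auto.
        -- intros x. now apply angular_period.
        -- apply simple_zero_periodic.
        -- apply zero_form_simple.
    + assert (Hne : map snd l <> []) by (rewrite El; discriminate).
      rewrite <- El in *. clear m0 ms El.
      simpl In in Hms.
      destruct Hms as [E | [E | [E | [E | [E | [E | [E | [E | [E | [E | [E | []]]]]]]]]]]];
        rewrite <- E in Main, Sym.
      * rewrite <- E in Hne. now elim Hne.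
      * apply (Main (NF_IV s) 0 0 [(Two, s)] 0 2)%nat; first [discriminate | reflexivity | exact I].
      * apply (Main (NF_IV s) 0 0 [(Two, s)] 0 2)%nat; first [discriminate | reflexivity | exact I].
      * destruct s;
          [apply (Main (NF_III (- (1 / 12))) 0%nat 1%nat [(One, Plus); (One, Minus)] 4%nat 0%nat)
          |apply (Main (NF_III (- (1 / 12))) 1%nat 0%nat [(One, Plus); (One, Minus)] 4%nat 0%nat)];
          first [discriminate | reflexivity].
      * destruct s;
          [apply (Main (NF_III (- (1 / 12))) 0%nat 1%nat [(One, Plus); (One, Minus)] 4%nat 0%nat)
          |apply (Main (NF_III (- (1 / 12))) 1%nat 0%nat [(One, Plus); (One, Minus)] 4%nat 0%nat)];
          first [discriminate | reflexivity].
      * destruct s;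
          [apply (Main (NF_III (- (1 / 12))) 0%nat 1%nat [(One, Plus); (One, Minus)] 4%nat 0%nat)
          |apply (Main (NF_III (- (1 / 12))) 1%nat 0%nat [(One, Plus); (One, Minus)] 4%nat 0%nat)];
          first [discriminate | reflexivity].
      * destruct s.
        -- apply (Main NF_VI 0 0 [(Two, Plus); (Two, Plus)] 0 4)%nat; first [discriminate | reflexivity | exact I].
        (* Two double zeros with [g <= 0]: no rotation changes these signs, and the reflected
           alternative is used. *)
        -- exists NF_VI.
           apply (factored_conclusion lambda Q NF_VI rho B Minus l [] [Minus; Minus] 0 4)%nat; auto;
             try rewrite <- E; try discriminate; try reflexivity.
           right. split; [reflexivity |]. apply (factored_symbol_sequence (LQ Q) Minus l); auto.
           rewrite <- E. apply cyclic_eq_refl.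
      * apply (Main (NF_V s) 0 0 [(Two, s); (One, opp_sign s); (One, s)] 4 2)%nat;
          destruct s; first [discriminate | reflexivity | exact I].
      (* After the double zero there is one sign change before the end of the half-turn, so its sign
         is opposite to [s]. *)
      * apply (Main (NF_V (opp_sign s)) 1 1 [(Two, opp_sign s); (One, s); (One, opp_sign s)] 4 2)%nat;
          destruct s; first [discriminate | reflexivity | exact I].
      * apply (Main (NF_V s) 2 2 [(Two, s); (One, opp_sign s); (One, s)] 4 2)%nat;
          destruct s; first [discriminate | reflexivity | exact I].
      * destruct s;
          [apply (Main (NF_I (-1)) 0%nat 1%nat [(One, Plus); (One, Minus); (One, Plus); (One, Minus)] 8%nat 0%nat)
          |apply (Main (NF_I (-1)) 1%nat 0%nat [(One, Plus); (One, Minus); (One, Plus); (One, Minus)] 8%nat 0%nat)];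
          first [discriminate | reflexivity].
  - assert (Hz' : forall x, angular Q x = 0).
    { intros x. apply NNPP. intros N. apply Hz. now exists x. }
    destruct (reference_polar_flow lambda NF_VII Hl I) as [rho' [B' HB']].
    exists NF_VII. apply (conclusion_of_conjugacy lambda Q NF_VII rho rho' B B'); auto.
    + exact I.
    + eapply circle_conjugacy_fixed; [exact HB | exact HB' | exact Hz' |]. intros x. now rewrite nf_angular.
    (* By homogeneity the vanishing of [LQ] on the unit circle extends to the plane. *)
    + left. intros X. destruct (polar_coordinates X) as [r [x [_ [_ ->]]]].
      destruct (homogeneous_cubic_polar Q r x HQ) as [E1 E2].
      unfold LQ, dot, perp. cbn [fst snd]. rewrite E1, E2, Hz'. unfold polar. cbn [fst snd]. ring.
    + intros x Hx. now apply infinite_equilibrium_angular.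
Qed.

Theorem theorem7p2 (lambda : R) (hlambda : 0 < lambda) :
  (forall N : normal_form, admissible N ->
     (forall X : plane, LQ (nf_field N) X = nf_LQ N X) /\
     symbol_sequence (LQ (nf_field N)) (nf_symbols N) /\
     portrait_at_infinity simple_zero N lambda (nf_field N) /\
     (N = NF_VI -> forall theta : R,
        infinite_equilibrium (system lambda (nf_field N)) theta <->
        In theta axis_angles))
  /\
  (forall Q : plane -> plane, homogeneous_cubic Q -> contracting Q ->
     exists N : normal_form,
       admissible N /\
       equivalent (system lambda Q) (system lambda (nf_field N)) /\
       symbols_as N (LQ Q) /\
       portrait_at_infinity (hyperbolic_as N) N lambda Q /\
       (exists C : plane -> Prop,
          the_invariant_circle (system lambda Q) C /\
          portrait_on (hyperbolic_as N) N lambda Q C) /\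
       (exists C : plane -> Prop,
          the_invariant_circle (system lambda (nf_field N)) C /\
          portrait_on simple_zero N lambda (nf_field N) C /\
          (N = NF_VI -> forall theta : R, 0 <= theta < 2 * PI ->
             ((exists X : plane,
                 equilibrium_on (system lambda (nf_field N)) C X /\
                 has_angle X theta) <->
              In theta axis_angles)))).
Proof.
  split.
  - intros N HA. split; [| split; [| split]].
    + intros X. apply nf_LQ_correct.
    + now apply nf_symbol_sequence.
    + now apply nf_portrait_at_infinity.
    + intros -> x. apply nf_VI_axis.
  - intros Q HQ HC. exact (classification lambda Q hlambda HQ HC).
Qed.
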